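(* Let $A$ be an invertible even linear operator in a $p|q$-dimensional superspace $V$ over $\mathcal A$. For $k\in\mathbb Z$ put $$\gamma_k=c_k-c_k^*,\qquad c_k=\operatorname{Tr}\Lambda^kA,\qquad c_k^*=\operatorname{Tr}\Sigma^{q+k}A .$$ Then the sequence $(\gamma_k)_{k\in\mathbb Z}$ is a recurrent sequence with period $q$ for all $k\in\mathbb Z$, in the following sense. (i) If $A$ is in general position, then there are elements $b_0=1,b_1,\dots,b_q\in\mathcal A_0$ such that $$b_0\gamma_{k+q}+b_1\gamma_{k+q-1}+\dots+b_q\gamma_k=0\qquad\text{for all }k\in\mathbb Z .$$ (ii) In closed form, for every invertible even operator $A$, $$\begin{vmatrix}\gamma_k&\dots&\gamma_{k+q}\\ \dots&\dots&\dots\\ \gamma_{k+q}&\dots&\gamma_{k+2q}\end{vmatrix}=0\qquad\text{for all }k\in\mathbb Z,$$ where the determinant is the Hankel determinant $\det(\gamma_{k+i+j})_{0\le i,j\le q}$.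
   Context: Let $\mathcal A=\mathcal A_0\oplus\mathcal A_1$ be a $\mathbb Z_2$-graded supercommutative algebra over $\mathbb C$. A $p|q$-dimensional superspace $V$ means a free $\mathbb Z_2$-graded $\mathcal A$-module of rank $p|q$. An even operator $A$ is given by a block matrix $\begin{pmatrix} A_{00} & A_{01} \\ A_{10} & A_{11} \end{pmatrix}$, where $A_{00}$ ($p\times p$) and $A_{11}$ ($q\times q$) have entries in $\mathcal A_0$ and $A_{01},A_{10}$ have entries in $\mathcal A_1$. $\operatorname{Tr}$ denotes the supertrace, $\operatorname{Tr}A=\operatorname{Tr}A_{00}-\operatorname{Tr}A_{11}$. The Berezinian is $\operatorname{Ber}A=\det(A_{00}-A_{01}A_{11}^{-1}A_{10})\,(\det A_{11})^{-1}$. $\Lambda^kV$ is the $k$-th exterior power in the super sense: the degree-$k$ part of the quotient of the tensor algebra $T(V)$ by the ideal generated by $v\otimes u+(-1)^{\tilde v\tilde u}u\otimes v$ for homogeneous $u,v$ of parities $\tilde u,\tilde v$, with $\mathbb Z_2$-grading inherited from $V$. $\Lambda^kA$ is the induced operator, and $\Lambda^kV=0$ for $k<0$. $\Sigma^kV=\operatorname{Ber}V\otimes\Lambda^{p-k}V^*$ and $\operatorname{Tr}\Sigma^kA=\operatorname{Ber}A\cdot\operatorname{Tr}\Lambda^{p-k}(A^{-1})$. Thus $c_k=0$ for $k<0$, $c_0=1$, and $c_k^*=\operatorname{Ber}A\cdot\operatorname{Tr}\Lambda^{p-q-k}(A^{-1})$ vanishes for $k>p-q$. The operator $A$ is in general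 position if its characteristic function $R_A(z)=\operatorname{Ber}(1+zA)$ can be written as a fraction $\dfrac{1+a_1z+\dots+a_pz^p}{1+b_1z+\dots+b_qz^q}$ with $a_i,b_j\in\mathcal A_0$, whose top coefficients $a_p$ and $b_q$ are invertible. *)

(* Defs.v *)
From HB Require Import structures.
From mathcomp Require Export all_boot all_order all_fingroup all_algebra.
From mathcomp Require Export boolp classical_sets reals.
From mathcomp Require Export complex.

Set Implicit Arguments.
Unset Strict Implicit.
Unset Printing Implicit Defensive.

Import GRing.Theory.
Local Open Scope ring_scope.

(* Parities are booleans: [false] is even, [true] is odd, [(+)] is addition. *)
Record supercommutative (C : fieldType) (A : algType C)
    (gA : bool -> {pred A}) : Prop := Supercommutative {
  super_submod : forall e : bool, submod_closed (gA e);
  super_decomp : forall x : A,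
    exists2 x0, x0 \in gA false & exists2 x1, x1 \in gA true & x = x0 + x1;
  super_direct : forall x : A, x \in gA false -> x \in gA true -> x = 0;
  super_one : 1 \in gA false;
  super_mul : forall (d e : bool) (x y : A),
    x \in gA d -> y \in gA e -> x * y \in gA (d (+) e);
  super_comm : forall (d e : bool) (x y : A),
    x \in gA d -> y \in gA e -> x * y = (-1) ^+ (d && e) * (y * x)
}.

(* Two-sided inverses in arbitrary rings; the value is 0 if there is none. *)
Definition elt_invertible (T : pzRingType) (x : T) : Prop :=
  exists y : T, x * y = 1 /\ y * x = 1.

Definition elt_inv (T : pzRingType) (x : T) : T :=
  xget 0 [set y : T | x * y = 1 /\ y * x = 1]%classic.

Definition mx_invertible (T : pzRingType) (n : nat) (M : 'M[T]_n) : Prop :=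
  exists N : 'M[T]_n, M *m N = 1%:M /\ N *m M = 1%:M.

Definition mx_inv (T : pzRingType) (n : nat) (M : 'M[T]_n) : 'M[T]_n :=
  xget 0 [set N : 'M[T]_n | M *m N = 1%:M /\ N *m M = 1%:M]%classic.

(* Used only when M is even, so that both determinants are taken over the
   commuting even elements and the Leibniz formula is unambiguous. *)
Definition Ber (T : pzRingType) (p q : nat) (M : 'M[T]_(p + q)) : T :=
  \det (ulsubmx M - ursubmx M *m mx_inv (drsubmx M) *m dlsubmx M)
  * elt_inv (\det (drsubmx M)).

(* The ring T[[z]] of formal power series in a central (even) variable z. *)
Definition pseries (T : Type) : Type := nat -> T.

HB.instance Definition _ (T : Type) := gen_eqMixin (pseries T).
HB.instance Definition _ (T : Type) := gen_choiceMixin (pseries T).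

Section PowerSeriesRing.
Context (T : nzRingType).
Implicit Types f g h : pseries T.

Definition ps_zero : pseries T := fun=> 0.
Definition ps_opp f : pseries T := fun n => - f n.
Definition ps_add f g : pseries T := fun n => f n + g n.
Definition ps_one : pseries T := fun n => (n == 0%N)%:R.
Definition ps_mul f g : pseries T := fun n => \sum_(i < n.+1) f i * g (n - i)%N.

Fact ps_addA : associative ps_add.
Proof. by move=> f g h; apply/funext => n; apply: addrA. Qed.
Fact ps_addC : commutative ps_add.
Proof. by move=> f g; apply/funext => n; apply: addrC. Qed.
Fact ps_add0 : left_id ps_zero ps_add.
Proof. by move=> f; apply/funext => n; apply: add0r. Qed.
Fact ps_addN : left_inverse ps_zero ps_opp ps_add.
Proof. by move=> f; apply/funext => n; apply: addNr. Qed.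

HB.instance Definition _ := GRing.isZmodule.Build (pseries T)
  ps_addA ps_addC ps_add0 ps_addN.

Definition ps_trunc (m : nat) f : {poly T} := \poly_(i < m) f i.

Fact ps_mulE f g n m : (n < m)%N ->
  ps_mul f g n = (ps_trunc m f * ps_trunc m g)`_n.
Proof.
move=> nm; rewrite coefM; apply: eq_bigr => i _.
rewrite !coef_poly (leq_ltn_trans _ nm) ?leq_ord//.
by rewrite (leq_ltn_trans (leq_subr _ _) nm).
Qed.

Fact ps_mulA : associative ps_mul.
Proof.
move=> f g h; apply/funext => n; rewrite /ps_mul.
transitivity ((ps_trunc n.+1 f * (ps_trunc n.+1 g * ps_trunc n.+1 h))`_n).
  rewrite coefM; apply: eq_bigr => i _.
  rewrite coef_poly ltn_ord -(@ps_mulE g h) // ltnS; exact: leq_subr.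
rewrite mulrA coefM; apply: eq_bigr => i _.
by rewrite -(@ps_mulE f g) // coef_poly ltnS leq_subr.
Qed.
Fact ps_mul1l : left_id ps_one ps_mul.
Proof.
move=> f; apply/funext => n; rewrite /ps_mul big_ord_recl /= mul1r subn0.
by rewrite big1 ?addr0// => i _; rewrite /ps_one /= mul0r.
Qed.
Fact ps_mul1r : right_id ps_one ps_mul.
Proof.
move=> f; apply/funext => n; rewrite /ps_mul big_ord_recr /= subnn mulr1.
rewrite big1 ?add0r// => i _; rewrite /ps_one subn_eq0 leqNgt ltn_ord /=.
by rewrite mulr0.
Qed.
Fact ps_mulDl : left_distributive ps_mul ps_add.
Proof.
move=> f g h; apply/funext => n; rewrite /ps_mul /ps_add -big_split /=.
by apply: eq_bigr => i _; rewrite mulrDl.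
Qed.
Fact ps_mulDr : right_distributive ps_mul ps_add.
Proof.
move=> f g h; apply/funext => n; rewrite /ps_mul /ps_add -big_split /=.
by apply: eq_bigr => i _; rewrite mulrDr.
Qed.
Fact ps_one_neq0 : ps_one != 0 :> pseries T.
Proof.
apply/eqP => /(congr1 (fun f : pseries T => f 0%N)).
by apply/eqP; rewrite /ps_one /= oner_neq0.
Qed.

HB.instance Definition _ := GRing.Zmodule_isNzRing.Build (pseries T)
  ps_mulA ps_mul1l ps_mul1r ps_mulDl ps_mulDr ps_one_neq0.

Definition ps_of_poly (P : {poly T}) : pseries T := fun n => P`_n.

End PowerSeriesRing.

(* Ber (1 + zM), an element of T[[z]]. *)
Definition charfun (T : nzRingType) (p q : nat) (M : 'M[T]_(p + q)) :
    pseries T :=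
  Ber (map_mx (@ps_of_poly T) (1%:M + 'X *: map_mx (@polyC T) M)).

(* V is the free module with basis e_i, i < p + q, where e_i is even for i < p
   and odd for p <= i. Coordinates are written on the right: the column v
   stands for \sum_i e_i v_i. An operator M sends e_j to \sum_i e_i M_ij, so it
   acts on columns by v |-> M *m v. *)
Definition ipar (p q : nat) (i : 'I_(p + q)) : bool := (p <= i)%N.

Definition even_op (C : fieldType) (A : algType C) (gA : bool -> {pred A})
    (p q : nat) (M : 'M[A]_(p + q)) : Prop :=
  forall i j, M i j \in gA (ipar i (+) ipar j).

Definition vec_par (C : fieldType) (A : algType C) (gA : bool -> {pred A})
    (p q : nat) (s : bool) (v : 'cV[A]_(p + q)) : Prop :=
  forall i, v i 0 \in gA (s (+) ipar i).

(* The k-th tensor power of V: the free module with basis the words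
   e_w = e_{w 0} (x) ... (x) e_{w (k-1)}, coordinates again on the right. *)
Definition tensor (A : pzRingType) (p q k : nat) : Type :=
  {ffun {ffun 'I_k -> 'I_(p + q)} -> A}.

Definition wpar (p q k : nat) (w : {ffun 'I_k -> 'I_(p + q)}) : bool :=
  \big[addb/false]_(i < k) ipar (w i).

Definition tscale (A : pzRingType) (p q k : nat) (x : tensor A p q k) (a : A) :
  tensor A p q k := [ffun w => x w * a].

Definition tensor_par (C : fieldType) (A : algType C) (gA : bool -> {pred A})
    (p q k : nat) (d : bool) (x : tensor A p q k) : Prop :=
  forall w, x w \in gA (d (+) wpar w).

(* v_0 (x) ... (x) v_{k-1} for homogeneous vectors v_i of parities s_i. The
   coordinate of v_i along e_{w i} has parity s_i + |w i|; moving it to the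
   right past e_{w j} for all j > i produces the sign. *)
Definition pure_tensor (A : pzRingType) (p q k : nat)
    (s : 'I_k -> bool) (v : 'I_k -> 'cV[A]_(p + q)) : tensor A p q k :=
  [ffun w : {ffun 'I_k -> 'I_(p + q)} =>
    (-1) ^+ (\sum_(i < k) \sum_(j < k | (i < j)%N)
               ((s i (+) ipar (w i)) && ipar (w j)))%N
    * \prod_(i < k) v i (w i) 0].

(* The k-th tensor power of an even operator M:
   e_w |-> M e_{w 0} (x) ... (x) M e_{w (k-1)}, extended right-linearly. *)
Definition tensor_op (A : pzRingType) (p q k : nat) (M : 'M[A]_(p + q))
    (x : tensor A p q k) : tensor A p q k :=
  \sum_(w : {ffun 'I_k -> 'I_(p + q)})
    tscale (pure_tensor (fun i => ipar (w i)) (fun i => col (w i) M)) (x w).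

(* The degree k part of the two-sided ideal of T(V) generated by
   v (x) u + (-1)^(|v||u|) u (x) v. It is spanned by the products
   t (x) (v (x) u + (-1)^(|v||u|) u (x) v) (x) t' where t and t' may be taken
   to be pure tensors of homogeneous vectors; here v and u are the factors
   number i and j = i + 1. *)
Inductive ext_ideal (C : fieldType) (A : algType C) (gA : bool -> {pred A})
    (p q k : nat) : tensor A p q k -> Prop :=
| ext_ideal_gen (s : 'I_k -> bool) (v : 'I_k -> 'cV[A]_(p + q)) (i j : 'I_k) :
    (forall l, vec_par gA (s l) (v l)) ->
    j = i.+1 :> nat ->
    ext_ideal gA (pure_tensor s v
      + tscale (pure_tensor (s \o tperm i j) (v \o tperm i j))
               ((-1) ^+ (s i && s j)))
| ext_ideal_zero : ext_ideal gA 0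
| ext_ideal_add (x y : tensor A p q k) :
    ext_ideal gA x -> ext_ideal gA y -> ext_ideal gA (x + y)
| ext_ideal_scale (x : tensor A p q k) (a : A) :
    ext_ideal gA x -> ext_ideal gA (tscale x a).

(* Lambda^k V is [tensor A p q k] modulo [ext_ideal]; its elements are handled
   through representatives. *)
Definition ext_eq (C : fieldType) (A : algType C) (gA : bool -> {pred A})
    (p q k : nat) (x y : tensor A p q k) : Prop := ext_ideal gA (x - y).

Definition tcomb (A : pzRingType) (p q k n : nat)
    (E : 'I_n -> tensor A p q k) (a : 'I_n -> A) : tensor A p q k :=
  \sum_(j < n) tscale (E j) (a j).

(* The classes of the E_j form a basis of Lambda^k V, E_j being homogeneous of
   parity d_j. *)
Definition ext_basis (C : fieldType) (A : algType C) (gA : bool -> {pred A})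
    (p q k n : nat) (d : 'I_n -> bool) (E : 'I_n -> tensor A p q k) : Prop :=
  [/\ forall j, tensor_par gA (d j) (E j),
      forall x, exists a : 'I_n -> A, ext_eq gA x (tcomb E a)
    & forall a : 'I_n -> A, ext_ideal gA (tcomb E a) -> forall j, a j = 0].

(* t is the supertrace of the operator Lambda^k M induced on Lambda^k V,
   computed from its matrix L in some homogeneous basis. *)
Definition is_strLambda (C : fieldType) (A : algType C) (gA : bool -> {pred A})
    (p q k : nat) (M : 'M[A]_(p + q)) (t : A) : Prop :=
  exists (n : nat) (d : 'I_n -> bool) (E : 'I_n -> tensor A p q k)
         (L : 'M[A]_n),
    [/\ ext_basis gA d E,
        forall j, ext_eq gA (tensor_op M (E j)) (tcomb E (fun i => L i j))
      & t = \sum_(j < n) (-1) ^+ (d j) * L j j].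

(* Lambda^k V = 0 for k < 0. *)
Definition strLambda (C : fieldType) (A : algType C) (gA : bool -> {pred A})
    (p q : nat) (k : int) (M : 'M[A]_(p + q)) : A :=
  match k with
  | Posz m => xget 0 [set t : A | is_strLambda gA m M t]%classic
  | Negz _ => 0
  end.

(* Sigma^k V = Ber V (x) Lambda^(p-k) V^*, and M acts on V^* by the transpose of
   its inverse. *)
Definition strSigma (C : fieldType) (A : algType C) (gA : bool -> {pred A})
    (p q : nat) (k : int) (M : 'M[A]_(p + q)) : A :=
  Ber M * strLambda gA (p%:Z - k) (mx_inv M).

Definition gam (C : fieldType) (A : algType C) (gA : bool -> {pred A})
    (p q : nat) (M : 'M[A]_(p + q)) (k : int) : A :=
  strLambda gA k M - strSigma gA (q%:Z + k) M.

Definition general_position (C : fieldType) (A : algType C)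
    (gA : bool -> {pred A}) (p q : nat) (M : 'M[A]_(p + q)) : Prop :=
  exists a b : {poly A},
    [/\ [/\ (size a <= p.+1)%N, a`_0 = 1, elt_invertible a`_p
          & forall i, a`_i \in gA false],
        [/\ (size b <= q.+1)%N, b`_0 = 1, elt_invertible b`_q
          & forall i, b`_i \in gA false]
      & charfun M = ps_of_poly a * elt_inv (ps_of_poly b)].

(* Main.v *)
(* Symmetrization identifies the degree k part of the exterior ideal with the
   kernel of the signed symmetrizer, so that c_k = str (Lambda^k M) can be computed
   in the tensor power; cyclicity of this supertrace gives Newton's identities
   k c_k = \sum_j (-1)^j str (M^(j+1)) c_(k-1-j). Since
   d Ber N = Ber N str (dN N^-1), the coefficients of Ber (1 + z M) and of
   Ber (M + z) / Ber M satisfy the same recursions, and therefore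
   Ber (1 + z M) = \sum_k c_k z^k and Ber (M + z) = \sum_n c*_(p-q-n) z^n.

   Both series are fractions, with numerators and denominators exchanged by
   z -> 1/z. Hence a recursion of order q satisfied by (c_k) beyond degree p is
   matched by one for (c*_k), and the two cancel in gamma: this is (i).

   For (ii), after clearing denominators the Hankel determinant is a polynomial in
   the even entries of M and the products of its odd entries. On the line
   D + s (M - D), with D = diag(0, 1), this polynomial in s is zero as a power
   series, because D + s (M - D) is conjugate over power series in s to a block
   diagonal matrix, for which Ber (1 + z .) is a fraction det / det with
   denominator of degree q. Hence it is also zero at s = 1. *)
From HB Require Import structures.
Require Import Defs.
From mathcomp Require Import zify.
Set Implicit Arguments.
Unset Strict Implicit.
Unset Printing Implicit Defensive.
Import GRing.Theory.
Local Open Scope ring_scope.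

(** In (ii) the obstacle is that Ber (1 + z M) need not be a fraction of degrees p and q: for p = q
    = 1 with equal diagonal entries it is none as soon as the product of the two odd entries is
    nonzero. Clearing denominators directly gives [Nf] / [Qf], whose denominator has formal degree q
    (p + 1), and hence too long a recursion. The degree drops once the spectra of the diagonal
    blocks are separated. This is why the deformation starts at diag(0, 1): the commutator with it
    is invertible on off-diagonal blocks.

    This dictates the generality. The axioms below pass to power series, so the results on Ber can
    be used over series in s, and again over series in z with such coefficients. Odd entries enter
    the cleared Hankel determinant only through their products, which lie in the commutative ring
    [evenT]; the determinant is then natural for ring morphisms, and s = 1 is one of them.

    Characteristic zero enters through [sr_div]: 1/k! turns the symmetrizer into a projection, and
    1/(n + 1) makes Newton's recursion determine each coefficient. *)

(* The properties of a supercommutative algebra used below, in a form inherited by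
   power series with coefficientwise parity. *)
Record superring (B : nzRingType) (g : bool -> B -> Prop) : Prop := Superring {
  sr_B : forall d x y, g d x -> g d y -> g d (x - y);
  sr_1 : g false 1;
  sr_M : forall d e x y, g d x -> g e y -> g (d (+) e) (x * y);
  sr_C : forall d e x y, g d x -> g e y -> x * y = (-1) ^+ (d && e) * (y * x);
  sr_dec : forall x, exists x0 x1, [/\ g false x0, g true x1 & x = x0 + x1];
  sr_dir : forall x, g false x -> g true x -> x = 0;
  sr_div : forall n, exists u, n.+1%:R * u = 1 :> B
}.

(** * Parity rules and the commutative ring of even elements *)

Section SuperringTheory.
Context (B : nzRingType) (g : bool -> B -> Prop) (hg : superring g).

Lemma sr_0 d : g d 0.
Proof.
have [x0 [x1 [h0 h1 _]]] := sr_dec hg 0.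
by case: d; [rewrite -(subrr x1) | rewrite -(subrr x0)]; apply: sr_B.
Qed.
Lemma sr_N d x : g d x -> g d (- x).
Proof. by move=> hx; rewrite -sub0r; apply: sr_B => //; apply: sr_0. Qed.
Lemma sr_D d x y : g d x -> g d y -> g d (x + y).
Proof. by move=> hx hy; rewrite -[y]opprK; apply: sr_B => //; apply: sr_N. Qed.
Lemma sr_sum (J : Type) (r : seq J) (P : pred J) (F : J -> B) d :
  (forall i, P i -> g d (F i)) -> g d (\sum_(i <- r | P i) F i).
Proof.
by move=> h; elim/big_ind: _ => // [|x y]; [apply: sr_0 | apply: sr_D].
Qed.
Lemma sr_sign d x (b : nat) : g d x -> g d ((-1) ^+ b * x).
Proof.
by move=> hx; rewrite -signr_odd mulr_sign; case: odd => //; apply: sr_N.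
Qed.
Lemma sr_eM d x y : g false x -> g d y -> g d (x * y).
Proof. by move=> hx hy; have := sr_M hg hx hy. Qed.
Lemma sr_eC d x y : g false x -> g d y -> x * y = y * x.
Proof. by move=> hx hy; rewrite (sr_C hg hx hy) /= mul1r. Qed.
Lemma sr_nat n : g false n%:R.
Proof.
elim: n => [|n ih]; first exact: sr_0.
by rewrite -addn1 natrD; apply: sr_D => //; apply: sr_1.
Qed.
Lemma sr_fact n : exists u, n`!%:R * u = 1 :> B.
Proof. by rewrite -(prednK (fact_gt0 n)); apply: (sr_div hg). Qed.
Lemma sr_inj n (x : B) : n.+1%:R * x = 0 -> x = 0.
Proof.
have [u hu] := sr_div hg n => h.
by rewrite -[x]mul1r -hu mulr_natl -mulr_natr -mulrA h mulr0.
Qed.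
Lemma sr_injf n (x : B) : n`!%:R * x = 0 -> x = 0.
Proof. by rewrite -(prednK (fact_gt0 n)); apply: sr_inj. Qed.

Lemma sr_dir2 (b : bool) x : g b x -> g (~~ b) x -> x = 0.
Proof. by case: b => h h'; apply: (sr_dir hg). Qed.
Lemma sr_dec2 (b : bool) x : exists y z, [/\ g b y, g (~~ b) z & x = y + z].
Proof.
have [x0 [x1 [h0 h1 e]]] := sr_dec hg x.
by case: b; [exists x1, x0; rewrite addrC | exists x0, x1].
Qed.

Definition even_pred of superring g : {pred B} := fun x => `[< g false x >].

Lemma even_predP x : reflect (g false x) (x \in even_pred hg).
Proof. exact: asboolP. Qed.

Fact even_subring : subring_closed (even_pred hg).
Proof.
split; [by apply/even_predP; apply: sr_1 | | ].
  by move=> x y /even_predP hx /even_predP hy; apply/even_predP; apply: sr_B.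
by move=> x y /even_predP hx /even_predP hy; apply/even_predP; apply: sr_eM.
Qed.

HB.instance Definition _ :=
  GRing.isSubringClosed.Build B (even_pred hg) even_subring.

(** The commutative ring in which determinants, adjugates and Cramer's rule are used; the classical
    predicate makes it a subtype. *)
Definition evenT := {x : B | x \in even_pred hg}.
HB.instance Definition _ := SubChoice.on evenT.
HB.instance Definition _ := [SubChoice_isSubNzRing of evenT by <:].

Lemma evenTP (x : evenT) : g false (val x).
Proof. exact/even_predP/(valP x). Qed.

Fact even_mulC : @commutative evenT evenT *%R.
Proof.
by move=> x y; apply: val_inj; rewrite !rmorphM; apply: sr_eC (evenTP x) (evenTP y).
Qed.
HB.instance Definition _ := GRing.PzRing_hasCommutativeMul.Build evenT even_mulC.

Definition to_even (x : B) : evenT := insubd (0 : evenT) x.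
Lemma to_evenK x : g false x -> val (to_even x) = x.
Proof. by move=> hx; rewrite insubdK //; apply/even_predP. Qed.

End SuperringTheory.

(** * Tensors and the exterior ideal *)

Module Words.

(* A tensor is the function giving the coefficient of every word, in all degrees
   at once: a degree k statement only looks at words of length k. *)
Definition wten (I B : Type) : Type := seq I -> B.
HB.instance Definition _ (I B : Type) := gen_eqMixin (wten I B).
HB.instance Definition _ (I B : Type) := gen_choiceMixin (wten I B).

Section WordTensor.
Context (I : Type) (B : nzRingType).
Implicit Types x y z : wten I B.
Definition wt_zero : wten I B := fun=> 0.
Definition wt_opp x : wten I B := fun u => - x u.
Definition wt_add x y : wten I B := fun u => x u + y u.
Fact wt_addA : associative wt_add.
Proof. by move=> x y z; apply/funext => u; apply: addrA. Qed.
Fact wt_addC : commutative wt_add.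
Proof. by move=> x y; apply/funext => u; apply: addrC. Qed.
Fact wt_add0 : left_id wt_zero wt_add.
Proof. by move=> x; apply/funext => u; apply: add0r. Qed.
Fact wt_addN : left_inverse wt_zero wt_opp wt_add.
Proof. by move=> x; apply/funext => u; apply: addNr. Qed.
HB.instance Definition _ := GRing.isZmodule.Build (wten I B)
  wt_addA wt_addC wt_add0 wt_addN.
Definition rs x (a : B) : wten I B := fun u => x u * a.

Lemma wtD x y u : (x + y) u = x u + y u. Proof. by []. Qed.
Lemma wtN x u : (- x) u = - x u. Proof. by []. Qed.
Lemma wt0 u : (0 : wten I B) u = 0. Proof. by []. Qed.
Lemma wt_sum (J : Type) (r : seq J) (P : pred J) (F : J -> wten I B) u :
  (\sum_(i <- r | P i) F i) u = \sum_(i <- r | P i) F i u.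
Proof. by elim/big_rec2: _ => // i a b _ <-. Qed.
Lemma wtMn x n u : (x *+ n) u = n%:R * x u.
Proof.
elim: n => [|n ih]; first by rewrite mulr0n mul0r.
by rewrite mulrS wtD ih -addn1 natrD mulrDl mul1r addrC.
Qed.

Definition rlin (O : wten I B -> wten I B) : Prop :=
  (forall x y, O (x + y) = O x + O y) /\ (forall x a, O (rs x a) = rs (O x) a).

Lemma rlinD O : rlin O -> forall x y, O (x + y) = O x + O y.
Proof. by case. Qed.
Lemma rlinZ O : rlin O -> forall x a, O (rs x a) = rs (O x) a.
Proof. by case. Qed.
Lemma rlin0 O : rlin O -> O 0 = 0.
Proof. by move=> h; apply: (addIr (O 0)); rewrite -(rlinD h) !add0r. Qed.
Lemma rlinN O : rlin O -> forall x, O (- x) = - O x.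
Proof.
by move=> h x; apply: (addIr (O x)); rewrite -(rlinD h) !addNr (rlin0 h).
Qed.
Lemma rlinB O : rlin O -> forall x y, O (x - y) = O x - O y.
Proof. by move=> h x y; rewrite (rlinD h) (rlinN h). Qed.
Lemma rlin_sum O : rlin O -> forall (J : Type) (r : seq J) (P : pred J)
  (F : J -> wten I B), O (\sum_(i <- r | P i) F i) = \sum_(i <- r | P i) O (F i).
Proof. by move=> h J r P F; apply: big_morph; [apply: rlinD | apply: rlin0]. Qed.
Lemma rlinMn O : rlin O -> forall x n, O (x *+ n) = O x *+ n.
Proof.
move=> h x; elim=> [|n ih]; first by rewrite !mulr0n (rlin0 h).
by rewrite !mulrS (rlinD h) ih.
Qed.

Lemma rs0 a : rs 0 a = 0.
Proof. by apply/funext => u; rewrite /rs mul0r. Qed.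
Lemma rsr1 x : rs x 1 = x.
Proof. by apply/funext => u; rewrite /rs mulr1. Qed.
Lemma rsD x y a : rs (x + y) a = rs x a + rs y a.
Proof. by apply/funext => u; rewrite /rs wtD mulrDl. Qed.
Lemma rsA x a b : rs (rs x a) b = rs x (a * b).
Proof. by apply/funext => u; rewrite /rs mulrA. Qed.
Lemma rs_sum (J : Type) (r : seq J) (P : pred J) (F : J -> wten I B) a :
  rs (\sum_(i <- r | P i) F i) a = \sum_(i <- r | P i) rs (F i) a.
Proof.
apply: (big_morph (fun x => rs x a)); [by move=> x y; apply: rsD | exact: rs0].
Qed.
Lemma rsNr x a : rs x (- a) = - rs x a.
Proof. by apply/funext => u; rewrite /rs mulrN. Qed.
Lemma rsN x a : rs (- x) a = - rs x a.
Proof. by apply/funext => u; rewrite /rs mulNr. Qed.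

End WordTensor.

(** * Koszul signs, signed derivations and the symmetrizer *)

Section Koszul.
Context (I : finType) (B : nzRingType) (par : I -> bool).
Implicit Types (x y z : wten I B) (i j : I) (u w : seq I).

Definition wp w : bool := foldr (fun i b => par i (+) b) false w.
(** The exterior sign: e_i e_j = [eps i j] e_j e_i, so two odd letters commute and any other pair
    anticommutes. *)
Definition eps i j : B := - (-1) ^+ (par i && par j).

Definition dl w : wten I B := fun u => (u == w)%:R.
(* [ei i] is left multiplication by e_i, and [der j] removes a letter j from every
   position, with a factor [eps i j] for each letter i in front of it. Iterating
   [der] gives [sym], the signed sum over all permutations of the factors. *)
Definition lq i x : wten I B := fun u => x (i :: u).
Definition ei i x : wten I B :=
  fun u => if u is j :: u' then (j == i)%:R * x u' else 0.
Fixpoint der_rec j x u : B :=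
  if u is i :: u' then x (j :: i :: u') + eps i j * der_rec j (lq i x) u'
  else x [:: j].
Definition der j x : wten I B := der_rec j x.
(** Left multiplication by a scalar [a] of parity [d]: coordinates stand on the right, so [a] has to
    pass the word [u]. *)
Definition lft (d : bool) (a : B) x : wten I B :=
  fun u => (-1) ^+ (d && wp u) * a * x u.
Definition ls (c : B) x : wten I B := fun u => c * x u.
Fixpoint sym_rec x u : B := if u is i :: u' then sym_rec (der i x) u' else x [::].
Definition sym x : wten I B := sym_rec x.

Lemma lq_ext x y : x [::] = y [::] -> (forall i, lq i x = lq i y) -> x = y.
Proof.
by move=> h0 h; apply/funext => -[|i u] //; have := congr1 (@^~ u) (h i).
Qed.

Lemma lqD i x y : lq i (x + y) = lq i x + lq i y. Proof. by []. Qed.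
Lemma lqN i x : lq i (- x) = - lq i x. Proof. by []. Qed.
Lemma lq0 i : lq i 0 = 0 :> wten I B. Proof. by []. Qed.
Lemma lq_rs i x a : lq i (rs x a) = rs (lq i x) a. Proof. by []. Qed.
Lemma lq_ls i c x : lq i (ls c x) = ls c (lq i x). Proof. by []. Qed.
Lemma lq_sum i (J : Type) (r : seq J) (P : pred J) (F : J -> wten I B) :
  lq i (\sum_(k <- r | P k) F k) = \sum_(k <- r | P k) lq i (F k).
Proof. by apply: big_morph; [apply: lqD | apply: lq0]. Qed.
Lemma lq_ei i j x : lq i (ei j x) = ls (i == j)%:R x.
Proof. by []. Qed.
Lemma lq_der i j x : lq i (der j x) = lq i (lq j x) + ls (eps i j) (der j (lq i x)).
Proof. by []. Qed.
Lemma lq_sym i x : lq i (sym x) = sym (der i x). Proof. by []. Qed.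
Lemma lq_lft i d a x : lq i (lft d a x) = ls ((-1) ^+ (d && par i)) (lft d a (lq i x)).
Proof.
apply/funext => u; rewrite /lq /lft /ls /= !mulrA -signr_addb.
by congr (_ ^+ _ * _ * _); case: d; case: (par i); case: (wp u).
Qed.

Lemma ls1 x : ls 1 x = x. Proof. by apply/funext => u; rewrite /ls mul1r. Qed.
Lemma ls0 x : ls 0 x = 0. Proof. by apply/funext => u; rewrite /ls mul0r. Qed.
Lemma lsN c x : ls (- c) x = - ls c x.
Proof. by apply/funext => u; rewrite /ls mulNr. Qed.
Lemma lsA c c' x : ls c (ls c' x) = ls (c * c') x.
Proof. by apply/funext => u; rewrite /ls mulrA. Qed.
Lemma lsD c x y : ls c (x + y) = ls c x + ls c y.
Proof. by apply/funext => u; rewrite /ls wtD mulrDr. Qed.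
Lemma lsr0 c : ls c 0 = 0.
Proof. by apply/funext => u; rewrite /ls mulr0. Qed.
Lemma ls_sign (b : bool) x : ls ((-1) ^+ b) x = if b then - x else x.
Proof. by apply/funext => u; rewrite /ls mulr_sign; case: b. Qed.
Lemma ls_eps i j x : ls (eps i j) x = if par i && par j then x else - x.
Proof. by rewrite lsN ls_sign; case: ifP; rewrite ?opprK. Qed.
Lemma ls_bool (b : bool) x : ls b%:R x = if b then x else 0.
Proof. by case: b; rewrite ?ls1 ?ls0. Qed.
Lemma ls_sum c (J : Type) (r : seq J) (P : pred J) (F : J -> wten I B) :
  ls c (\sum_(k <- r | P k) F k) = \sum_(k <- r | P k) ls c (F k).
Proof. by apply: big_morph; [apply: lsD | apply: lsr0]. Qed.

Lemma rlin_ls c : rlin (ls c).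
Proof. by split=> [x y|x a]; [apply: lsD | apply/funext => u; apply: mulrA]. Qed.
Lemma rlin_lft d a : rlin (lft d a).
Proof.
by split=> [x y|x b]; apply/funext => u; [apply: mulrDr | apply: mulrA].
Qed.
Lemma rlin_ei i : rlin (ei i).
Proof.
by split=> [x y|x b]; apply/funext => -[|j u] /=;
  rewrite ?wtD /= ?addr0 /rs ?mul0r // ?mulrDr ?mulrA.
Qed.
Lemma rlin_der j : rlin (der j).
Proof.
split=> [x y|x b]; apply/funext => u; rewrite ?wtD /rs.
  elim: u x y => [|i u ih] x y //=.
  by rewrite lqD ih mulrDr wtD addrACA.
by elim: u x => [|i u ih] x //=; rewrite lq_rs ih mulrDl mulrA.
Qed.
Lemma rlin_sym : rlin sym.
Proof.
split=> [x y|x b]; apply/funext => u; rewrite ?wtD /rs.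
  by elim: u x y => [|i u ih] x y //=; rewrite (rlinD (rlin_der i)) ih.
by elim: u x => [|i u ih] x //=; rewrite (rlinZ (rlin_der i)) ih.
Qed.
Lemma rlin_comp (O1 O2 : wten I B -> wten I B) :
  rlin O1 -> rlin O2 -> rlin (O1 \o O2).
Proof.
by move=> [a1 z1] [a2 z2]; split=> [x y|x a] /=; rewrite ?a2 ?a1 ?z2 ?z1.
Qed.

Lemma epsC i j : eps i j = eps j i. Proof. by rewrite /eps andbC. Qed.
Lemma eps2 i j : eps i j * eps i j = 1.
Proof. by rewrite /eps mulrNN -expr2 sqrr_sign. Qed.
Lemma eps_comm i j (a : B) : GRing.comm (eps i j) a.
Proof. by apply: commr_sym; apply: commrN; apply: commr_sign. Qed.
Lemma ls_epsC i j k l x : ls (eps i j) (ls (eps k l) x) = ls (eps k l) (ls (eps i j) x).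
Proof. by rewrite !lsA eps_comm. Qed.
Lemma ls_eps2 i j x : ls (eps i j) (ls (eps i j) x) = x.
Proof. by rewrite lsA eps2 ls1. Qed.

Definition cst (c : B) : Prop := forall a, GRing.comm c a.
Lemma cst_eps i j : cst (eps i j). Proof. exact: eps_comm. Qed.
Lemma cst_sign (b : nat) : cst ((-1) ^+ b). Proof. by move=> a; apply/commr_sym/commr_sign. Qed.
Lemma cst_nat n : cst n%:R. Proof. by move=> a; apply/commr_sym/commr_nat. Qed.
Lemma ls_rs c x : cst c -> ls c x = rs x c.
Proof. by move=> hc; apply/funext => u; apply: hc. Qed.
Lemma rlin_cst O c x : rlin O -> cst c -> O (ls c x) = ls c (O x).
Proof. by move=> hO hc; rewrite !ls_rs ?(rlinZ hO). Qed.

(** The signed commutation relation of creation and annihilation operators. As [sym] only iterates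
    [der], its properties are drawn from this relation. *)
Lemma der_ei i j x : der j (ei i x) = ls (i == j)%:R x + ls (eps i j) (ei i (der j x)).
Proof.
apply: lq_ext => [|a]; first by rewrite /= wtD /ls mulr0 addr0 eq_sym.
rewrite lq_der lqD !lq_ls !lq_ei (eq_sym j i); congr (_ + _).
rewrite !ls_bool; case: eqVneq => [->|_] //; rewrite ?lsr0 //.
by rewrite (rlin0 (rlin_der j)) lsr0.
Qed.

Lemma wt_split x : x = ls (x [::]) (dl [::]) + \sum_i ei i (lq i x).
Proof.
apply: lq_ext => [|a].
  by rewrite wtD wt_sum big1 // addr0 /ls /dl eqxx mulr1.
rewrite lqD lq_sum (bigD1 a) //= lq_ei eqxx ls1 big1 ?addr0 => [|i hi].
  by rewrite (_ : lq a (ls _ _) = 0) ?add0r //; apply/funext => u; apply: mulr0.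
by rewrite lq_ei eq_sym (negbTE hi) ls0.
Qed.

(** Tensors carry all degrees at once; equality in degree k is [zon k] of the difference. *)
Definition zon k x := forall u, size u = k -> x u = 0.

Lemma zonP0 x : zon 0 x <-> x [::] = 0.
Proof. by split=> [h|h u /size0nil->] //; apply: h. Qed.
Lemma zonS k x : zon k.+1 x <-> forall i, zon k (lq i x).
Proof.
split=> [h i u hu|h [//|i u] [hu]]; first by apply: h; rewrite /= hu.
exact: h.
Qed.
Lemma zonD k x y : zon k x -> zon k y -> zon k (x + y).
Proof. by move=> hx hy u hu; rewrite wtD hx ?hy ?addr0. Qed.
Lemma zon_ls k c x : zon k x -> zon k (ls c x).
Proof. by move=> h u hu; rewrite /ls h ?mulr0. Qed.

Lemma zon_der k j x : zon k.+1 x -> zon k (der j x).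
Proof.
elim: k x => [|k ih] x h; first by apply/zonP0; apply: h.
apply/zonS => i; rewrite lq_der; apply: zonD.
  by move=> u hu; apply: h; rewrite /= hu.
by apply/zon_ls/ih => u hu; apply: h; rewrite /= hu.
Qed.
Lemma zon_sym k x : zon k x -> zon k (sym x).
Proof.
elim: k x => [|k ih] x h; first by apply/zonP0; apply: h.
by apply/zonS => i; rewrite lq_sym; apply/ih/zon_der.
Qed.
Lemma zon_ei k i x : zon k x -> zon k.+1 (ei i x).
Proof. by move=> h; apply/zonS => j; rewrite lq_ei; apply: zon_ls. Qed.

(* A family of homogeneous right submodules, stable under the e_i and containing
   the relations of the exterior algebra in front position. *)
Record is_ideal (J : nat -> wten I B -> Prop) : Prop := IsIdeal {
  id_zon : forall k x, zon k x -> J k x;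
  id_D : forall k x y, J k x -> J k y -> J k (x + y);
  id_Z : forall k x a, J k x -> J k (rs x a);
  id_ei : forall k i x, J k x -> J k.+1 (ei i x);
  id_rel : forall k i j x, J k.+2 (ei i (ei j x) - ls (eps i j) (ei j (ei i x)))
}.

Section Ideal.
Context (J : nat -> wten I B -> Prop) (hJ : is_ideal J).

Lemma id_0 k : J k 0. Proof. by apply: (id_zon hJ). Qed.
Lemma id_N k x : J k x -> J k (- x).
Proof. by move=> h; rewrite -[x]rsr1 -rsNr; apply: id_Z. Qed.
Lemma id_B k x y : J k x -> J k y -> J k (x - y).
Proof. by move=> hx hy; apply: id_D => //; apply: id_N. Qed.
Lemma id_sum k (L : Type) (r : seq L) (P : pred L) (F : L -> wten I B) :
  (forall l, P l -> J k (F l)) -> J k (\sum_(l <- r | P l) F l).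
Proof. by move=> h; elim/big_ind: _ => // [|x y]; [apply: id_0 | apply: id_D]. Qed.
Lemma id_trans k y x z : J k (x - y) -> J k (y - z) -> J k (x - z).
Proof. by move=> h1 h2; rewrite -(subrK y x) -addrA; apply: id_D. Qed.
Lemma id_ls k c x : cst c -> J k x -> J k (ls c x).
Proof. by move=> hc; rewrite (ls_rs _ hc); apply: id_Z. Qed.

Lemma id_rel1 k i j x :
  J k.+1 (ei i (ei j x) - ls (eps i j) (ei j (ei i x))).
Proof.
case: k => [|k]; last exact: id_rel.
apply: (id_zon hJ) => -[|a [|b u]] //= _.
by rewrite wtD wtN /ls /= !mulr0 subr0.
Qed.

Lemma rlin_euler k : rlin (fun x => \sum_i ei i (der i x) - x *+ k).
Proof.
split=> [x y|x a].
  rewrite mulrnDl opprD addrACA -big_split; congr (_ + _); apply: eq_bigr => i _.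
  by rewrite (rlinD (rlin_der i)) (rlinD (rlin_ei i)).
rewrite rsD rs_sum; congr (_ + _).
  by apply: eq_bigr => i _; rewrite (rlinZ (rlin_der i)) (rlinZ (rlin_ei i)).
by apply/funext => u; rewrite wtN !wtMn /rs wtN mulNr wtMn mulrA.
Qed.

(** Euler's identity: modulo the relations, putting a removed letter back in front recovers the
    tensor once per position. For a first letter a, the Kronecker term of [der_ei] gives one copy;
    in the other terms e_i is commuted past e_a by a relation, and induction gives the remaining k
    copies. *)
Lemma euler k x : J k (\sum_i ei i (der i x) - x *+ k).
Proof.
elim: k x => [|k ih] x.
  by apply: id_zon => //; apply/zonP0; rewrite mulr0n subr0 wt_sum big1.
have zc : forall l (c : B), zon l.+1 (ls c (dl [::])).
  by move=> l c [|a u] // _; rewrite /ls mulr0.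
have hz : J k.+1 (\sum_i ei i (der i (ls (x [::]) (dl [::])))
               - ls (x [::]) (dl [::]) *+ k.+1).
  apply: id_zon => // u hu; rewrite wtD wtN wt_sum big1 ?add0r => [|i _].
    by rewrite wtMn (zc k) ?mulr0 ?oppr0.
  by apply: zon_ei hu; apply: zon_der; apply: zc.
have hy a y : J k.+1 (\sum_i ei i (der i (ei a y)) - ei a y *+ k.+1).
  have -> : \sum_i ei i (der i (ei a y)) - ei a y *+ k.+1 =
     \sum_i ls (eps a i) (ei i (ei a (der i y)) - ls (eps i a) (ei a (ei i (der i y))))
     + ei a (\sum_i ei i (der i y) - y *+ k); last first.
    apply: id_D => //; last by apply: id_ei.
    by apply: id_sum => i _; apply: id_ls; [exact: cst_eps | apply: id_rel1].
  rewrite (rlinB (rlin_ei a)) (rlin_sum (rlin_ei a)) addrA -big_split /=.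
  rewrite mulrS opprD addrA (rlinMn (rlin_ei a)); congr (_ - _).
  have e1 : ei a y = \sum_i ei i (ls (a == i)%:R y).
    rewrite (bigD1 a) //= eqxx ls1 big1 ?addr0 // => i hi.
    by rewrite eq_sym (negbTE hi) ls0 (rlin0 (rlin_ei i)).
  rewrite [X in _ - X = _]e1 -sumrB; apply: eq_bigr => i _.
  rewrite der_ei (rlinD (rlin_ei i)) addrAC subrr add0r.
  rewrite (rlin_cst _ (rlin_ei i)) ?lsD ?(rlin_cst _ (rlin_ei i)); last exact: cst_eps.
  by rewrite (rlinN (rlin_ls _)) (epsC i a) ls_eps2 subrK.
rewrite (wt_split x) (rlinD (rlin_euler _)); apply: id_D => //.
by rewrite (rlin_sum (rlin_euler _)); apply: id_sum => a _; apply: hy.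
Qed.

(** In positive degree sym x = sum_i e_i sym (der_i x). Induction replaces the inner [sym] by k!,
    and Euler's identity supplies the factor k + 1. *)
Lemma sym_fact k x : J k (sym x - x *+ k`!).
Proof.
elim: k x => [|k ih] x; first by apply: id_zon => //; apply/zonP0; rewrite wtD wtN subrr.
have e : J k.+1 (sym x - \sum_i ei i (sym (der i x))).
  apply: id_zon => //; apply/zonS => i; rewrite lqD lqN lq_sum (bigD1 i) //= lq_ei eqxx ls1.
  rewrite big1 ?addr0 ?lq_sym ?subrr => [u _|j hj] //.
  by rewrite lq_ei eq_sym (negbTE hj) ls0.
apply: (id_trans e) => {e}.
apply: (@id_trans _ (\sum_i ei i (der i x) *+ k`!)).
  rewrite -sumrB; apply: id_sum => i _.
  by rewrite -(rlinMn (rlin_ei i)) -(rlinB (rlin_ei i)); apply: id_ei.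
rewrite factS mulrnA sumrMnl -mulrnBl -[X in J _ X]rsr1.
have -> : forall y : wten I B, rs (y *+ k`!) 1 = rs y (k`!)%:R.
  by move=> y; apply/funext => u; rewrite /rs wtMn mulr1; apply: cst_nat.
by apply: id_Z; rewrite //; apply: euler.
Qed.

End Ideal.

Definition kers k x : Prop := zon k (sym x).

(** The Kronecker terms of [der_ei] cancel, so a derivative of a relation is, up to sign, the same
    relation on [der a x]. Iterating, the symmetrizer kills every relation. *)
Lemma der_rel a i j x :
  der a (ei i (ei j x) - ls (eps i j) (ei j (ei i x))) =
  ls (eps i a * eps j a)
    (ei i (ei j (der a x)) - ls (eps i j) (ei j (ei i (der a x)))).
Proof.
rewrite (rlinB (rlin_der a)) (rlin_cst _ (rlin_der a)) ?der_ei; last exact: cst_eps.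
rewrite !(rlinD (rlin_ei _)) !(rlin_cst _ (rlin_ei _)); try exact: cst_eps; try exact: cst_nat.
rewrite (rlinB (rlin_ls _)) !lsD -!lsA.
have e1 : ls (i == a)%:R (ei j x) = ls (eps i j) (ls (eps j a) (ls (i == a)%:R (ei j x))).
  by rewrite !ls_bool; case: eqVneq => [->|_]; rewrite ?lsr0 // (epsC j a) ls_eps2.
have e2 : ls (eps i a) (ls (j == a)%:R (ei i x)) = ls (eps i j) (ls (j == a)%:R (ei i x)).
  by rewrite !ls_bool; case: eqVneq => [->|_]; rewrite ?lsr0.
rewrite -e1 e2 !opprD addrACA [X in _ + X]addrC.
rewrite [in RHS](ls_epsC j a i j) [in RHS](ls_epsC i a i j).
by rewrite addrCA subrKA [X in X + _]addrC subrKA addrC (ls_epsC i a j a (ei j _)).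
Qed.

(** By [der_ei] a derivative of e_i x is a multiple of x plus a sign times e_i applied to a
    derivative of x, so induction on the degree applies. *)
Lemma kers_ei k i x : kers k x -> kers k.+1 (ei i x).
Proof.
elim: k x => [|k ih] x h; apply/zonS => a; rewrite lq_sym der_ei.
  rewrite (rlinD rlin_sym) !(rlin_cst _ rlin_sym); try exact: cst_eps; try exact: cst_nat.
  by apply: zonD; apply/zon_ls => //; apply/zonP0.
rewrite (rlinD rlin_sym) !(rlin_cst _ rlin_sym); try exact: cst_eps; try exact: cst_nat.
apply: zonD; apply/zon_ls => //; apply: ih => u hu.
by apply: (h (a :: u)); rewrite /= hu.
Qed.

Lemma kers_rel k i j x :
  kers k.+2 (ei i (ei j x) - ls (eps i j) (ei j (ei i x))).
Proof.
elim: k x => [|k ih] x; apply/zonS => a; rewrite lq_sym der_rel -!lsA;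
  rewrite !(rlin_cst _ rlin_sym); try exact: cst_eps.
  apply/zon_ls/zon_ls/zonS => b; rewrite lq_sym der_rel -!lsA;
  rewrite !(rlin_cst _ rlin_sym); try exact: cst_eps.
  by apply/zon_ls/zon_ls/zonP0; rewrite /= !wtD wtN /ls /= mulr0 subrr.
by apply/zon_ls/zon_ls; apply: ih.
Qed.

Lemma kersD k x y : kers k x -> kers k y -> kers k (x + y).
Proof. by move=> hx hy; rewrite /kers (rlinD rlin_sym); apply: zonD. Qed.
Lemma kersZ k x a : kers k x -> kers k (rs x a).
Proof.
by move=> h u hu; rewrite (rlinZ rlin_sym) /rs h ?mul0r.
Qed.

Lemma kers_ideal : is_ideal kers.
Proof.
split; [exact: zon_sym|exact: kersD|exact: kersZ|exact: kers_ei|exact: kers_rel].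
Qed.

Lemma kers_der k i x : kers k.+1 x -> kers k (der i x).
Proof. by move=> h u hu; apply: (h (i :: u)); rewrite /= hu. Qed.

(** The minimality of [kers] where k! is invertible: k! x differs from sym x, which is zero in
    degree k, by an element of J. *)
Lemma sym_sub_ideal (J : nat -> wten I B -> Prop) k x (v : B) :
  is_ideal J -> k`!%:R * v = 1 -> kers k x -> J k x.
Proof.
move=> hJ hv hx; rewrite -[x]rsr1 -hv.
have -> : rs x (k`!%:R * v) = rs (x *+ k`!) v.
  by rewrite -rsA; congr rs; apply/funext => u; rewrite wtMn /rs; rewrite -(cst_nat _ (x u)).
apply: (id_Z hJ); rewrite -[_ *+ _](subKr (sym x)); apply: (id_B hJ); last exact: sym_fact.
exact: (id_zon hJ).
Qed.

(** Idempotence of the symmetrizer up to the factor k!, read off from [sym_fact] for the kernel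
    itself. *)
Lemma sym_kers k x : kers k (sym x - x *+ k`!).
Proof. exact: (sym_fact kers_ideal). Qed.

End Koszul.

End Words.
Import Words.

(** * Operators and supertraces *)

Module Operators.

Section Operators.
Context (B : nzRingType) (g : bool -> B -> Prop) (hg : superring g).
Context (n : nat) (par : 'I_n -> bool).
Local Notation I := 'I_n.
Local Notation W := (wten I B).
Local Notation wp := (wp par).
Local Notation eps := (eps B par).
Local Notation der := (der par).
Local Notation lft := (lft par).
Local Notation sym := (sym par).
Local Notation kers := (kers par).
Local Notation dl := (@dl I B).
Implicit Types (x y : W) (i j : I) (u w : seq I) (M N : 'M[B]_n).

Definition emx M : Prop := forall i j, g (par i (+) par j) (M i j).
Definition strm M : B := \sum_i (-1) ^+ par i * M i i.

(* [mop M] is M acting on all tensor powers. *)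
Fixpoint mop_rec M x u : B :=
  if u is i :: u' then
    \sum_j (-1) ^+ ((par i (+) par j) && wp u') * M i j * mop_rec M (lq j x) u'
  else x [::].
Definition mop M x : W := mop_rec M x.

Lemma lq_mop i M x :
  lq i (mop M x) = \sum_j lft (par i (+) par j) (M i j) (mop M (lq j x)).
Proof. by apply/funext => u; rewrite wt_sum. Qed.

Lemma rlin_mop M : rlin (mop M).
Proof.
split=> [x y|x b]; apply/funext => u; rewrite ?wtD /rs.
  elim: u x y => [|i u ih] x y //=.
  by rewrite -big_split; apply: eq_bigr => j _; rewrite lqD ih mulrDr.
elim: u x => [|i u ih] x //=.
by rewrite mulr_suml; apply: eq_bigr => j _; rewrite lq_rs ih mulrA.
Qed.

Lemma mop_ei M i x :
  mop M (ei i x) = \sum_l ei l (lft (par l (+) par i) (M l i) (mop M x)).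
Proof.
apply: lq_ext => [|a]; first by rewrite wt_sum big1.
rewrite lq_mop lq_sum (bigD1 i) //= [in RHS](bigD1 a) //= !lq_ei !eqxx !ls1.
rewrite !big1 ?addr0 // => j hj; have := hj; rewrite eq_sym => hj';
  rewrite lq_ei ?(negbTE hj) ?(negbTE hj') ls0 //.
by rewrite (rlin0 (rlin_mop M)) (rlin0 (rlin_lft _ _ _)).
Qed.

Lemma lft_ei d a b x : lft d a (ei b x) = ls ((-1) ^+ (d && par b)) (ei b (lft d a x)).
Proof.
apply: lq_ext => [|c]; first by rewrite /ls /lft /= !mulr0.
rewrite lq_lft lq_ls !lq_ei !ls_bool; case: eqVneq => [->|_] //.
by rewrite (rlin0 (rlin_lft _ _ _)) !lsr0.
Qed.

Lemma lft_lft d a e b x : g d a -> g e b ->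
  lft d a (lft e b x) = lft (d (+) e) (a * b) x.
Proof.
move=> ha hb; apply/funext => u; rewrite /lft !mulrA; congr (_ * _ * _).
rewrite -mulrA commr_sign mulrA -signr_addb; congr (_ ^+ _ * _).
by case: d {ha}; case: e {hb}; case: (wp u).
Qed.

Lemma lft_ls d a c x : cst c -> lft d a (ls c x) = ls c (lft d a x).
Proof. by move=> hc; rewrite (rlin_cst _ (rlin_lft _ _ _)). Qed.

Lemma lftC d a e b x : g d a -> g e b ->
  lft d a (lft e b x) = ls ((-1) ^+ (d && e)) (lft e b (lft d a x)).
Proof.
move=> ha hb; rewrite !lft_lft // (sr_C hg ha hb) addbC.
by apply/funext => u; rewrite /ls /lft !mulrA commr_sign.
Qed.

Lemma der_lft i d a x : der i (lft d a x) = ls ((-1) ^+ (d && par i)) (lft d a (der i x)).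
Proof.
apply/funext => u; elim: u x => [|c u ih] x.
  by rewrite /ls /lft /= /wp /= addbF andbF expr0 mul1r mulrA.
change (lq c (der i (lft d a x)) u = lq c (ls ((-1) ^+ (d && par i)) (lft d a (der i x))) u).
rewrite lq_der lq_ls !lq_lft lq_der lq_ls lq_lft (rlinD (rlin_lft _ _ _)) !lsD.
rewrite !wtD (rlin_cst _ (rlin_der _ _ _)); last exact: cst_sign.
rewrite lft_ls; last exact: cst_eps.
congr (_ + _).
rewrite /ls ih /ls !mulrA -[eps c i * _ * _]mulrA eps_comm.
by do 4 congr (_ * _); apply: commr_sign.
Qed.

Lemma sym_lft d a x : sym (lft d a x) = lft d a (sym x).
Proof.
apply/funext => u; elim: u x => [|c u ih] x //.
change (lq c (sym (lft d a x)) u = lq c (lft d a (sym x)) u).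
rewrite lq_lft !lq_sym der_lft (rlin_cst _ (rlin_sym _ _)); last exact: cst_sign.
by rewrite /ls ih.
Qed.

(** As M acts factor by factor, a letter i of M x comes from some letter j of x with weight M i j.
    This entry has to pass the entries acting on the letters in front, hence the parity hypothesis
    on M. *)
Lemma der_mop M i x : emx M ->
  der i (mop M x) = \sum_j lft (par i (+) par j) (M i j) (mop M (der j x)).
Proof.
move=> hM; apply/funext => u; elim: u i x => [|a u ih] i x.
  rewrite wt_sum /= ; apply: eq_bigr => j _; by rewrite /lft /= andbF.
change (lq a (der i (mop M x)) u =
  lq a (\sum_j lft (par i (+) par j) (M i j) (mop M (der j x))) u).
rewrite lq_der !lq_mop lq_sum (rlin_sum (rlin_der _ _ _)) lq_sum ls_sum.
have -> : \sum_j lq a (lft (par i (+) par j) (M i j) (mop M (der j x))) =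
  \sum_j lq a (lft (par i (+) par j) (M i j) (mop M (lq j x))) +
  \sum_j \sum_b ls (eps a i) (ls ((-1) ^+ ((par a (+) par b) && par i))
    (lft (par a (+) par b) (M a b) (lft (par i (+) par j) (M i j) (mop M (der j (lq b x)))))).
  rewrite -big_split; apply: eq_bigr => j _ /=; rewrite !lq_lft !lq_mop.
  rewrite !(rlin_sum (rlin_lft _ _ _)) !ls_sum -big_split; apply: eq_bigr => b _ /=.
  rewrite lq_der (rlinD (rlin_mop _)) !(rlinD (rlin_lft _ _ _)) lsD; congr (_ + _).
  rewrite (rlin_cst _ (rlin_mop _)); last exact: cst_eps.
  rewrite !lft_ls; try exact: cst_eps.
  rewrite (lftC _ (hM i j) (hM a b)) !ls_eps !ls_sign.
  by case: (par i); case: (par j); case: (par a); case: (par b); rewrite /= ?opprK.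
rewrite !wtD; congr (_ + _); rewrite exchange_big /= !wt_sum; apply: eq_bigr => b _.
rewrite der_lft wt_sum {1 2}/ls {1}/lft ih wt_sum !mulr_sumr; apply: eq_bigr => j _.
by [].
Qed.

Lemma sym_mop M x : emx M -> sym (mop M x) = mop M (sym x).
Proof.
move=> hM; apply/funext => u; elim: u x => [|i u ih] x //.
change (sym (der i (mop M x)) u = lq i (mop M (sym x)) u).
rewrite lq_mop der_mop // (rlin_sum (rlin_sym _ _)) !wt_sum; apply: eq_bigr => j _.
by rewrite sym_lft /lft ih lq_sym.
Qed.

Definition hom k s x : Prop := forall u, size u = k -> g (s (+) wp u) (x u).

(** Right-linear maps of parity d from degree k to degree l that descend to the quotients by [kers],
    that is, to exterior powers. *)
Record isop (k l : nat) (d : bool) (O : W -> W) : Prop := IsOp {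
  op_lin : rlin O;
  op_zon : forall x, zon k x -> zon l (O x);
  op_hom : forall s x, hom k s x -> hom l (s (+) d) (O x);
  op_kers : forall x, kers k x -> kers l (O x)
}.

Lemma hom_dl k w : hom k (wp w) (dl w).
Proof.
move=> u _; rewrite /Words.dl; case: eqVneq => [->|_]; last exact: sr_0.
by rewrite addbb; apply: sr_1.
Qed.
Lemma hom_sum k s (J : Type) (r : seq J) (P : pred J) (F : J -> W) :
  (forall l, P l -> hom k s (F l)) -> hom k s (\sum_(l <- r | P l) F l).
Proof. by move=> h u hu; rewrite wt_sum; apply: sr_sum => // i hi; apply: h. Qed.
Lemma hom_lq k s i x : hom k.+1 s x -> hom k (s (+) par i) (lq i x).
Proof. by move=> h u hu; rewrite -addbA; apply: (h (i :: u)); rewrite /= hu. Qed.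

Lemma even_eps i j : g false (eps i j).
Proof. by apply: sr_N => //; rewrite -[_ ^+ _]mulr1; apply: sr_sign => //; apply: sr_1. Qed.

Lemma hom_ei k s i x : hom k s x -> hom k.+1 (s (+) par i) (ei i x).
Proof.
move=> h [//|j u] [hu] /=; case: eqVneq => [->|_]; last by rewrite mul0r; apply: sr_0.
by rewrite mul1r addbA -(addbA s) addbb addbF; apply: h.
Qed.
Lemma hom_der k s i x : hom k.+1 s x -> hom k (s (+) par i) (der i x).
Proof.
elim: k s x => [|k ih] s x h.
  by move=> u /size0nil ->; have := h [:: i] erefl; rewrite /= !addbF.
move=> [//|a u] [hu].
change (g (s (+) par i (+) (par a (+) wp u)) (lq a (der i x) u)).
rewrite lq_der wtD; apply: sr_D => //.
  by move: (h [:: i, a & u]); rewrite /= !addbA hu; apply.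
apply: sr_eM => //; first exact: even_eps.
have := ih _ _ (hom_lq a h) u hu.
by case: s {h}; case: (par i); case: (par a); case: (wp u).
Qed.
Lemma hom_lft k s d a x : g d a -> hom k s x -> hom k (s (+) d) (lft d a x).
Proof.
move=> ha h u hu; rewrite /Words.lft -mulrA; apply: sr_sign => //.
by rewrite addbAC addbC; apply: sr_M => //; apply: h.
Qed.
Lemma hom_sym k s x : hom k s x -> hom k s (sym x).
Proof.
elim: k s x => [|k ih] s x h; first by move=> u /size0nil ->; apply: h.
move=> [//|a u] [hu]; have := ih _ _ (hom_der a h) u hu.
by rewrite /= addbA.
Qed.
Lemma hom_mop M k s x : emx M -> hom k s x -> hom k s (mop M x).
Proof.
move=> hM; elim: k s x => [|k ih] s x h; first by move=> u /size0nil ->; apply: h.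
move=> [//|a u] [hu].
change (g (s (+) (par a (+) wp u)) (lq a (mop M x) u)).
rewrite lq_mop; move: u hu.
have : hom k (s (+) par a) (\sum_j lft (par a (+) par j) (M a j) (mop M (lq j x))).
  apply: hom_sum => j _; have := hom_lft (hM a j) (ih _ _ (hom_lq j h)).
  by rewrite (addbC (par a)) addbA -(addbA s) addbb addbF.
by move=> h' u hu; rewrite addbA; apply: h'.
Qed.

Lemma zon_lft k d a x : zon k x -> zon k (lft d a x).
Proof. by move=> h u hu; rewrite /Words.lft h ?mulr0. Qed.
Lemma zon_sum k (J : Type) (r : seq J) (P : pred J) (F : J -> W) :
  (forall l, P l -> zon k (F l)) -> zon k (\sum_(l <- r | P l) F l).
Proof. by move=> h u hu; rewrite wt_sum big1 // => i hi; apply: h. Qed.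
Lemma zon_mop M k x : zon k x -> zon k (mop M x).
Proof.
elim: k x => [|k ih] x h; first by apply/zonP0; apply: h.
apply/zonS => i; rewrite lq_mop; apply: zon_sum => j _; apply/zon_lft/ih.
by apply: (zonS _ _).1.
Qed.

Lemma isop_ei k i : isop k k.+1 (par i) (ei i).
Proof.
split; [exact: rlin_ei|exact: zon_ei|move=> s x; exact: hom_ei|exact: kers_ei].
Qed.
Lemma isop_der k i : isop k.+1 k (par i) (der i).
Proof.
split; [exact: rlin_der|exact: zon_der|move=> s x; exact: hom_der|exact: kers_der].
Qed.
Lemma isop_lft k d a : g d a -> isop k k d (lft d a).
Proof.
move=> ha; split; [exact: rlin_lft|exact: zon_lft|move=> s x; exact: hom_lft|].
by move=> x h; rewrite /Words.kers sym_lft; apply: zon_lft.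
Qed.
Lemma isop_sym k : isop k k false sym.
Proof.
split; [exact: rlin_sym|exact: zon_sym|move=> s x; rewrite addbF; exact: hom_sym|].
by move=> x h; apply: zon_sym.
Qed.
Lemma isop_mop k M : emx M -> isop k k false (mop M).
Proof.
move=> hM; split; [exact: rlin_mop|exact: zon_mop|move=> s x; rewrite addbF; exact: hom_mop|].
by move=> x h; rewrite /Words.kers sym_mop //; apply: zon_mop.
Qed.
Lemma isop_comp k l m d e O1 O2 :
  isop k l d O1 -> isop l m e O2 -> isop k m (d (+) e) (O2 \o O1).
Proof.
move=> h1 h2; split=> [|x hx|s x hx|x hx] /=.
- by apply: rlin_comp; [case: h2 | case: h1].
- exact/(op_zon h2)/(op_zon h1).
- by rewrite addbA; apply/(op_hom h2)/(op_hom h1).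
- exact/(op_kers h2)/(op_kers h1).
Qed.

Lemma zon_words k x : zon k (x - \sum_(w : k.-tuple I) rs (dl w) (x w)).
Proof.
move=> v hv; rewrite wtD wtN wt_sum.
have -> : v = tcast hv (in_tuple v) :> seq I by rewrite val_tcast.
set t := tcast _ _; rewrite (bigD1 t) //= big1 => [|w hw].
  by rewrite /rs /Words.dl eqxx mul1r addr0 subrr.
by rewrite /rs /Words.dl [_ == _](_ : _ = false) ?mul0r //; apply/negbTE; rewrite eq_sym.
Qed.

Lemma zon_expand k l (O : W -> W) x u : rlin O ->
  (forall x, zon k x -> zon l (O x)) -> size u = l ->
  O x u = \sum_(w : k.-tuple I) O (dl w) u * x w.
Proof.
move=> hl hz hu; have := hz _ (zon_words (k := k) x) u hu.
rewrite (rlinB hl) (rlin_sum hl) wtD wtN wt_sum => /subr0_eq ->.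
by apply: eq_bigr => w _; rewrite (rlinZ hl).
Qed.

Definition ptr k (O : W -> W) : B := \sum_(w : k.-tuple I) (-1) ^+ wp w * O (dl w) w.

Lemma ptrC k l d O1 O2 : isop l k d O1 -> isop k l d O2 ->
  ptr k (O1 \o O2) = (-1) ^+ d * ptr l (O2 \o O1).
Proof.
move=> h1 h2; rewrite /ptr.
under eq_bigr => w _ do rewrite /= (zon_expand _ (op_lin h1) (op_zon h1)) ?size_tuple // mulr_sumr.
under [in RHS]eq_bigr => w _ do
  rewrite /= (zon_expand _ (op_lin h2) (op_zon h2)) ?size_tuple // mulr_sumr.
rewrite exchange_big mulr_sumr; apply: eq_bigr => v _; rewrite mulr_sumr.
apply: eq_bigr => w _.
have g1 : g (wp v (+) d (+) wp w) (O1 (dl v) w).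
  by apply: (op_hom h1); [apply: hom_dl | rewrite size_tuple].
have g2 : g (wp w (+) d (+) wp v) (O2 (dl w) v).
  by apply: (op_hom h2); [apply: hom_dl | rewrite size_tuple].
rewrite (sr_C hg g1 g2) !mulrA -!signr_addb; congr (_ ^+ _ * _ * _).
by case: (wp v); case: d {h1 h2 g1 g2}; case: (wp w).
Qed.

Definition ifact k : B := xget 0 [set v : B | k`!%:R * v = 1]%classic.
Lemma ifactP k : k`!%:R * ifact k = 1.
Proof. by have [v hv] := sr_fact hg k; rewrite /ifact; case: xgetP => [w -> //|/(_ v)]. Qed.

Lemma ifactP' k : ifact k * k`!%:R = 1.
Proof. by rewrite mulr_natr -mulr_natl ifactP. Qed.
Lemma ifactC k a : ifact k * a = a * ifact k.
Proof.
rewrite -[ifact k * a]mulr1 -(ifactP k) mulrA -(mulrA _ a) mulr_natr -mulr_natl.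
by rewrite mulrA ifactP' mul1r.
Qed.

(* The supertrace on Lambda^k: [sym] is k! times a projection along the ideal. *)
Definition tr k (O : W -> W) : B := ifact k * ptr k (sym \o O).

Lemma ptr_ext k O1 O2 : (forall w, size w = k -> O1 (dl w) w = O2 (dl w) w) ->
  ptr k O1 = ptr k O2.
Proof. by move=> h; apply: eq_bigr => w _; rewrite h // size_tuple. Qed.

Lemma ptr_nat k c O : ptr k (fun x => ls c%:R (O x)) = c%:R * ptr k O.
Proof.
rewrite /ptr mulr_sumr; apply: eq_bigr => w _.
by rewrite /ls !mulrA commr_sign.
Qed.

(** [tr] sees only the induced map into the quotient by the kernel. *)
Lemma tr_kers k O1 O2 : (forall x, kers k (O1 x - O2 x)) -> tr k O1 = tr k O2.
Proof.
move=> h; congr (_ * _); apply: ptr_ext => w hw /=.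
by have := h (dl w) w hw; rewrite (rlinB (rlin_sym _ _)) wtD wtN => /subr0_eq.
Qed.

(** Cyclicity descends to exterior powers: O1 respects the kernels, so sym O1 sym O2 equals l! sym
    O1 O2, and likewise with k! in the other order. Hence [ptrC] for sym O1 and sym O2 gives the
    claim after division by the factorials. *)
Lemma trC k l d O1 O2 : isop l k d O1 -> isop k l d O2 ->
  tr k (O1 \o O2) = (-1) ^+ d * tr l (O2 \o O1).
Proof.
have aux m m' O O' : isop m' m d O -> isop m m' d O' ->
    ptr m ((sym \o O) \o (sym \o O')) = m'`!%:R * ptr m (sym \o (O \o O')).
  move=> h h'; rewrite -ptr_nat; apply: ptr_ext => w hw /=.
  have := op_kers h (@sym_kers _ _ par m' (O' (dl w))) => /(_ _ hw).
  rewrite (rlinB (op_lin h)) (rlinB (rlin_sym _ _)) wtD wtN => /subr0_eq ->.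
  by rewrite (rlinMn (op_lin h)) (rlinMn (rlin_sym _ _)) wtMn.
move=> h1 h2.
have h1' : isop l k d (sym \o O1) by rewrite -[d]addbF; apply: (isop_comp h1); apply: isop_sym.
have h2' : isop k l d (sym \o O2) by rewrite -[d]addbF; apply: (isop_comp h2); apply: isop_sym.
have e := ptrC h1' h2'; rewrite !(aux _ _ _ _ h1 h2, aux _ _ _ _ h2 h1) in e.
rewrite /tr; set a := ptr k _ in e *; set b := ptr l _ in e *.
have -> : a = ifact l * (l`!%:R * a) by rewrite mulrA ifactP' mul1r.
rewrite e.
rewrite (mulrA (ifact l)) (ifactC l) -mulrA (mulrA (ifact k)) (ifactC k) -mulrA.
congr (_ * _); rewrite mulrA (ifactC k) -mulrA (mulrA (ifact k)).
by rewrite ifactP' mul1r.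
Qed.

End Operators.

End Operators.
Import Operators.

(** * Newton's identities *)

Section Newton.
Context (B : nzRingType) (g : bool -> B -> Prop) (hg : superring g).
Context (n : nat) (par : 'I_n -> bool).
Local Notation I := 'I_n.
Local Notation W := (wten I B).
Local Notation wp := (wp par).
Local Notation eps := (eps B par).
Local Notation der := (der par).
Local Notation lft := (lft par).
Local Notation sym := (sym par).
Local Notation kers := (kers par).
Local Notation mop := (mop par).
Local Notation emx := (emx g par).
Local Notation isop := (isop g par).
Local Notation tr := (tr par).
Local Notation ptr := (ptr par).
Local Notation dl := (@dl I B).
Implicit Types (x y : W) (i j : I) (u w : seq I) (M N : 'M[B]_n).

Lemma ptr_sum k (J : Type) (r : seq J) (F : J -> W -> W) :
  ptr k (fun x => \sum_(a <- r) F a x) = \sum_(a <- r) ptr k (F a).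
Proof.
rewrite /Operators.ptr exchange_big; apply: eq_bigr => w _.
by rewrite wt_sum mulr_sumr.
Qed.
Lemma tr_sum k (J : Type) (r : seq J) (F : J -> W -> W) :
  tr k (fun x => \sum_(a <- r) F a x) = \sum_(a <- r) tr k (F a).
Proof.
rewrite /Operators.tr -mulr_sumr -ptr_sum; congr (_ * _); apply: eq_bigr => w _ /=.
by rewrite (rlin_sum (rlin_sym _ _)).
Qed.
Lemma tr_ls k c O : cst c -> tr k (fun x => ls c (O x)) = c * tr k O.
Proof.
move=> hc; rewrite /Operators.tr /Operators.ptr mulrA hc -mulrA; congr (_ * _).
rewrite mulr_sumr; apply: eq_bigr => w _ /=.
by rewrite (rlin_cst _ (rlin_sym _ _)) // /ls !mulrA hc.
Qed.
Lemma tr_ext k O1 O2 : (forall x, O1 x = O2 x) -> tr k O1 = tr k O2.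
Proof. by move=> h; congr (Operators.tr _ _ _); apply/funext. Qed.
Lemma trD k O1 O2 : tr k (fun x => O1 x + O2 x) = tr k O1 + tr k O2.
Proof.
rewrite /Operators.tr -mulrDr -big_split; congr (_ * _); apply: eq_bigr => w _ /=.
by rewrite (rlinD (rlin_sym _ _)) wtD mulrDr.
Qed.

Lemma even_cst a : g false a -> cst a.
Proof.
move=> ha b; have [b0 [b1 [h0 h1 ->]]] := sr_dec hg b.
by rewrite /GRing.comm mulrDl mulrDr (sr_eC hg ha h0) (sr_eC hg ha h1).
Qed.

Definition strL k M : B := tr k (mop M).
(* tr k (theta N M) interpolates between k str (Lambda^k M), for N = M, and the
   power sums str (M^j N), by moving e_l around the trace. *)
Definition theta N M x : W :=
  \sum_l \sum_j ei l (lft (par l (+) par j) (N l j) (mop M (der j x))).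

(** Pulling e_l out of M replaces it by sum_b e_b M b l, so M is absorbed into N; all parities
    combine to the single sign -1. *)
Lemma theta_step N M x : emx M -> emx N ->
  \sum_l \sum_j ls ((-1) ^+ par l)
    (ls (eps l j) (lft (par l (+) par j) (N l j) (mop M (ei l (der j x)))))
  = - theta (M *m N) M x.
Proof.
move=> hM hN.
transitivity (\sum_l \sum_j \sum_b - ei b (lft (par b (+) par j) (M b l * N l j)
   (mop M (der j x)))).
  apply: eq_bigr => l _; apply: eq_bigr => j _.
  rewrite mop_ei (rlin_sum (rlin_lft _ _ _)) !ls_sum; apply: eq_bigr => b _.
  rewrite lft_ei (lftC hg _ _ (hN l j) (hM b l)) (lft_lft _ _ (hM b l) (hN l j)).
  rewrite !(rlin_cst _ (rlin_ei _ _)); try exact: cst_sign.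
  rewrite !ls_eps !ls_sign.
  by case: (par l); case: (par j); case: (par b); rewrite /= ?opprK.
under eq_bigr => l _ do rewrite exchange_big /=.
rewrite exchange_big /theta -sumrN /=; apply: eq_bigr => b _.
rewrite exchange_big -sumrN /=; apply: eq_bigr => j _; rewrite sumrN; congr (- _).
rewrite -(rlin_sum (rlin_ei _ _)); congr (ei b _); apply/funext => u.
rewrite wt_sum /Words.lft mxE mulr_sumr mulr_suml; apply: eq_bigr => l _.
by rewrite !mulrA.
Qed.

(** By cyclicity e_l is moved to the other end of the trace, where it meets [der j]. The Kronecker
    term of [der_ei] splits off the factor str N, and [theta_step] collects the other term. *)
Lemma tr_theta N M k : emx M -> emx N ->
  tr k.+1 (theta N M) = strm par N * strL k M - tr k (theta (M *m N) M).
Proof.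
move=> hM hN; rewrite /theta tr_sum.
transitivity (\sum_l \sum_j (-1) ^+ par l * tr k (fun x =>
   ls (l == j)%:R (lft (par l (+) par j) (N l j) (mop M x)) +
   ls (eps l j) (lft (par l (+) par j) (N l j) (mop M (ei l (der j x)))))).
  apply: eq_bigr => l _; rewrite tr_sum; apply: eq_bigr => j _.
  have h1 := isop_ei hg par k l.
  have h2 : isop k.+1 k (par l) (lft (par l (+) par j) (N l j) \o (mop M \o der j)).
    have e : (par j (+) false) (+) (par l (+) par j) = par l.
      by case: (par l); case: (par j).
    rewrite -[X in isop _ _ X]e; apply: isop_comp; last exact: (isop_lft hg _ _ (hN l j)).
    exact: isop_comp (isop_der hg par k j) (isop_mop hg k hM).
  transitivity (tr k.+1 (ei l \o (lft (par l (+) par j) (N l j) \o (mop M \o der j)))) => //.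
  rewrite (trC hg h1 h2); congr (_ * _); apply: tr_ext => x /=.
  rewrite der_ei (rlinD (rlin_mop _ _)) (rlinD (rlin_lft _ _ _)).
  rewrite !(rlin_cst _ (rlin_mop _ _)) ?(rlin_cst _ (rlin_lft _ _ _)) //;
    by [exact: cst_eps | exact: cst_nat].
have e1 l j : tr k (fun x => ls (l == j)%:R (lft (par l (+) par j) (N l j) (mop M x)))
   = (l == j)%:R * (N l j * strL k M).
  rewrite tr_ls; last exact: cst_nat.
  case: eqVneq => [->|_]; last by rewrite !mul0r.
  rewrite !mul1r addbb -tr_ls; last by apply: even_cst; have := hN j j; rewrite addbb.
  by apply: tr_ext => x; apply/funext => u; rewrite /Words.lft /= mul1r.
transitivity (\sum_l \sum_j (-1) ^+ par l * ((l == j)%:R * (N l j * strL k M)) +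
  \sum_l \sum_j tr k (fun x => ls ((-1) ^+ par l)
   (ls (eps l j) (lft (par l (+) par j) (N l j) (mop M (ei l (der j x))))))).
  rewrite -big_split; apply: eq_bigr => l _; rewrite -big_split; apply: eq_bigr => j _.
  by rewrite trD mulrDr e1 [in RHS]tr_ls //; apply: cst_sign.
congr (_ + _).
  rewrite mulr_suml; apply: eq_bigr => l _; rewrite (bigD1 l) //= eqxx mul1r mulrA.
  by rewrite big1 ?addr0 // => j hj; rewrite eq_sym (negbTE hj) mul0r mulr0.
under eq_bigr => l _ do rewrite -tr_sum.
rewrite -tr_sum (@tr_ext _ _ (fun x => ls (-1) (theta (M *m N) M x))) => [|x]; last first.
  by rewrite theta_step // lsN ls1.
by rewrite tr_ls ?mulN1r // => a; rewrite /GRing.comm mulN1r mulrN1.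
Qed.

Lemma tr_theta0 N M : tr 0 (theta N M) = 0.
Proof.
rewrite /Operators.tr /Operators.ptr big1 ?mulr0 // => w _.
rewrite (size0nil (size_tuple w)) /= /theta wt_sum big1 ?mulr0 // => l _.
by rewrite wt_sum big1.
Qed.

Lemma emx_mul M N : emx M -> emx N -> emx (M *m N).
Proof.
move=> hM hN i j; rewrite mxE; apply: sr_sum => // k _.
have := sr_M hg (hM i k) (hN k j).
by rewrite addbA -(addbA (par i)) addbb addbF.
Qed.

(** For N = M the operator [theta] is M after sum_i e_i der_i, and the latter is k by Euler's
    identity. *)
Lemma euler_tr M k : emx M -> k%:R * strL k M = tr k (theta M M).
Proof.
move=> hM; rewrite -tr_ls; last exact: cst_nat.
apply: tr_kers => // x.
have -> : theta M M x = mop M (\sum_i ei i (der i x)).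
  rewrite (rlin_sum (rlin_mop _ _)) /theta exchange_big; apply: eq_bigr => j _ /=.
  by rewrite mop_ei.
have := op_kers (isop_mop hg k hM) (euler (kers_ideal _ _) k x).
rewrite (rlinB (rlin_mop _ _)) (rlinMn (rlin_mop _ _)).
have -> : mop M x *+ k = ls k%:R (mop M x).
  by apply/funext => u; rewrite wtMn.
by move=> /(id_N (kers_ideal _ _)); rewrite opprB.
Qed.

Lemma strL0 M : strL 0 M = 1.
Proof.
have := ifactP hg 0; rewrite /strL /Operators.tr fact0 mul1r => ->; rewrite mul1r.
rewrite /Operators.ptr (bigD1 [tuple]) //= big1 ?addr0 => [|w].
  by rewrite /Words.dl eqxx mulr1.
by move=> /eqP []; rewrite (tuple0 w).
Qed.

Lemma tr_theta_sum N M k : emx M -> emx N -> tr k.+1 (theta N M) =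
  \sum_(j < k.+1) (-1) ^+ j * strm par (iter j (mulmx M) N) * strL (k - j) M.
Proof.
move=> hM; elim: k N => [|k ih] N hN.
  by rewrite tr_theta // tr_theta0 subr0 big_ord1 mul1r.
rewrite tr_theta // ih; last exact: emx_mul.
rewrite [in RHS]big_ord_recl /= expr0 mul1r subn0; congr (_ + _); rewrite -sumrN; apply: eq_bigr => j _.
rewrite /bump /= exprS mulN1r !mulNr subSS; congr (- (_ * Operators.strm _ _ * _)); exact: (esym (iterSr j (mulmx M) N)).
Qed.

Lemma strL_newton M k : emx M -> k.+1%:R * strL k.+1 M =
  \sum_(j < k.+1) (-1) ^+ j * strm par (M ^+ j.+1) * strL (k - j) M.
Proof.
move=> hM; rewrite euler_tr // tr_theta_sum //; apply: eq_bigr => j _.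
congr (_ * strm par _ * _); elim: (nat_of_ord j) => [|m ih]; first by rewrite expr1.
by rewrite iterS ih [in RHS]exprS.
Qed.

End Newton.

(** * Standard monomials *)

Section SortedWords.
Context (B : nzRingType) (g : bool -> B -> Prop) (hg : superring g).
Context (n : nat) (par : 'I_n -> bool).
Local Notation I := 'I_n.
Local Notation W := (wten I B).
Local Notation wp := (wp par).
Local Notation eps := (eps B par).
Local Notation der := (der par).
Local Notation sym := (sym par).
Local Notation kers := (kers par).
Local Notation dl := (@dl I B).
Implicit Types (x y : W) (i j : I) (u w : seq I).

(* A word is a standard monomial if it is weakly increasing and repeats only odd
   letters. *)
Definition mord : rel I := fun i j => (i < j)%N || (i == j) && par j.
Definition mon u : bool := sorted mord u.

Lemma mord_trans : transitive mord.
Proof.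
move=> j i k /orP[h1|/andP[/eqP -> h1]] /orP[h2|/andP[/eqP <- h2]]; rewrite /mord.
- by rewrite (ltn_trans h1 h2).
- by rewrite h1.
- by rewrite h2.
- by rewrite eqxx h1 orbT.
Qed.
Lemma mord_anti : antisymmetric mord.
Proof.
move=> i j /andP[] /orP[h1|/andP[/eqP -> h1]] // /orP[h2|/andP[/eqP <- h2]] //.
by have := ltn_trans h1 h2; rewrite ltnn.
Qed.

Lemma dl_cons i w : dl (i :: w) = ei i (dl w).
Proof.
apply: lq_ext => // a; rewrite lq_ei ls_bool; apply/funext => u.
rewrite /lq /Words.dl eqseq_cons.
by case: eqP.
Qed.

Lemma der_dl_nil i : der i (dl [::]) = 0.
Proof.
have z a : lq a (dl [::]) = 0 by [].
apply: lq_ext => // a; rewrite lq_der !z (rlin0 (rlin_der _ _ _)) lsr0 addr0.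
by [].
Qed.

Lemma der_dl_supp i w u : der i (dl w) u != 0 -> perm_eq (i :: u) w.
Proof.
elim: w u => [|a w ih] u; first by rewrite der_dl_nil eqxx.
rewrite dl_cons der_ei ls_bool wtD => h.
have [e|hai] := eqVneq a i; last first.
  move: h; rewrite (negbTE hai) wt0 add0r /ls; case: u => [|b u] /=; first by rewrite mulr0 eqxx.
  case: (eqVneq b a) => [->|_]; last by rewrite mul0r mulr0 eqxx.
  rewrite mul1r => h; have : der i (dl w) u != 0 by apply: contraNneq h => ->; rewrite mulr0.
  move=> /ih h'; rewrite (perm_catCA [:: i] [:: a] u) /= ; by rewrite perm_cons.
subst a; rewrite eqxx in h; rewrite perm_cons.
have [/eqP->//|hu] := boolP (u == w).
move: h; rewrite /Words.dl (negbTE hu) add0r /ls; case: u hu => [|b u] hu /=; first by rewrite mulr0 eqxx.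
case: (eqVneq b i) => [->|_]; last by rewrite mul0r mulr0 eqxx.
rewrite mul1r => h; have : der i (dl w) u != 0 by apply: contraNneq h => ->; rewrite mulr0.
by move=> /ih h'.
Qed.

Lemma sym_dl_supp w u : sym (dl w) u != 0 -> perm_eq u w.
Proof.
elim: u w => [|i u ih] w.
  by rewrite /= /Words.dl; case: w => [|a w] //=; rewrite eqxx.
rewrite -[sym _ _]/(sym (der i (dl w)) u).
rewrite (zon_expand _ (rlin_sym _ par) (@zon_sym _ _ par (size u)) erefl) => h.
have [v hv] : exists v : (size u).-tuple I, sym (dl v) u * der i (dl w) v != 0.
  apply/existsP; apply: contraNT h; rewrite negb_exists => /forallP h.
  by rewrite big1 // => v _; apply/eqP; have := h v; rewrite negbK.
have h1 : sym (dl v) u != 0 by apply: contraNneq hv => ->; rewrite mul0r.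
have h2 : der i (dl w) v != 0 by apply: contraNneq hv => ->; rewrite mulr0.
by apply: perm_trans (der_dl_supp h2); rewrite perm_cons; apply: ih.
Qed.

(** Only copies of the first letter contribute. An even letter occurs once; copies of an odd letter
    add up without cancellation because [eps i i] = 1. So c + 1 is the multiplicity of i. *)
Lemma der_mon i w : mon (i :: w) ->
  exists c, der i (dl (i :: w)) = ls c.+1%:R (dl w).
Proof.
have z : forall v, i \notin v -> der i (dl v) = 0.
  move=> v hv; apply/funext => u; apply/eqP; apply: contraNT hv => /der_dl_supp h.
  by rewrite -(perm_mem h) mem_head.
have e0 v : der i (dl v) = 0 -> der i (dl (i :: v)) = ls 1%:R (dl v).
  move=> h; rewrite dl_cons der_ei eqxx h (rlin0 (rlin_ei _ _)).
  by rewrite (rlin0 (rlin_ls _ _)) addr0.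
elim: w => [|j w ih] hw; first by exists 0; apply/e0/der_dl_nil.
have /= /andP[hij hw'] := hw.
have ha := order_path_min mord_trans hw'.
case/orP: hij => [lij|/andP[/eqP eij hj]].
  exists 0; apply/e0/z; rewrite inE negb_or -(inj_eq val_inj) (ltn_eqF lij) /=.
  apply/negP => /(allP ha) /orP[|/andP[/eqP e _]].
    by rewrite ltnNge ltnW.
  by rewrite e ltnn in lij.
subst j; have [c hc] := ih hw'.
exists c.+1; rewrite dl_cons der_ei hc (rlin_cst _ (rlin_ei _ _)); last exact: cst_nat.
rewrite -dl_cons eqxx ls1 ls_eps hj; apply/funext => u.
by rewrite wtD /ls -[in RHS]addn1 natrD mulrDl mul1r addrC.
Qed.

Lemma sym_mon w : mon w -> exists c, sym (dl w) w = c.+1%:R.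
Proof.
elim: w => [|i w ih] hw; first by exists 0; rewrite /= /Words.dl eqxx.
have [c hc] := der_mon hw.
have [c' hc'] := ih (path_sorted hw).
exists (c.+1 * c'.+1).-1; rewrite prednK ?muln_gt0 // natrM -hc'.
change (sym (der i (dl (i :: w))) w = c.+1%:R * sym (dl w) w).
by rewrite hc (rlin_cst _ (rlin_sym _ _)) //; apply: cst_nat.
Qed.

(** A standard word is the only standard one among its permutations, so between standard words the
    matrix of [sym] is diagonal; its entries are positive integers, hence cancellable. *)
Lemma mon_free k (a : k.-tuple I -> B) :
  kers k (\sum_(w : k.-tuple I | mon w) rs (dl w) (a w)) ->
  forall w : k.-tuple I, mon w -> a w = 0.
Proof.
move=> h w hw; have := h w (size_tuple w).
rewrite (rlin_sum (rlin_sym _ _)) wt_sum (bigD1 w) //= big1 => [|v /andP[hv nvw]].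
  have [c hc] := sym_mon hw.
  by rewrite addr0 (rlinZ (rlin_sym _ _)) /rs hc; apply: (sr_inj hg).
rewrite (rlinZ (rlin_sym _ _)) /rs.
have [-> |/sym_dl_supp hp] := eqVneq (sym (dl v) w) 0; first by rewrite mul0r.
case/eqP: nvw; apply/val_inj/esym.
exact: (sorted_eq mord_trans mord_anti hw hv hp).
Qed.

Lemma kers_sq k i x : par i = false -> kers k.+2 (ei i (ei i x)).
Proof.
move=> hi; have : kers k.+2 (ei i (ei i x) - ls (eps i i) (ei i (ei i x))) by exact: kers_rel.
rewrite (_ : eps i i = -1); last first.
  by rewrite /Words.eps hi.
rewrite lsN ls1 opprK -mulr2n => h u hu; have := h u hu.
rewrite (rlinMn (rlin_sym _ _)) wtMn; exact: (sr_inj hg).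
Qed.

(** Insertion sort modulo the relations: the new letter moves right past smaller ones, and the
    tensor dies when an even letter meets its equal ([kers_sq]). *)
Lemma mon_insert i w : mon w -> kers (size w).+1 (dl (i :: w)) \/
  exists u b, [/\ mon u, perm_eq u (i :: w) &
    kers (size w).+1 (dl (i :: w) - ls ((-1) ^+ b) (dl u))].
Proof.
elim: w => [|h w ih] hw.
  right; exists [:: i], 0%N; rewrite perm_refl ls1 subrr; split=> //.
  exact: (id_0 (kers_ideal _ _)).
have [hih|] := boolP (mord i h).
  right; exists [:: i, h & w], 0%N; rewrite perm_refl ls1 subrr; split=> //.
    by rewrite /mon /= hih.
  exact: (id_0 (kers_ideal _ _)).
rewrite negb_or -leqNgt => /andP[lhi hih].
move: lhi; rewrite leq_eqVlt => /orP[/eqP/val_inj e|lhi].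
  subst h; left; rewrite !dl_cons; apply: kers_sq.
  by move: hih; rewrite eqxx; case: (par i).
have key : kers (size w).+2 (dl [:: i, h & w] - ls (eps i h) (ei h (dl (i :: w)))).
  by rewrite !dl_cons; apply: kers_rel.
case: (ih (path_sorted hw)) => [hz|[u [b [hu hp hk]]]].
  left; rewrite /= -[dl _](subrK (ls (eps i h) (ei h (dl (i :: w))))).
  apply: (id_D (kers_ideal _ _)) => //; apply: (id_ls (kers_ideal _ _)); first exact: cst_eps.
  exact: kers_ei.
right; exists (h :: u), (~~ (par i && par h) + b)%N; split.
- rewrite /mon /= path_min_sorted //; rewrite (perm_all _ hp) /= {1}/mord lhi /=.
  exact: (order_path_min mord_trans hw).
- by rewrite perm_sym (perm_catCA [:: i] [:: h] w) /= perm_cons perm_sym.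
- apply: (id_trans (kers_ideal _ _) key).
  have -> : (-1) ^+ (~~ (par i && par h) + b) = eps i h * (-1) ^+ b.
    by rewrite exprD /Words.eps; case: (par i && par h); rewrite /= ?expr0 ?expr1 ?opprK.
  rewrite -lsA -(rlinB (rlin_ls _ _)); apply: (id_ls (kers_ideal _ _)); first exact: cst_eps.
  rewrite (dl_cons h) -(rlin_cst _ (rlin_ei _ _)); last exact: cst_sign.
  by rewrite -(rlinB (rlin_ei _ _)); apply: kers_ei.
Qed.

Lemma word_mon w : kers (size w) (dl w) \/
  exists u b, [/\ mon u, size u = size w &
    kers (size w) (dl w - ls ((-1) ^+ b) (dl u))].
Proof.
elim: w => [|i w ih].
  right; exists [::], 0%N; rewrite ls1 subrr; split=> //.
  exact: (id_0 (kers_ideal _ _)).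
case: ih => [hz|[u [b [hu hs hk]]]]; first by left; rewrite dl_cons; apply: kers_ei.
have hk' : kers (size w).+1 (dl (i :: w) - ls ((-1) ^+ b) (dl (i :: u))).
  rewrite !dl_cons -(rlin_cst _ (rlin_ei _ _)); last exact: cst_sign.
  by rewrite -(rlinB (rlin_ei _ _)); apply: kers_ei.
have := mon_insert i hu; rewrite hs => -[hz|[v [c [hv hp hk2]]]].
  left; rewrite /= -[dl _](subrK (ls ((-1) ^+ b) (dl (i :: u)))).
  by apply: (id_D (kers_ideal _ _)) => //; apply: (id_ls (kers_ideal _ _)) => //; apply: cst_sign.
right; exists v, (b + c)%N; split=> //; first by rewrite (perm_size hp) /= hs.
apply: (id_trans (kers_ideal _ _) hk').
rewrite exprD -lsA -(rlinB (rlin_ls _ _)); apply: (id_ls (kers_ideal _ _)) => //.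
exact: cst_sign.
Qed.

Lemma mon_span k x : exists a : k.-tuple I -> B,
  kers k (x - \sum_(w : k.-tuple I | mon w) rs (dl w) (a w)).
Proof.
have hJ := kers_ideal B par.
pose sp y := exists a : k.-tuple I -> B,
  kers k (y - \sum_(w : k.-tuple I | mon w) rs (dl w) (a w)).
have sp0 y : kers k y -> sp y.
  by move=> hy; exists (fun=> 0); rewrite big1 ?subr0 // => w _; apply/funext => u; apply: mulr0.
have spD y z : sp y -> sp z -> sp (y + z).
  move=> [a ha] [b hb]; exists (fun t => a t + b t).
  rewrite (eq_bigr (fun w : k.-tuple I => rs (dl w) (a w) + rs (dl w) (b w))) => [|w _].
    by rewrite big_split opprD addrACA; apply: (id_D hJ).
  by apply/funext => u; apply: mulrDr.
have spZ y c : sp y -> sp (rs y c).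
  move=> [a ha]; exists (fun t => a t * c).
  rewrite (eq_bigr (fun w : k.-tuple I => rs (rs (dl w) (a w)) c)) => [|w _].
    by rewrite -rs_sum -rsN -rsD; apply: (id_Z hJ).
  by rewrite rsA.
have spm (w : k.-tuple I) : mon w -> sp (dl w).
  move=> hw; exists (fun v => (v == w)%:R); rewrite (bigD1 w) //= eqxx rsr1 big1 ?addr0.
    by rewrite subrr; apply: (id_0 hJ).
  by move=> v /andP[_ /negbTE ->]; apply/funext => u; apply: mulr0.
have spw (w : k.-tuple I) : sp (dl w).
  have := word_mon w; rewrite size_tuple => -[/sp0 //|[u [b [hu hs hk]]]].
  rewrite -[dl w](subrK (ls ((-1) ^+ b) (dl u))); apply: spD; first exact: sp0.
  rewrite ls_rs; last exact: cst_sign.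
  have -> : u = tcast hs (in_tuple u) :> seq I by rewrite val_tcast.
  by apply/spZ/spm; rewrite val_tcast.
rewrite -/(sp x) -[x](subrK (\sum_(w : k.-tuple I) rs (dl w) (x w))); apply: (spD _ _).
  by apply/sp0/zon_sym/zon_words.
apply: (big_ind sp); [exact/sp0/(id_0 hJ) | exact: spD |].
by move=> w _; apply: (spZ _ _ (spw w)).
Qed.

End SortedWords.

(** * Identification of the exterior powers *)

Lemma supercommutative_superring (C : fieldType) (A : algType C)
    (gA : bool -> {pred A}) :
  (forall n, n.+1%:R != 0 :> C) -> supercommutative gA ->
  superring (fun d x => x \in gA d).
Proof.
move=> hC hA; have hB d x y : x \in gA d -> y \in gA d -> x - y \in gA d.
  have [_ h] := super_submod hA d.
  by move=> hx hy; rewrite addrC -scaleN1r; apply: h.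
split=> //; first exact: super_one hA; try exact: super_mul hA.
- exact: super_comm hA.
- move=> x; have [x0 h0 [x1 h1 e]] := super_decomp hA x.
  by exists x0, x1.
- exact: super_direct hA.
- move=> n; exists ((n.+1%:R : C)^-1 *: 1).
  by rewrite mulr_natl -scaler_nat scalerA mulfV // scale1r.
Qed.

Section Link.
Context (C : fieldType) (A : algType C) (gA : bool -> {pred A}).
Context (hg : superring (fun d x => x \in gA d)).
Context (p q : nat).
Local Notation g := (fun (d : bool) (x : A) => x \in gA d).
Local Notation I := 'I_(p + q).
Local Notation W := (wten I A).
Local Notation par := (@ipar p q).
Local Notation wp := (wp par).
Local Notation sym := (sym par).
Local Notation kers := (kers par).
Local Notation mop := (mop par).
Local Notation lft := (lft par).
Local Notation dl := (@dl I A).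
Local Notation T k := (tensor A p q k).

Definition ofW k (x : W) : T k := [ffun w : {ffun 'I_k -> I} => x (tuple_of_finfun w)].
Definition toW k (x : T k) : W :=
  fun u => if insub u is Some t then x (finfun_of_tuple (t : k.-tuple I)) else 0.

Lemma toW_tuple k (x : T k) (t : k.-tuple I) : toW x t = x (finfun_of_tuple t).
Proof. by rewrite /toW valK. Qed.
Lemma toWK k (x : T k) : ofW k (toW x) = x.
Proof. by apply/ffunP => w; rewrite ffunE toW_tuple tuple_of_finfunK. Qed.
Lemma ofWK k (x : W) (t : k.-tuple I) : toW (ofW k x) t = x t.
Proof. by rewrite toW_tuple ffunE finfun_of_tupleK. Qed.
Lemma zon_tuple k (x : W) : (forall t : k.-tuple I, x t = 0) -> zon k x.
Proof.
move=> h u hu; have -> : u = tcast hu (in_tuple u) :> seq I by rewrite val_tcast.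
exact: h.
Qed.
Lemma ofWKz k (x : W) : zon k (toW (ofW k x) - x).
Proof. by apply: zon_tuple => t; rewrite wtD wtN ofWK subrr. Qed.
Lemma ofW_zon k x : zon k x -> ofW k x = 0.
Proof. by move=> h; apply/ffunP => w; rewrite !ffunE h ?size_tuple. Qed.
Lemma ofWD k x y : ofW k (x + y) = ofW k x + ofW k y.
Proof. by apply/ffunP => w; rewrite !ffunE. Qed.
Lemma ofWZ k x a : ofW k (rs x a) = tscale (ofW k x) a.
Proof. by apply/ffunP => w; rewrite !ffunE. Qed.
Lemma toWD k (x y : T k) : toW (x + y) = toW x + toW y.
Proof.
apply/funext => u; rewrite wtD /toW; case: insub => [t|]; by rewrite ?ffunE ?addr0.
Qed.
Lemma toWZ k (x : T k) a : toW (tscale x a) = rs (toW x) a.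
Proof.
apply/funext => u; rewrite /rs /toW; case: insub => [t|]; by rewrite ?ffunE ?mul0r.
Qed.
Lemma toW0 k : toW (0 : T k) = 0.
Proof. by apply/funext => u; rewrite /toW; case: insub => [t|]; rewrite ?ffunE. Qed.
Lemma toW_sum k (J : Type) (r : seq J) (F : J -> T k) :
  toW (\sum_(j <- r) F j) = \sum_(j <- r) toW (F j).
Proof. by apply: big_morph; [exact: toWD | exact: toW0]. Qed.

Lemma tuple_of_finfunE k (w : {ffun 'I_k -> I}) :
  tuple_of_finfun w = [seq w i | i <- enum 'I_k] :> seq I.
Proof. by rewrite /= /image_mem /= ?val_ord_tuple ?enumT. Qed.

Lemma wp_enum k (F : 'I_k -> I) (w : seq I) :
  w = [seq F i | i <- enum 'I_k] -> \big[addb/false]_(i < k) par (F i) = wp w.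
Proof.
by move=> ->; rewrite -[LHS]big_enum /=; elim: (enum _) => [|i r ih];
  rewrite ?big_nil // big_cons ih.
Qed.
Lemma wpar_wp k (w : {ffun 'I_k -> I}) : wpar w = wp (tuple_of_finfun w).
Proof. by apply: wp_enum; apply: tuple_of_finfunE. Qed.

(** Tensoring on the left with a vector, as a combination of creation operators: the double sum of
    signs in [pure_tensor] then arises one factor at a time. *)
Definition vec (s : bool) (v : 'cV[A]_(p + q)) (x : W) : W :=
  \sum_i ei i (lft (s (+) par i) (v i 0) x).
Definition pureW (l : seq (bool * 'cV[A]_(p + q))) : W :=
  foldr (fun sv x => vec sv.1 sv.2 x) (dl [::]) l.

Lemma lq_vec i s v x : lq i (vec s v x) = lft (s (+) par i) (v i 0) x.
Proof.
rewrite /vec lq_sum (bigD1 i) //= lq_ei eqxx ls1 big1 ?addr0 // => j hj.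
by rewrite lq_ei eq_sym (negbTE hj) ls0.
Qed.

Lemma sign_sum k (b : bool) (F : 'I_k -> bool) :
  (-1) ^+ (\sum_(j < k) (b && F j))%N = (-1) ^+ (b && \big[addb/false]_(j < k) F j) :> A.
Proof.
elim/big_rec2: _ => [|j x y _ ih]; first by rewrite andbF.
rewrite exprD ih -signr_addb; congr (_ ^+ _).
by case: b {ih}; case: (F j); case: x.
Qed.

Lemma map_enum_ordSl (X : Type) k (f : 'I_k.+1 -> X) :
  [seq f i | i <- enum 'I_k.+1] = f ord0 :: [seq f (lift ord0 i) | i <- enum 'I_k].
Proof. by rewrite enum_ordSl map_cons; congr (_ :: _); elim: (enum _) => //= a r ->. Qed.

Lemma pureW_eval k (s : 'I_k -> bool) (v : 'I_k -> 'cV[A]_(p + q)) (w : 'I_k -> I) :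
  pureW [seq (s i, v i) | i <- enum 'I_k] [seq w i | i <- enum 'I_k] =
  (-1) ^+ (\sum_(i < k) \sum_(j < k | (i < j)%N) ((s i (+) par (w i)) && par (w j)))%N
    * \prod_(i < k) v i (w i) 0.
Proof.
elim: k s v w => [|k ih] s v w.
  have -> : enum 'I_0 = [::] by apply: size0nil; rewrite size_enum_ord.
  by rewrite !big_ord0 mulr1 /= /Words.dl eqxx.
rewrite !map_enum_ordSl.
rewrite -[LHS]/(lq (w ord0) (vec (s ord0) (v ord0)
  (pureW [seq ((s \o lift ord0) i, (v \o lift ord0) i) | i <- enum 'I_k]))
  [seq (w \o lift ord0) i | i <- enum 'I_k]) lq_vec /Words.lft.
rewrite (ih (s \o lift ord0) (v \o lift ord0) (w \o lift ord0)).
rewrite !big_ord_recl exprD -!mulrA.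
have e1 : (\sum_(j < k.+1 | (@ord0 k < j)%N) ((s ord0 (+) par (w ord0)) && par (w j)))%N =
   (\sum_(j < k) ((s ord0 (+) par (w ord0)) && par (w (lift ord0 j))))%N.
  by rewrite big_mkcond big_ord_recl.
rewrite e1.
rewrite sign_sum (wp_enum (w := [seq (w \o lift ord0) i | i <- enum 'I_k])) //.
congr (_ * _); rewrite !mulrA -commr_sign; congr (_ * _ * _); congr (_ ^+ _).
apply: eq_bigr => i _; by rewrite [RHS]big_mkcond big_ord_recl -big_mkcond.
Qed.

Lemma pure_tensorE k (s : 'I_k -> bool) (v : 'I_k -> 'cV[A]_(p + q)) :
  pure_tensor s v = ofW k (pureW [seq (s i, v i) | i <- enum 'I_k]).
Proof.
apply/ffunP => w; rewrite !ffunE.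
rewrite tuple_of_finfunE.
by rewrite pureW_eval.
Qed.

Lemma mop_dl (M : 'M[A]_(p + q)) w :
  mop M (dl w) = pureW [seq (par a, col a M) | a <- w].
Proof.
elim: w => [|a w ih].
  apply: lq_ext => // i; rewrite lq_mop big1 // => j _.
  by rewrite (_ : lq j _ = 0) // (rlin0 (rlin_mop _ _)) (rlin0 (rlin_lft _ _ _)).
rewrite dl_cons mop_ei ih; apply: eq_bigr => i _.
by rewrite mxE addbC.
Qed.

Lemma ofW_sum k (J : Type) (r : seq J) (F : J -> W) :
  ofW k (\sum_(j <- r) F j) = \sum_(j <- r) ofW k (F j).
Proof. by apply: big_morph; [exact: ofWD | apply: ofW_zon]. Qed.

Lemma tensor_opE k (M : 'M[A]_(p + q)) (x : T k) :
  tensor_op M x = ofW k (mop M (toW x)).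
Proof.
have e : mop M (toW x) = mop M (toW x - \sum_(w : k.-tuple I) rs (dl w) (toW x w)) +
    \sum_(w : k.-tuple I) rs (mop M (dl w)) (toW x w).
  rewrite (rlinB (rlin_mop _ _)) (rlin_sum (rlin_mop _ _)) -[LHS]addr0 -addrA; congr (_ + _).
  rewrite -sumrN -big_split big1 // => w _ /=.
  by rewrite (rlinZ (rlin_mop _ _)) addNr.
rewrite e ofWD ofW_zon ?add0r; last by apply/zon_mop/zon_words.
rewrite ofW_sum (reindex (@tuple_of_finfun I k)); last first.
  by exists (@finfun_of_tuple I k) => z _; rewrite ?finfun_of_tupleK ?tuple_of_finfunK.
apply: eq_bigr => w _; rewrite ofWZ toW_tuple tuple_of_finfunK; congr (tscale _ _).
rewrite mop_dl pure_tensorE tuple_of_finfunE; congr (ofW _ (pureW _)).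
by rewrite -map_comp.
Qed.

Definition hvec (sv : bool * 'cV[A]_(p + q)) : Prop := vec_par gA sv.1 sv.2.

Lemma kers_vec k sv x : hvec sv -> kers k x -> kers k.+1 (vec sv.1 sv.2 x).
Proof.
move=> hv hx; apply: (id_sum (kers_ideal _ _)) => i _; apply: kers_ei.
exact: (op_kers (isop_lft hg _ _ (hv i)) hx).
Qed.

Lemma rlin_vec s v : rlin (vec s v).
Proof.
split=> [x y|x a].
  rewrite -big_split; apply: eq_bigr => i _.
  by rewrite (rlinD (rlin_lft _ _ _)) (rlinD (rlin_ei _ _)).
rewrite rs_sum; apply: eq_bigr => i _.
by rewrite (rlinZ (rlin_lft _ _ _)) (rlinZ (rlin_ei _ _)).
Qed.

(** Expanding both vectors gives the relations between basis letters; the signs come from moving the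
    coordinates into a common order in both products. *)
Lemma kers_swap2 k s v t u (z : W) : hvec (s, v) -> hvec (t, u) ->
  kers k.+2 (vec s v (vec t u z) + rs (vec t u (vec s v z)) ((-1) ^+ (s && t))).
Proof.
move=> hv hu.
have -> : vec s v (vec t u z) + rs (vec t u (vec s v z)) ((-1) ^+ (s && t)) =
  \sum_i \sum_j ls ((-1) ^+ ((s (+) par i) && par j))
     (ei i (ei j (lft (s (+) par i) (v i 0) (lft (t (+) par j) (u j 0) z)))
     - ls (eps A par i j)
        (ei j (ei i (lft (s (+) par i) (v i 0) (lft (t (+) par j) (u j 0) z))))).
  rewrite -ls_rs; last exact: cst_sign.
  have -> : vec t u (vec s v z) = \sum_i \sum_j ei j (lft (t (+) par j) (u j 0)
     (ei i (lft (s (+) par i) (v i 0) z))).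
    rewrite exchange_big; apply: eq_bigr => j _ /=.
    by rewrite -(rlin_sum (rlin_ei _ _)) -(rlin_sum (rlin_lft _ _ _)).
  rewrite ls_sum -big_split; apply: eq_bigr => i _ /=.
  rewrite /vec (rlin_sum (rlin_lft _ _ _)) (rlin_sum (rlin_ei _ _)) ls_sum -big_split.
  apply: eq_bigr => j _ /=; rewrite !lft_ei.
  rewrite !(rlin_cst _ (rlin_ei _ _)); try exact: cst_sign.
  rewrite (lftC hg _ _ (hu j) (hv i)) !(rlin_cst _ (rlin_ei _ _)); try exact: cst_sign.
  rewrite !ls_eps !ls_sign {hv hu}.
  by case: s; case: t; case: (par i); case: (par j); rewrite /= ?opprD ?opprK.
apply: (id_sum (kers_ideal _ _)) => i _; apply: (id_sum (kers_ideal _ _)) => j _.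
by apply: (id_ls (kers_ideal _ _)); [exact: cst_sign | exact: kers_rel].
Qed.

Lemma kers_swap l1 x y l2 :
  (forall sv, sv \in l1 ++ [:: x, y & l2] -> hvec sv) ->
  kers (size (l1 ++ [:: x, y & l2]))
   (pureW (l1 ++ [:: x, y & l2]) + rs (pureW (l1 ++ [:: y, x & l2])) ((-1) ^+ (x.1 && y.1))).
Proof.
elim: l1 => [|sv l1 ih] h.
  case: x y h => [s v] [t u] h;
  by apply: (@kers_swap2 (size l2) s v t u (pureW l2)); apply: h; rewrite !inE eqxx ?orbT.
rewrite /= -(rlinZ (rlin_vec _ _)) -(rlinD (rlin_vec _ _)); apply: kers_vec.
  by apply: h; rewrite mem_head.
by apply: ih => sv' h'; apply: h; rewrite inE h' orbT.
Qed.

Lemma enum_adj k (i j : 'I_k) : j = i.+1 :> nat -> exists a b : seq 'I_k,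
  [/\ a = take i (enum 'I_k), b = drop j.+1 (enum 'I_k), enum 'I_k = (a ++ [:: i, j & b])%SEQ &
  forall (X : Type) (f : 'I_k -> X), [seq f (tperm i j l) | l <- enum 'I_k] =
    ([seq f l | l <- a] ++ [:: f j, f i & [seq f l | l <- b]])%SEQ].
Proof.
move=> hij; have hi := ltn_ord i; have hj := ltn_ord j.
have e : enum 'I_k = (take i (enum 'I_k) ++ [:: i, j & drop j.+1 (enum 'I_k)])%SEQ.
  rewrite -{1}(cat_take_drop i (enum 'I_k)) (drop_nth i) ?size_enum_ord //.
  rewrite nth_ord_enum; congr (_ ++ _ :: _); rewrite -hij (drop_nth i) ?size_enum_ord //.
  by rewrite nth_ord_enum.
exists (take i (enum 'I_k)), (drop j.+1 (enum 'I_k)); split=> // X f.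
move: (enum_uniq 'I_k); rewrite {1}e cat_uniq /= !negb_or => /and3P[_ /and3P[ia ja _] /andP[]].
move=> /andP[_ ib] /andP[jb _]. have {}ib : i \notin drop j.+1 (enum 'I_k) := ib.
rewrite {1}e map_cat /= tpermL tpermR; congr (_ ++ [:: _, _ & _]).
all: apply/eq_in_map => l hl; rewrite tpermD //.
all: by apply/eqP => e'; move: hl; rewrite -e' ?(negbTE ia) ?(negbTE ja) ?(negbTE ib) ?(negbTE jb).
Qed.

Lemma ext_kers k (x : T k) : ext_ideal gA x -> kers k (toW x).
Proof.
elim=> [s v i j hv hij| |y z _ hy _ hz|y a _ hy].
- have [a [b [_ _ e et]]] := enum_adj hij.
  rewrite !pure_tensorE -ofWZ -ofWD.
  rewrite -[toW _](subrK (pureW [seq (s l, v l) | l <- enum 'I_k] +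
     rs (pureW [seq ((s \o tperm i j) l, (v \o tperm i j) l) | l <- enum 'I_k])
       ((-1) ^+ (s i && s j)))).
  apply: (id_D (kers_ideal _ _)); first exact/zon_sym/ofWKz.
  rewrite (et _ (fun l => (s l, v l))) e map_cat /=.
  have := @kers_swap [seq (s l, v l) | l <- a] (s i, v i) (s j, v j) [seq (s l, v l) | l <- b].
  have hs : size ([seq (s l, v l) | l <- a] ++ [:: (s i, v i), (s j, v j) & [seq (s l, v l) | l <- b]]) = k.
    by rewrite -[RHS](size_enum_ord k) e !size_cat /= !size_map.
  rewrite hs; apply=> sv; rewrite (_ : (_ ++ _)%SEQ = [seq (s l, v l) | l <- enum 'I_k]).
    by move=> /mapP[l _ ->]; apply: hv.
  by rewrite e map_cat.
- by rewrite toW0; apply: (id_0 (kers_ideal _ _)).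
- by rewrite toWD; apply: (id_D (kers_ideal _ _)).
- by rewrite toWZ; apply: (id_Z (kers_ideal _ _)).
Qed.

Lemma ext_swap k l1 x y l2 : size (l1 ++ [:: x, y & l2]) = k ->
  (forall sv, sv \in l1 ++ [:: x, y & l2] -> hvec sv) ->
  ext_ideal gA (ofW k (pureW (l1 ++ [:: x, y & l2])
     + rs (pureW (l1 ++ [:: y, x & l2])) ((-1) ^+ (x.1 && y.1)))).
Proof.
move=> hs hv; set L := (l1 ++ _)%SEQ in hs hv *.
have hi : (size l1 < k)%N by rewrite -hs size_cat /= -addSnnS leq_addr.
have hj : ((size l1).+1 < k)%N by rewrite -hs size_cat /= -!addSnnS leq_addr.
pose f (i : 'I_k) := nth x L i.
have eL : [seq f i | i <- enum 'I_k] = L.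
  transitivity [seq nth x L i | i <- map val (enum 'I_k)]; first by rewrite -map_comp.
  by rewrite val_enum_ord -hs map_nth_iota0 // take_size.
have fi : f (Ordinal hi) = x by rewrite /f /= nth_cat ltnn subnn.
have fj : f (Ordinal hj) = y by rewrite /f /= nth_cat ltnNge leqnSn /= subSnn.
have [a [b [ea eb e et]]] := @enum_adj k (Ordinal hi) (Ordinal hj) erefl.
have := @ext_ideal_gen C A gA p q k (fun i => (f i).1) (fun i => (f i).2)
  (Ordinal hi) (Ordinal hj) _ erefl.
rewrite !pure_tensorE -ofWZ -ofWD fi fj.
have es (h : 'I_k -> bool * 'cV[A]_(p + q)) : (fun i => ((h i).1, (h i).2)) = h.
  by apply/funext => i; case: (h i).
rewrite (es f) eL.
have -> : [seq (((fun i => (f i).1) \o tperm (Ordinal hi) (Ordinal hj)) i,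
     ((fun i => (f i).2) \o tperm (Ordinal hi) (Ordinal hj)) i) | i <- enum 'I_k] =
   (l1 ++ [:: y, x & l2])%SEQ.
  transitivity [seq f (tperm (Ordinal hi) (Ordinal hj) i) | i <- enum 'I_k].
    by apply: eq_map => i /=; case: (f _).
  rewrite et fi fj ea eb map_take map_drop eL /= take_size_cat //; congr (_ ++ [:: _, _ & _]).
  by rewrite -[L]/(l1 ++ [:: x; y] ++ l2)%SEQ catA drop_size_cat // size_cat addn2.
by apply=> l; apply: hv; rewrite -eL map_f // mem_enum.
Qed.

Lemma vec_delta i x : vec (par i) (delta_mx i 0) x = ei i x.
Proof.
rewrite /vec (bigD1 i) //= big1 ?addr0 => [|j hj]; last first.
  rewrite mxE (negbTE hj) /= (_ : lft _ 0 x = 0) ?(rlin0 (rlin_ei _ _)) //.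
  by apply/funext => u; rewrite /Words.lft mulr0 mul0r.
rewrite mxE !eqxx addbb; congr (ei i _); apply/funext => u.
by rewrite /Words.lft /= !mul1r.
Qed.

Lemma dl_pureW w : dl w = pureW [seq (par a, delta_mx a 0) | a <- w].
Proof. by elim: w => [|a w ih] //; rewrite dl_cons ih /= vec_delta. Qed.

Lemma hvec_delta i : hvec (par i, delta_mx i 0).
Proof.
move=> j; rewrite mxE andbT; case: eqVneq => [->|_].
  by rewrite addbb; apply: (sr_1 hg).
exact: (sr_0 hg).
Qed.

Lemma ofW_wd k (x y : W) : zon k (x - y) -> ofW k x = ofW k y.
Proof. by move=> /ofW_zon h; rewrite -[x](subrK y) ofWD h add0r. Qed.

(** Serves the inclusion converse to [ext_kers]: once the exterior ideal has these closure
    properties, [sym_sub_ideal] puts the kernel of the symmetrizer inside it. *)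
Lemma ext_is_ideal : is_ideal par (fun k x => ext_ideal gA (ofW k x)).
Proof.
split=> [k x hx|k x y hx hy|k x a hx|k i x hx|k i j x].
- by rewrite ofW_zon //; apply: ext_ideal_zero.
- by rewrite ofWD; apply: ext_ideal_add.
- by rewrite ofWZ; apply: ext_ideal_scale.
- rewrite (@ofW_wd _ _ (ei i (toW (ofW k x)))); last first.
    rewrite -(rlinB (rlin_ei _ _)); apply: zon_ei; rewrite -opprB => u hu.
    by rewrite wtN ofWKz // oppr0.
  elim: hx => [s v a b hv hab| |y z _ hy _ hz|y c _ hy].
  (* Left multiplication by e_i prepends a basis vector to the list of factors, so a generator stays
     a generator. *)
  + have [l1 [l2 [_ _ e et]]] := enum_adj hab.
    pose f l := (s l, v l).
    rewrite (@ofW_wd _ _ (ei i (pureW [seq f l | l <- enum 'I_k]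
       + rs (pureW [seq f (tperm a b l) | l <- enum 'I_k]) ((-1) ^+ (s a && s b))))); last first.
      rewrite -(rlinB (rlin_ei _ _)); apply: zon_ei.
      by rewrite !pure_tensorE -ofWZ -ofWD; apply: ofWKz.
    rewrite (et _ f) e map_cat -vec_delta.
    rewrite (rlinD (rlin_vec _ _)) (rlinZ (rlin_vec _ _)).
    apply: (@ext_swap _ ((par i, delta_mx i 0) :: map f l1) (f a) (f b) (map f l2)).
      rewrite /= -[RHS](congr1 S (size_enum_ord k)) e !size_cat /= !size_map.
      by [].
    move=> sv; rewrite [X in sv \in X](_ : _ = (par i, delta_mx i 0) :: [seq f l | l <- enum 'I_k]).
      by rewrite inE => /orP[/eqP ->|/mapP[l _ ->]]; [apply: hvec_delta | apply: hv].
    by rewrite e map_cat.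
  + by rewrite toW0 (rlin0 (rlin_ei _ _)) ofW_zon //; apply: ext_ideal_zero.
  + by rewrite toWD (rlinD (rlin_ei _ _)) ofWD; apply: ext_ideal_add.
  + by rewrite toWZ (rlinZ (rlin_ei _ _)) ofWZ; apply: ext_ideal_scale.
(* By right linearity x may be taken to be a word, and then the relation is a generator on basis
   vectors. *)
- pose F x := ei i (ei j x) - ls (eps A par i j) (ei j (ei i x)).
  have lF : rlin F.
    rewrite /F; split=> [y z|y a].
      by rewrite !(rlinD (rlin_ei _ _)) lsD opprD addrACA.
    by rewrite !(rlinZ (rlin_ei _ _)) (rlinZ (rlin_ls _ _)) -rsN -rsD.
  rewrite -/(F x) (@ofW_wd _ _ (\sum_(w : k.-tuple I) rs (F (dl w)) (x w))); last first.
    have -> : F x - \sum_(w : k.-tuple I) rs (F (dl w)) (x w) =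
       F (x - \sum_(w : k.-tuple I) rs (dl w) (x w)).
      rewrite (rlinB lF) (rlin_sum lF); congr (_ - _); apply: eq_bigr => w _.
      by rewrite (rlinZ lF).
    have hz := @zon_words A (p + q) k x.
    apply: zonD; first by do 2 apply: zon_ei.
    by move=> u hu; rewrite wtN /ls (zon_ei _ (zon_ei _ hz)) // mulr0 oppr0.
  rewrite ofW_sum; apply: (big_ind (fun t => ext_ideal gA t)) => [|y z hy hz|w _].
  + exact: ext_ideal_zero.
  + exact: ext_ideal_add.
  rewrite ofWZ; apply: ext_ideal_scale.
  have -> : F (dl w) = pureW [seq (par a, delta_mx a 0) | a <- [:: i, j & w]] +
     rs (pureW [seq (par a, delta_mx a 0) | a <- [:: j, i & w]]) ((-1) ^+ (par i && par j)).
    rewrite -!dl_pureW !dl_cons /F; congr (_ + _).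
    by rewrite -ls_rs ?lsN ?opprK //; apply: cst_sign.
  apply: (@ext_swap k.+2 [::] (par i, delta_mx i 0) (par j, delta_mx j 0)
     [seq (par a, delta_mx a 0) | a <- w]).
    by rewrite /= size_map size_tuple.
  rewrite -[_ ++ _]/[seq (par a, delta_mx a (0 : 'I_1)) | a <- [:: i, j & w]] => sv /mapP[a _ ->].
  exact: hvec_delta.
Qed.

Lemma kers_ext k (x : T k) : kers k (toW x) -> ext_ideal gA x.
Proof.
have [v hv] := sr_fact hg k.
by move=> /(sym_sub_ideal ext_is_ideal hv); rewrite toWK.
Qed.

Lemma ext_kersP k (x : T k) : ext_ideal gA x <-> kers k (toW x).
Proof. by split; [apply: ext_kers | apply: kers_ext]. Qed.

End Link.

(** * Independence of the supertrace on an exterior power from the basis *)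

Section Trace.
Context (C : fieldType) (A : algType C) (gA : bool -> {pred A}).
Context (hg : superring (fun d x => x \in gA d)).
Context (p q : nat).
Local Notation g := (fun (d : bool) (x : A) => x \in gA d).
Local Notation I := 'I_(p + q).
Local Notation W := (wten I A).
Local Notation par := (@ipar p q).
Local Notation wp := (wp par).
Local Notation sym := (sym par).
Local Notation kers := (kers par).
Local Notation mop := (mop par).
Local Notation dl := (@dl I A).
Local Notation T k := (tensor A p q k).

Lemma toW_tcomb k n (E : 'I_n -> T k) a :
  toW (tcomb E a) = \sum_(j < n) rs (toW (E j)) (a j).
Proof. by rewrite toW_sum; apply: eq_bigr => j _; rewrite toWZ. Qed.

Lemma toWN k (x : T k) : toW (- x) = - toW x.
Proof.
apply/funext => u; rewrite wtN /toW; case: insub => [t|]; by rewrite ?ffunE ?oppr0.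
Qed.
Lemma toWB k (x y : T k) : toW (x - y) = toW x - toW y.
Proof. by rewrite toWD toWN. Qed.

Section Uniq.
Context (k n : nat) (d : 'I_n -> bool) (F : 'I_n -> W).

Definition hom_free := (forall j, hom g par k (d j) (F j)) /\
  forall a : 'I_n -> A, kers k (\sum_j rs (F j) (a j)) -> forall j, a j = 0.

(** Split each coefficient by parity. The parts of the wrong parity add up to a tensor whose
    symmetrization has both parities, hence vanishes, and freeness kills them. *)
Lemma hom_coef x s (a : 'I_n -> A) : hom_free -> hom g par k s x ->
  kers k (x - \sum_j rs (F j) (a j)) -> forall j, a j \in gA (d j (+) s).
Proof.
move=> [hF fF] hx hk.
have /choice[b hb] j := sr_dec2 hg (d j (+) s) (a j).
have /choice[c hc] := hb.
suff h : forall j, c j = 0 by move=> j; have [h1 _ ->] := hc j; rewrite h addr0.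
apply: fF => u hu; have := hk u hu.
have -> : x - \sum_j rs (F j) (a j) = (x - \sum_j rs (F j) (b j)) - \sum_j rs (F j) (c j).
  rewrite -addrA -opprD -big_split; congr (_ - _); apply: eq_bigr => j _ /=.
  by apply/funext => v; rewrite wtD /rs -mulrDr; have [_ _ <-] := hc j.
rewrite (rlinB (rlin_sym _ _)) wtD wtN => /subr0_eq e.
apply: (@sr_dir2 _ _ hg (s (+) wp u)).
  rewrite -e; apply: (hom_sym hg) hu => v hv; rewrite wtD wtN; apply: (sr_B hg).
    exact: hx.
  rewrite wt_sum; apply: (sr_sum hg) => j _; have [hbj _ _] := hc j.
  have := sr_M hg (hF j v hv) hbj.
  by rewrite addbAC addbA addbb.
rewrite -addTb addbA; apply: (hom_sym hg) hu => v hv.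
rewrite wt_sum; apply: (sr_sum hg) => j _; have [_ hcj _] := hc j.
have := sr_M hg (hF j v hv) hcj.
by case: (d j); case: (s); case: (wp v).
Qed.

End Uniq.

(** Let G write the words in the given basis F modulo the kernel, and let z_j represent M F_j. Then
    L = G z, and supercommutativity gives str (G z) = str (z G), where z G is sym M divided by k!,
    an expression free of the basis. *)
Lemma strLambda_uniq k (M : 'M[A]_(p + q)) t : even_op gA M ->
  is_strLambda gA k M t -> t = strL par k M.
Proof.
move=> hM [n [d [E [L [[hE sE fE] hL ->]]]]].
pose F j := toW (E j).
have hJ := kers_ideal A par.
have hF : hom_free k d F.
  split=> [j u hu|a ha].
    have -> : u = tcast hu (in_tuple u) :> seq I by rewrite val_tcast.
    rewrite /F toW_tuple -[X in wp (tval X)]finfun_of_tupleK -wpar_wp; exact: hE.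
  apply: fE; apply/(ext_kersP hg); rewrite toW_tcomb; exact: ha.
have /choice[G hG] : forall w : k.-tuple I, exists a : 'I_n -> A,
    kers k (dl w - \sum_j rs (F j) (a j)).
  move=> w; have [a ha] := sE (ofW k (dl w)); exists a.
  move: ha => /(ext_kersP hg); rewrite toWB toW_tcomb => ha.
  rewrite -[dl w](subrK (toW (ofW k (dl w)))) -addrA; apply: (id_D hJ) => //.
  by apply: zon_sym; rewrite -opprB => u hu; rewrite wtN ofWKz // oppr0.
have gG w j : G w j \in gA (d j (+) wp w).
  by apply: (hom_coef hF) (hG w) j; apply: (hom_dl hg).
(* With the symmetrized representative of M F_j the final trace is literally the one in [tr]. *)
pose z j : W := ls (ifact A k) (sym (mop M (F j))).
have cf : cst (ifact A k) by move=> a; apply: (ifactC hg).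
have hz j : kers k (mop M (F j) - z j).
  have h := @sym_kers _ _ par k (mop M (F j)).
  have -> : mop M (F j) - z j = ls (- ifact A k) (sym (mop M (F j)) - mop M (F j) *+ k`!).
    rewrite lsN (rlinB (rlin_ls _ _)) opprB -/(z j); congr (_ - _).
    by apply/funext => u; rewrite /ls wtMn mulrA (ifactP' hg) mul1r.
  apply: (id_ls hJ) => // a; rewrite /GRing.comm mulNr mulrN; congr (- _); exact: cf.
have eL i j : L i j = \sum_(w : k.-tuple I) G w i * z j w.
  have h1 : kers k (mop M (F j) - \sum_i rs (F i) (L i j)).
    have := hL j; rewrite /ext_eq => /(ext_kersP hg).
    rewrite toWB toW_tcomb tensor_opE => h.
    rewrite -[mop M _](subrK (toW (ofW k (mop M (F j))))) -addrA; apply: (id_D hJ) => //.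
    by apply: zon_sym; rewrite -opprB => u hu; rewrite wtN ofWKz // oppr0.
  have h2 : kers k (z j - \sum_i rs (F i) (\sum_(w : k.-tuple I) G w i * z j w)).
    apply: (id_trans hJ (y := \sum_(w : k.-tuple I) rs (dl w) (z j w))).
      exact/zon_sym/zon_words.
    have -> : \sum_i rs (F i) (\sum_(w : k.-tuple I) G w i * z j w) =
       \sum_(w : k.-tuple I) rs (\sum_i rs (F i) (G w i)) (z j w).
      rewrite (eq_bigr (fun i => \sum_(w : k.-tuple I) rs (rs (F i) (G w i)) (z j w))) => [|l _].
        by rewrite exchange_big; apply: eq_bigr => w _; rewrite rs_sum.
      apply/funext => u; rewrite wt_sum /rs mulr_sumr; apply: eq_bigr => w _.
      by rewrite mulrA.
    rewrite -sumrB; apply: (id_sum hJ) => w _.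
    by rewrite -rsN -rsD; apply: (id_Z hJ).
  have h3 : kers k (\sum_i rs (F i) (L i j - \sum_(w : k.-tuple I) G w i * z j w)).
    rewrite (eq_bigr (fun i => rs (F i) (L i j) - rs (F i) (\sum_(w : k.-tuple I) G w i * z j w)))
      => [|l _]; last by apply/funext => u; rewrite wtD wtN /rs mulrBr.
    rewrite sumrB; apply: (id_trans hJ (y := mop M (F j))).
      by rewrite -opprB; apply: (id_N hJ).
    by apply: (id_trans hJ (hz j)).
  by have /(_ i)/subr0_eq := hF.2 _ h3.
have gz j (w : k.-tuple I) : z j w \in gA (d j (+) wp w).
  (* The inverse of k! is even: k! times its odd part is both odd and even, hence zero, and k! can
     be cancelled. *)
  have hi : ifact A k \in gA false.
    have [y [y' [hy hy' e]]] := sr_dec hg (ifact A k).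
    have e' := ifactP hg k; rewrite e mulrDr in e'.
    have h0 : k`!%:R * y' = 0.
      apply: (sr_dir hg); last by apply: (sr_eM hg) => //; apply: (sr_nat hg).
      rewrite -[X in X \in _](addKr (k`!%:R * y)) e' addrC; apply: (sr_B hg).
        exact: (sr_1 hg).
      by apply: (sr_eM hg) => //; apply: (sr_nat hg).
    by rewrite e (sr_injf hg h0) addr0.
  apply: (sr_eM hg) => //.
  apply: (hom_sym hg); last exact: size_tuple.
  by apply: (hom_mop hg hM); have [h _] := hF; apply: h.
transitivity (\sum_(w : k.-tuple I) (-1) ^+ wp w * \sum_j z j w * G w j).
  under eq_bigr => j _ do rewrite eL mulr_sumr.
  rewrite exchange_big; apply: eq_bigr => w _ /=; rewrite mulr_sumr.
  apply: eq_bigr => j _; rewrite (sr_C hg (gG w j) (gz j w)) mulrA -signr_addb.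
  by congr (_ ^+ _ * _); case: (d j); case: (wp w).
rewrite /strL /tr /ptr mulr_sumr; apply: eq_bigr => w _.
rewrite (mulrA (ifact A k)) cf -mulrA; congr (_ * _).
transitivity ((ls (ifact A k) (sym (mop M (\sum_j rs (F j) (G w j))))) w).
  rewrite !(rlin_sum (rlin_mop _ _)) !(rlin_sum (rlin_sym _ _)) ls_sum wt_sum.
  apply: eq_bigr => j _; rewrite (rlinZ (rlin_mop _ _)) (rlinZ (rlin_sym _ _)).
  by rewrite (rlinZ (rlin_ls _ _)).
rewrite /ls /=; congr (_ * _).
have := op_kers (isop_mop hg k hM) (hG w) (size_tuple w).
by rewrite (rlinB (rlin_mop _ _)) (rlinB (rlin_sym _ _)) wtD wtN => /subr0_eq ->.
Qed.

(** Standard monomials form a homogeneous basis; this excludes the default value 0 in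
    [strLambda]. *)
Lemma strLambda_exists k (M : 'M[A]_(p + q)) : even_op gA M ->
  exists t, is_strLambda gA k M t.
Proof.
move=> hM; pose S : pred (k.-tuple I) := fun w => mon par w.
pose wd (j : 'I_#|S|) : k.-tuple I := enum_val j.
have hJ := kers_ideal A par.
pose E j : T k := ofW k (dl (wd j)).
have comb (a : 'I_#|S| -> A) : kers k (toW (tcomb E a) - \sum_j rs (dl (wd j)) (a j)).
  rewrite toW_tcomb -sumrB; apply: (id_sum hJ) => j _.
  by rewrite -rsN -rsD; apply/(id_Z hJ)/zon_sym/ofWKz.
have combS (b : k.-tuple I -> A) :
   \sum_(w : k.-tuple I | mon par w) rs (dl w) (b w) = \sum_j rs (dl (wd j)) (b (wd j)).
  by rewrite [LHS](big_enum_val (A := S)).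
have span x : exists a : 'I_#|S| -> A, ext_eq gA x (tcomb E a).
  have [b hb] := mon_span hg par k (toW x); exists (b \o wd); apply/(ext_kersP hg).
  rewrite toWB; apply: (id_trans hJ hb); rewrite combS -opprB; apply: (id_N hJ).
  exact: comb.
have /choice[L hL] : forall j, exists a : 'I_#|S| -> A, ext_eq gA (tensor_op M (E j)) (tcomb E a).
  by move=> j; apply: span.
exists (\sum_(j < #|S|) (-1) ^+ (wp (wd j)) * L j j).
exists #|S|, (fun j => wp (wd j)), E, (\matrix_(i, j) L j i); split.
- split=> // [j w|a ha].
    rewrite ffunE wpar_wp; apply: (hom_dl hg); exact: size_tuple.
  have hk : kers k (\sum_j rs (dl (wd j)) (a j)).
    rewrite -[X in kers _ X](subrK (toW (tcomb E a))) -opprB; apply: (id_D hJ).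
      by apply: (id_N hJ); apply: comb.
    exact/(ext_kersP hg).
  have := @mon_free _ _ hg _ par k (fun w => if [pick j | wd j == w] is Some j then a j else 0).
  rewrite combS => h j.
  have e i : (if [pick j | wd j == wd i] is Some j then a j else 0) = a i.
    case: pickP => [j' /eqP /enum_val_inj -> //|/(_ i)]; by rewrite eqxx.
  rewrite -e; apply: h; last exact: (enum_valP j).
  by rewrite (eq_bigr (fun j => rs (dl (wd j)) (a j))) // => i _; rewrite e.
- move=> j; rewrite (_ : (fun i => _) = L j) //.
  by apply/funext => i; rewrite mxE.
- by apply: eq_bigr => j _; rewrite mxE.
Qed.

Lemma strLambdaE k (M : 'M[A]_(p + q)) : even_op gA M ->
  strLambda gA (Posz k) M = strL par k M.
Proof.
move=> hM; rewrite /strLambda; case: xgetP => [t _ /= ht|h].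
  exact: strLambda_uniq.
by have [t ht] := strLambda_exists k hM; case: (h t).
Qed.

End Trace.

(** * Power series and even matrices *)

Lemma elt_invE (T : pzRingType) (x y : T) : x * y = 1 -> y * x = 1 -> elt_inv x = y.
Proof.
move=> h1 h2; rewrite /elt_inv; case: xgetP => [z _ /= [h3 h4]|/(_ y) []] //.
by rewrite -[z]mul1r -h2 -mulrA h3 mulr1.
Qed.
Lemma mx_inv_unique (T : pzRingType) n (M N P : 'M[T]_n) :
  N *m M = 1%:M -> M *m P = 1%:M -> N = P.
Proof. by move=> h1 h2; rewrite -[N]mulmx1 -h2 mulmxA h1 mul1mx. Qed.
Lemma mx_invE (T : pzRingType) n (M N : 'M[T]_n) :
  M *m N = 1%:M -> N *m M = 1%:M -> mx_inv M = N.
Proof.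
move=> h1 h2; rewrite /mx_inv; case: xgetP => [P _ /= [h3 h4]|/(_ N) []] //.
by apply: mx_inv_unique h4 h1.
Qed.

(** Course-of-values recursion: [G m] tabulates the correct values below m and is arbitrary beyond,
    which [Phi] cannot see by hypothesis. *)
Lemma strong_rec (X : Type) (x0 : X) (Phi : nat -> (nat -> X) -> X) :
  (forall n f f', (forall i, (i < n)%N -> f i = f' i) -> Phi n f = Phi n f') ->
  exists f, forall n, f n = Phi n f.
Proof.
move=> h; pose G := fix G m := if m is m'.+1 then
  fun n => if n == m' then Phi n (G m') else G m' n else fun=> x0.
exists (fun n => G n.+1 n) => n; rewrite [LHS]/= eqxx; apply: h => i.
elim: n => // n ih; rewrite ltnS leq_eqVlt => /orP[/eqP -> //|lin].
by rewrite -ih // [LHS]/= (ltn_eqF lin).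
Qed.

Section PowerSeries.
Context (B : nzRingType).
Implicit Types f h : pseries B.

Lemma psD f h n : (f + h) n = f n + h n. Proof. by []. Qed.
Lemma ps1 n : (1 : pseries B) n = (n == 0%N)%:R. Proof. by []. Qed.
Lemma psM f h n : (f * h) n = \sum_(i < n.+1) f i * h (n - i)%N. Proof. by []. Qed.
Lemma ps_sum (J : Type) (r : seq J) (P : pred J) (F : J -> pseries B) n :
  (\sum_(i <- r | P i) F i) n = \sum_(i <- r | P i) F i n.
Proof. by elim/big_rec2: _ => // i a b _ <-. Qed.
Lemma psMr f h n : (f * h) n = \sum_(i < n.+1) f (n - i)%N * h i.
Proof.
rewrite psM (reindex_inj rev_ord_inj); apply: eq_bigr => i _ /=.
by rewrite !subSS subKn // -ltnS.
Qed.

Definition dps f : pseries B := fun n => n.+1%:R * f n.+1.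
Lemma dpsD f h : dps (f + h) = dps f + dps h.
Proof. by apply/funext => n; rewrite /dps psD mulrDr. Qed.
(** Coefficient n depends only on truncations below degree n + 2, where this is Leibniz' rule for
    polynomials. *)
Lemma dpsM f h : dps (f * h) = dps f * h + f * dps h.
Proof.
apply/funext => n; rewrite psD.
have nm : (n.+1 < n.+2)%N by [].
have tr f' : (ps_trunc n.+2 f')^`() = ps_trunc n.+1 (dps f').
  apply/polyP => i; rewrite coef_deriv !coef_poly !ltnS.
  by case: ifP; rewrite ?mul0rn // /dps mulr_natl.
transitivity ((ps_trunc n.+2 f * ps_trunc n.+2 h)^`())`_n.
  by rewrite coef_deriv -(@ps_mulE _ f h n.+1 n.+2) // /dps mulr_natl.
rewrite derivM !tr coefD; congr (_ + _); rewrite coefM psM; apply: eq_bigr => i _.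
  rewrite !coef_poly ltn_ord; congr (_ * _).
  by rewrite ltnS (leq_trans (leq_subr _ _)).
rewrite !coef_poly (ltn_trans (ltn_ord i)) //; congr (_ * _).
by rewrite ltnS leq_subr.
Qed.

Context (n : nat).
Definition cmx k (F : 'M[pseries B]_n) : 'M[B]_n := map_mx (fun f => f k) F.
Definition psmx (c : nat -> 'M[B]_n) : 'M[pseries B]_n :=
  \matrix_(i, j) ((fun k => c k i j) : pseries B).
Lemma psmxK c k : cmx k (psmx c) = c k.
Proof. by apply/matrixP => i j; rewrite !mxE. Qed.
Lemma cmx_inj F G : (forall k, cmx k F = cmx k G) -> F = G.
Proof.
move=> h; apply/matrixP => i j; apply/funext => k.
by have /matrixP/(_ i j) := h k; rewrite !mxE.
Qed.
Lemma cmx_mul F G k : cmx k (F *m G) = \sum_(i < k.+1) cmx i F *m cmx (k - i) G.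
Proof.
apply/matrixP => i j; rewrite !mxE ps_sum summxE.
under [RHS]eq_bigr => l _ do rewrite mxE.
rewrite exchange_big; apply: eq_bigr => m _ /=.
by apply: eq_bigr => l _; rewrite !mxE.
Qed.
Lemma cmx1 k : cmx k 1%:M = if k == 0%N then 1%:M else 0.
Proof.
apply/matrixP => i j; rewrite [LHS]mxE; case: eqP => [->|hk]; rewrite !mxE; case: (i == j) => //.
by rewrite mulr1n ps1; case: eqP.
Qed.

(** A left and a right inverse are solved for coefficient by coefficient; the coefficients do not
    commute, so both are built, and then they coincide. *)
Lemma mx_ps_inv (F : 'M[pseries B]_n) : mx_invertible (cmx 0 F) -> mx_invertible F.
Proof.
move=> [P [h1 h2]].
have [|l hl] := @strong_rec 'M[B]_n 0 (fun k c =>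
    if k is k'.+1 then - (\sum_(i < k'.+1) c i *m cmx (k - i) F) *m P else P).
  by case=> [|k] c c' e //; congr (- _ *m _); apply: eq_bigr => i _; rewrite e.
have [|r hr] := @strong_rec 'M[B]_n 0 (fun k c =>
    if k is k'.+1 then P *m - (\sum_(i < k'.+1) cmx (k - i) F *m c i) else P).
  by case=> [|k] c c' e //; congr (_ *m - _); apply: eq_bigr => i _; rewrite e.
have el : psmx l *m F = 1%:M.
  apply: cmx_inj => -[|k]; rewrite cmx_mul cmx1 /=.
    by rewrite big_ord1 psmxK hl h2.
  rewrite big_ord_recr /= subnn psmxK hl -mulmxA h2 mulmx1.
  by under eq_bigr => i _ do rewrite psmxK; rewrite subrr.
have er : F *m psmx r = 1%:M.
  apply: cmx_inj => -[|k]; rewrite cmx_mul cmx1 /=.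
    by rewrite big_ord1 psmxK hr h1.
  rewrite (reindex_inj rev_ord_inj) big_ord_recr /= subnn psmxK subn0 hr mulmxA h1 mul1mx.
  apply/eqP; rewrite addr_eq0 opprK; apply/eqP; apply: eq_bigr => i _.
  rewrite psmxK subSS; congr (cmx _ F *m r _).
  by rewrite subKn // ltnW.
by exists (psmx l); rewrite {1}(mx_inv_unique el er).
Qed.

End PowerSeries.

Section PsSuper.
Context (B : nzRingType) (g : bool -> B -> Prop) (hg : superring g).
Definition psg (d : bool) (f : pseries B) : Prop := forall n, g d (f n).

(** Allows every result on superrings to be applied over power series, and repeatedly: the
    deformation in s and the characteristic variable z are two such steps. *)
Lemma psg_superring : superring psg.
Proof.
split.
- by move=> d x y hx hy n; apply: (sr_B hg).
- by move=> n; rewrite ps1; case: eqP => _; [apply: (sr_1 hg) | apply: (sr_0 hg)].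
- by move=> d e x y hx hy n; rewrite psM; apply: (sr_sum hg) => i _; apply: (sr_M hg).
- move=> d e x y hx hy; apply/funext => n.
  have -> : (-1) ^+ (d && e) * (y * x) = (if d && e then - (y * x) else y * x).
    by rewrite mulr_sign.
  transitivity ((-1) ^+ (d && e) * (y * x) n); last by rewrite mulr_sign; case: (d && e).
  rewrite psM psMr mulr_sumr; apply: eq_bigr => i _; exact: (sr_C hg).
- move=> x; have /choice[x0 /choice[x1 h]] := fun n => sr_dec hg (x n).
  exists x0, x1; split=> [n|n|]; [by have [] := h n | by have [] := h n |].
  by apply/funext => n; have [_ _] := h n.
- move=> x h0 h1; apply/funext => n; exact: (sr_dir hg).
- move=> n; have [u hu] := sr_div hg n.
  exists (fun k => if k == 0%N then u else 0); apply/funext => k.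
  have nat_ps m : (m%:R : pseries B) = (fun k => (k == 0%N)%:R * m%:R).
    apply/funext => l; elim: m => [|m ih]; first by rewrite mulr0.
    by rewrite mulrSr psD ih ps1 [in RHS]mulrSr mulrDr mulr1.
  rewrite nat_ps psM big_ord_recl subn0 mul1r /= big1 ?addr0 => [|i _]; last by rewrite !mul0r.
  by case: eqP => [->|/eqP/negbTE h]; rewrite ps1 ?hu ?mulr0 // h.
Qed.

Lemma dps_psg d f : psg d f -> psg d (dps f).
Proof. by move=> h n; apply: (sr_eM hg); [apply: (sr_nat hg) | apply: h]. Qed.
End PsSuper.

(** * Jacobi's formula for a derivation *)

Section Derivation.
Context (K : comNzRingType) (D : K -> K).
Hypotheses (DD : forall x y, D (x + y) = D x + D y)
  (DM : forall x y, D (x * y) = D x * y + x * D y).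

Lemma deriv0 : D 0 = 0.
Proof. by apply: (addIr (D 0)); rewrite -DD !add0r. Qed.
Lemma deriv1 : D 1 = 0.
Proof. by apply: (addIr (D 1)); have := DM 1 1; rewrite !mulr1 mul1r add0r. Qed.
Lemma derivN x : D (- x) = - D x.
Proof. by apply: (addIr (D x)); rewrite -DD !addNr deriv0. Qed.
Lemma deriv_sum (J : Type) (r : seq J) (P : pred J) (F : J -> K) :
  D (\sum_(i <- r | P i) F i) = \sum_(i <- r | P i) D (F i).
Proof. by apply: big_morph; [exact: DD | exact: deriv0]. Qed.

Lemma deriv_prod (J : finType) (F : J -> K) :
  D (\prod_i F i) = \sum_i D (F i) * \prod_(j | i != j) F j.
Proof.
have h (r : seq J) : uniq r -> D (\prod_(i <- r) F i) =
    \sum_(i <- r) D (F i) * \prod_(j <- r | i != j) F j.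
  elim: r => [|a r ih] /=; first by rewrite !big_nil deriv1.
  move=> /andP[ar ur]; rewrite !big_cons DM eqxx ih // mulr_sumr; congr (_ * _ + _).
    rewrite [RHS]big_seq_cond [LHS]big_seq_cond; apply: eq_bigl => j.
    by apply: andb_id2l => jr; apply/esym; apply: contraNneq ar => ->.
  rewrite !big_seq; apply: eq_bigr => i ir; rewrite big_cons.
  have ia : i != a by apply: contraNneq ar => <-.
  by rewrite ia mulrCA.
by have := h _ (index_enum_uniq J).
Qed.

(** Differentiating the Leibniz formula gives one term for each row i and permutation s; those with
    the same value s i assemble into a cofactor. *)
Lemma deriv_det n (X : 'M[K]_n) : D (\det X) = \tr (map_mx D X *m \adj X).
Proof.
have Ds (s : 'S_n) x : D ((-1) ^+ s * x) = (-1) ^+ s * D x.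
  by rewrite !mulr_sign; case: (s : bool); rewrite ?derivN.
rewrite /determinant deriv_sum /mxtrace.
transitivity (\sum_i \sum_(s : 'S_n) (-1) ^+ s *
   (D (X i (s i)) * \prod_(j | i != j) X j (s j))).
  rewrite exchange_big; apply: eq_bigr => s _ /=.
  by rewrite Ds deriv_prod mulr_sumr.
apply: eq_bigr => i _; rewrite mxE.
rewrite (partition_big (fun s : 'S_n => s i) predT) //=; apply: eq_bigr => j _.
rewrite !mxE expand_cofactor mulr_sumr; apply: eq_bigr => s /eqP <-.
by rewrite mulrCA.
Qed.
End Derivation.

Section Nilpotent.
Context (K : comNzRingType).
Definition nilp (x : K) : Prop := exists n, x ^+ n = 0.

Lemma nilp0 : nilp 0. Proof. by exists 1%N; rewrite expr1. Qed.
Lemma nilpM x y : nilp x -> nilp (x * y).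
Proof. by move=> [n hn]; exists n; rewrite exprMn hn mul0r. Qed.
Lemma nilpD x y : nilp x -> nilp y -> nilp (x + y).
Proof.
move=> [n hn] [m hm]; exists (n + m)%N; rewrite exprDn big1 // => i _.
have [hi|hi] := leqP m i.
  by rewrite -(subnKC hi) (exprD y) hm mul0r mulr0 mul0rn.
have e : (n <= n + m - i)%N by rewrite -addnBA ?leq_addr // ltnW.
by rewrite -(subnKC e) exprD hn !mul0r mul0rn.
Qed.
Lemma nilp_sum (J : Type) (r : seq J) (P : pred J) (F : J -> K) :
  (forall i, P i -> nilp (F i)) -> nilp (\sum_(i <- r | P i) F i).
Proof. by move=> h; elim/big_ind: _ => //; [apply: nilp0 | apply: nilpD]. Qed.
Lemma nilp_unit x : nilp x -> exists u, u * (1 - x) = 1.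
Proof.
move=> [n hn]; exists (\sum_(i < n) x ^+ i).
have := subrXX 1 x n; rewrite hn expr1n subr0 => h; rewrite [RHS]h.
by rewrite mulrC; congr (_ * _); apply: eq_bigr => i _; rewrite expr1n mul1r.
Qed.
Lemma nilp_det n (X Y : 'M[K]_n) :
  (forall i j, nilp (X i j - Y i j)) -> nilp (\det X - \det Y).
Proof.
move=> h; rewrite /determinant -sumrB; apply: nilp_sum => s _.
rewrite -mulrBr mulrC; apply: nilpM.
apply: (big_ind2 (fun x y => nilp (x - y))) => [|x x' y y' hx hy|i _].
- by rewrite subrr; apply: nilp0.
- rewrite (_ : _ - _ = (x - x') * y + (y - y') * x'); last first.
    by rewrite !mulrBl [y * x']mulrC [y' * x']mulrC addrA subrK.
  by apply: nilpD; apply: nilpM.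
- exact: h.
Qed.
End Nilpotent.

(** * Even matrices, their inverses and determinants *)

Section EvenMatrices.
Context (B : nzRingType) (g : bool -> B -> Prop) (hg : superring g).
Local Notation E := (evenT hg).

Definition evmx m n (e : bool) (X : 'M[B]_(m, n)) : Prop := forall i j, g e (X i j).
Definition emb m n (X : 'M[E]_(m, n)) : 'M[B]_(m, n) := map_mx val X.
Definition lift_mx m n (X : 'M[B]_(m, n)) : 'M[E]_(m, n) := map_mx (to_even hg) X.

Lemma lift_mxK m n (X : 'M[B]_(m, n)) : evmx false X -> emb (lift_mx X) = X.
Proof. by move=> hX; apply/matrixP => i j; rewrite !mxE to_evenK. Qed.
Lemma emb_inj m n : injective (@emb m n).
Proof.
move=> X Y /matrixP h; apply/matrixP => i j; apply: val_inj.
by have := h i j; rewrite !mxE.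
Qed.
Lemma embM m n r (X : 'M[E]_(m, n)) (Y : 'M[E]_(n, r)) : emb (X *m Y) = emb X *m emb Y.
Proof. exact: map_mxM. Qed.
Lemma emb1 n : emb (1%:M : 'M[E]_n) = 1%:M.
Proof. exact: map_mx1. Qed.
Lemma evmx_mul m n r d e (X : 'M[B]_(m, n)) (Y : 'M[B]_(n, r)) :
  evmx d X -> evmx e Y -> evmx (d (+) e) (X *m Y).
Proof. by move=> hX hY i j; rewrite mxE; apply: (sr_sum hg) => k _; apply: (sr_M hg). Qed.
Lemma evmxB m n d (X Y : 'M[B]_(m, n)) : evmx d X -> evmx d Y -> evmx d (X - Y).
Proof. by move=> hX hY i j; rewrite !mxE; apply: (sr_B hg). Qed.
Lemma evmxN m n d (X : 'M[B]_(m, n)) : evmx d X -> evmx d (- X).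
Proof. by move=> hX i j; rewrite !mxE; apply: (sr_N hg). Qed.
Lemma evmx0 m n d : evmx d (0 : 'M[B]_(m, n)).
Proof. by move=> i j; rewrite mxE; apply: (sr_0 hg). Qed.
Lemma evmx1 n : evmx false (1%:M : 'M[B]_n).
Proof.
by move=> i j; rewrite mxE; case: eqP => _; [apply: (sr_1 hg) | apply: (sr_0 hg)].
Qed.

Lemma det_even n (X : 'M[B]_n) : evmx false X -> \det X = val (\det (lift_mx X)).
Proof. by move=> hX; rewrite -{1}(lift_mxK hX) /emb det_map_mx. Qed.
Lemma even_det n (X : 'M[B]_n) : evmx false X -> g false (\det X).
Proof. by move=> hX; rewrite det_even //; apply: evenTP. Qed.

Section Par.
Context (n : nat) (par : 'I_n -> bool).
Lemma emx1 : emx g par 1%:M.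
Proof.
move=> i j; rewrite mxE; case: eqP => [->|_]; rewrite ?mulr0n ?mulr1n ?addbb.
  exact: (sr_1 hg).
exact: (sr_0 hg).
Qed.
(** Let N1 be the part of N of the wrong parity. The entries of M N1 have both parities, so M N1 =
    0, and N1 = 0 as N is a left inverse. *)
Lemma emx_inv (M N : 'M[B]_n) : emx g par M -> M *m N = 1%:M -> N *m M = 1%:M ->
  emx g par N.
Proof.
move=> hM h1 h2.
have /choice[P hP] i : exists P : 'I_n -> B, forall j, exists z,
    [/\ g (par i (+) par j) (P j), g (~~ (par i (+) par j)) z & N i j = P j + z].
  by have [P hP] := choice (fun j => sr_dec2 hg (par i (+) par j) (N i j)); exists P.
pose N0 := \matrix_(i, j) P i j; pose N1 := N - N0.
have hN0 : emx g par N0 by move=> i j; rewrite mxE; have [z []] := hP i j.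
have hN1 i j : g (~~ (par i (+) par j)) (N1 i j).
  by rewrite !mxE; have [z [_ hz ->]] := hP i j; rewrite addrC addKr.
have z1 : M *m N1 = 0.
  apply/matrixP => i j; rewrite [RHS]mxE.
  have a1 : g (~~ (par i (+) par j)) ((M *m N1) i j).
    rewrite mxE; apply: (sr_sum hg) => k _; have := sr_M hg (hM i k) (hN1 k j).
    by case: (par i); case: (par j); case: (par k).
  have a2 : g (par i (+) par j) ((M *m N1) i j).
    rewrite mulmxBr h1 !mxE; apply: (sr_B hg).
      by have := emx1 i j; rewrite mxE.
    by have := emx_mul hg hM hN0 i j; rewrite mxE.
  exact: (sr_dir2 hg a2 a1).
have -> : N = N0.
  by apply/eqP; rewrite -subr_eq0 -/N1 -[N1]mul1mx -h2 -mulmxA z1 mulmx0.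
exact: hN0.
Qed.
Lemma strmC (M N : 'M[B]_n) : emx g par M -> emx g par N ->
  strm par (M *m N) = strm par (N *m M).
Proof.
move=> hM hN; rewrite /strm.
under eq_bigr => i _ do rewrite mxE mulr_sumr.
under [RHS]eq_bigr => i _ do rewrite mxE mulr_sumr.
rewrite exchange_big; apply: eq_bigr => j _; apply: eq_bigr => i _.
rewrite (sr_C hg (hM i j) (hN j i)) mulrA -signr_addb; congr (_ ^+ _ * _).
by case: (par i); case: (par j).
Qed.
Lemma strmD (M N : 'M[B]_n) : strm par (M + N) = strm par M + strm par N.
Proof. by rewrite -big_split; apply: eq_bigr => i _; rewrite mxE mulrDr. Qed.
End Par.

Lemma evmx_inv n (X Y : 'M[B]_n) : evmx false X -> X *m Y = 1%:M -> Y *m X = 1%:M ->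
  evmx false Y.
Proof. by move=> hX; apply: (@emx_inv n (fun=> false)). Qed.

Lemma even_unit (x y : B) : g false x -> x * y = 1 -> y * x = 1 -> g false y.
Proof.
move=> hx h1 h2.
have e1 : x%:M *m y%:M = 1%:M :> 'M[B]_1 by rewrite -scalar_mxM h1.
have e2 : y%:M *m x%:M = 1%:M :> 'M[B]_1 by rewrite -scalar_mxM h2.
have := @evmx_inv _ _ _ _ e1 e2; rewrite /evmx => /(_ _ 0 0); rewrite mxE /= mulr1n; apply.
by move=> i j; rewrite mxE !ord1 mulr1n.
Qed.

Lemma det_inv n (X Y : 'M[B]_n) : evmx false X -> X *m Y = 1%:M -> Y *m X = 1%:M ->
  \det X * \det Y = 1 /\ \det Y * \det X = 1.
Proof.
move=> hX h1 h2; have hY := evmx_inv hX h1 h2.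
have e : lift_mx X *m lift_mx Y = 1%:M.
  by apply: emb_inj; rewrite embM emb1 !lift_mxK.
by rewrite !det_even // -!rmorphM [_ * \det (lift_mx X)]mulrC -det_mulmx e det1 rmorph1.
Qed.

Lemma mx_inv_of_det n (X : 'M[B]_n) u : evmx false X -> g false u -> u * \det X = 1 ->
  mx_invertible X.
Proof.
move=> hX hu e; pose X' := lift_mx X; pose u' := to_even hg u.
have e' : u' * \det X' = 1.
  by apply: val_inj; rewrite rmorphM rmorph1 /= to_evenK // -det_even.
exists (emb (u' *: \adj X')); rewrite -{1 2}(lift_mxK hX) -!embM -/X'.
rewrite -scalemxAr -scalemxAl mul_mx_adj mul_adj_mx scale_scalar_mx e'.
by rewrite emb1.
Qed.

End EvenMatrices.

(** * The Berezinian *)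

Section Berezinian.
Context (B : nzRingType) (g : bool -> B -> Prop) (hg : superring g).
Local Notation E := (evenT hg).
Context (p q : nat).
Local Notation par := (@ipar p q).
Local Notation emx := (emx g par).
Local Notation str := (strm par).
Local Notation evmx := (evmx g).
Implicit Types M N : 'M[B]_(p + q).

Lemma ipar_l (i : 'I_p) : par (lshift q i) = false.
Proof. by rewrite /ipar /= leqNgt ltn_ord. Qed.
Lemma ipar_r (i : 'I_q) : par (rshift p i) = true.
Proof. by rewrite /ipar /= leq_addr. Qed.

Lemma emx_ul M : emx M -> evmx false (ulsubmx M).
Proof. by move=> h i j; have := h (lshift q i) (lshift q j); rewrite !ipar_l !mxE. Qed.
Lemma emx_ur M : emx M -> evmx true (ursubmx M).
Proof. by move=> h i j; have := h (lshift q i) (rshift p j); rewrite ipar_l ipar_r !mxE. Qed.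
Lemma emx_dl M : emx M -> evmx true (dlsubmx M).
Proof. by move=> h i j; have := h (rshift p i) (lshift q j); rewrite ipar_l ipar_r !mxE. Qed.
Lemma emx_dr M : emx M -> evmx false (drsubmx M).
Proof. by move=> h i j; have := h (rshift p i) (rshift p j); rewrite !ipar_r !mxE. Qed.
Lemma emx_block (a : 'M[B]_p) b c (d : 'M[B]_q) :
  evmx false a -> evmx true b -> evmx true c -> evmx false d -> emx (block_mx a b c d).
Proof.
move=> ha hb hc hd i j; rewrite !mxE; case: (split_ordP i) => k ->;
  rewrite mxE; case: (split_ordP j) => l ->; rewrite ?ipar_l ?ipar_r.
- exact: ha.
- exact: hb.
- exact: hc.
- exact: hd.
Qed.
Lemma str_block (a : 'M[B]_p) b c (d : 'M[B]_q) : str (block_mx a b c d) = \tr a - \tr d.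
Proof.
rewrite /Operators.strm big_split_ord /= -sumrN; congr (_ + _); apply: eq_bigr => i _.
  by rewrite ipar_l mul1r block_mxEul.
by rewrite ipar_r mulN1r block_mxEdr.
Qed.

(** Up to nilpotents M is block diagonal: Y Z = 1 - W, where the entries of W are sums of products
    of two odd elements. Hence det (1 - W) is 1 plus a nilpotent, a unit, and so is its factor det
    Y. *)
Lemma dr_invertible M : emx M -> mx_invertible M -> mx_invertible (drsubmx M).
Proof.
move=> hM [N [h1 h2]]; have hN := emx_inv hg hM h1 h2.
pose Y := drsubmx M; pose Z := drsubmx N; pose W := dlsubmx M *m ursubmx N.
have e : Y *m Z = 1%:M - W.
  have : drsubmx (M *m N) = 1%:M by rewrite h1 scalar_mx_block block_mxKdr.
  rewrite -{1}(submxK M) -{1}(submxK N) mulmx_block block_mxKdr => <-.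
  by rewrite addrC addKr.
have hY : evmx false Y := emx_dr hM.
have hZ : evmx false Z := emx_dr hN.
have hW : evmx false W := evmx_mul hg (emx_dl hM) (emx_ur hN).
have nW : forall i j, nilp (lift_mx hg W i j).
  move=> i j; pose f k : E := to_even hg (dlsubmx M i k * ursubmx N k j).
  have gf k : g false (dlsubmx M i k * ursubmx N k j).
    exact: (sr_M hg (emx_dl hM i k) (emx_ur hN k j)).
  have -> : lift_mx hg W i j = \sum_k f k.
    apply: val_inj; rewrite rmorph_sum mxE to_evenK // mxE.
    by apply: eq_bigr => k _; rewrite /= to_evenK.
  (* Odd elements square to zero, since b b = - b b and 2 is cancellable; hence (b c)^2 = - b b c c
     = 0. *)
  apply: nilp_sum => k _; exists 2; apply: val_inj; rewrite rmorphXn rmorph0 /= to_evenK //.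
  set b := dlsubmx M i k; set c := ursubmx N k j.
  have hb : g true b by apply: emx_dl.
  have hc : g true c by apply: emx_ur.
  have b2 : b * b = 0.
    apply: (sr_inj hg (n := 1)); have := sr_C hg hb hb.
    by rewrite /= mulN1r => e2; rewrite mulr_natl mulr2n {1}e2 addNr.
  rewrite expr2 mulrA -(mulrA b c b) (sr_C hg hc hb) /= mulN1r mulrN mulNr.
  by rewrite mulrA b2 !mul0r oppr0.
have [u hu] : exists u : E, u * \det (lift_mx hg (1%:M - W)) = 1.
  have h : nilp (1 - \det (lift_mx hg (1%:M - W))).
    rewrite -[X in X - _](det1 _ q); apply: nilp_det => i j.
    rewrite (_ : _ - _ = lift_mx hg W i j) //; apply: val_inj.
    have h1W := @evmx1 _ _ hg q; have hs := evmxB hg h1W hW.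
    have e1 : val (lift_mx hg (1%:M - W) i j) = (1%:M - W) i j by rewrite mxE to_evenK.
    have e2 : val (lift_mx hg W i j) = W i j by rewrite mxE to_evenK.
    rewrite rmorphB /= e1 e2 !mxE opprB addrCA.
    by case: (i == j); rewrite ?mulr1n ?mulr0n ?rmorph1 ?rmorph0 ?subrr ?addr0.
  by have [u hu] := nilp_unit h; exists u; rewrite -hu opprB addrCA subrr addr0.
have eE : lift_mx hg (1%:M - W) = lift_mx hg Y *m lift_mx hg Z.
  apply: emb_inj; rewrite embM !lift_mxK // -?e //.
  by apply: evmx_mul hY hZ.
apply: (mx_inv_of_det hg (u := val (u * \det (lift_mx hg Z)))) => //.
  exact: evenTP.
by rewrite (det_even hg hY) -rmorphM -mulrA [_ * \det (lift_mx hg Y)]mulrC -det_mulmx -eE hu rmorph1.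
Qed.

(** * Block factorization N = U G L and the derivative of the Berezinian *)

Section SchurInverse.
Context (N Ni : 'M[B]_(p + q)) (Yi : 'M[B]_q).
Hypotheses (hN : emx N) (N1 : N *m Ni = 1%:M) (N2 : Ni *m N = 1%:M).
Hypotheses (Y1 : drsubmx N *m Yi = 1%:M) (Y2 : Yi *m drsubmx N = 1%:M).
Let X := ulsubmx N.
Let b := ursubmx N.
Let c := dlsubmx N.
Let Y := drsubmx N.
Let S := X - b *m Yi *m c.
Let U : 'M[B]_(p + q) := block_mx 1%:M (b *m Yi) 0 1%:M.
Let Ui : 'M[B]_(p + q) := block_mx 1%:M (- (b *m Yi)) 0 1%:M.
Let L : 'M[B]_(p + q) := block_mx 1%:M 0 (Yi *m c) 1%:M.
Let Li : 'M[B]_(p + q) := block_mx 1%:M 0 (- (Yi *m c)) 1%:M.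
Let G : 'M[B]_(p + q) := block_mx S 0 0 Y.

Lemma schur_U : U *m Ui = 1%:M /\ Ui *m U = 1%:M.
Proof.
rewrite /U /Ui !mulmx_block !mulmx1 !mul1mx !mulmx0 !mul0mx !addr0 !add0r.
by rewrite addNr subrr -scalar_mx_block.
Qed.
Lemma schur_L : L *m Li = 1%:M /\ Li *m L = 1%:M.
Proof.
rewrite /L /Li !mulmx_block !mulmx1 !mul1mx !mulmx0 !mul0mx !addr0 !add0r.
by rewrite addNr subrr -scalar_mx_block.
Qed.
Lemma schur_UGL : N = U *m G *m L.
Proof.
rewrite /U /G /L !mulmx_block !mulmx1 !mul1mx !mulmx0 !mul0mx !addr0 !add0r.
rewrite -(mulmxA b Yi Y) Y2 mulmx1 !mulmxA Y1 mul1mx.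
by rewrite /S subrK submxK.
Qed.
Lemma schur_G : G *m (L *m Ni *m U) = 1%:M /\ (L *m Ni *m U) *m G = 1%:M.
Proof.
have [u1 u2] := schur_U; have [l1 l2] := schur_L.
have e : G = Ui *m N *m Li.
  by rewrite schur_UGL !mulmxA u2 mul1mx -mulmxA l1 mulmx1.
split; rewrite e.
  rewrite !mulmxA -(mulmxA _ Li L) l2 mulmx1 -(mulmxA _ N Ni) N1 mulmx1.
  exact: u2.
rewrite !mulmxA -(mulmxA _ U Ui) u1 mulmx1 -(mulmxA _ Ni N) N2 mulmx1.
exact: l1.
Qed.
Let Si := ulsubmx (L *m Ni *m U).
Lemma schur_S : S *m Si = 1%:M /\ Si *m S = 1%:M.
Proof.
have [h1 h2] := schur_G.
have e1 := congr1 ulsubmx h1; have e2 := congr1 ulsubmx h2.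
rewrite -[L *m Ni *m U]submxK /G mulmx_block block_mxKul -/Si in e1.
rewrite -[L *m Ni *m U]submxK /G mulmx_block block_mxKul -/Si in e2.
rewrite mul0mx addr0 scalar_mx_block block_mxKul in e1.
by rewrite mulmx0 addr0 scalar_mx_block block_mxKul in e2.
Qed.
Lemma evmx_Yi : evmx false Yi.
Proof. by apply: (evmx_inv hg _ Y1 Y2); apply: emx_dr. Qed.
Lemma evmx_S : evmx false S.
Proof.
apply: evmxB => //; first exact: emx_ul.
have h := evmx_mul hg (evmx_mul hg (emx_ur hN) evmx_Yi) (emx_dl hN).
exact: h.
Qed.

Context (D : B -> B).
Hypotheses (DD : forall x y, D (x + y) = D x + D y)
  (DM : forall x y, D (x * y) = D x * y + x * D y)
  (Dg : forall d x, g d x -> g d (D x)).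

(** [D] restricted to the commutative ring of even elements, where Jacobi's formula is available. *)
Let DE (x : E) : E := to_even hg (D (val x)).
Lemma val_DE x : val (DE x) = D (val x).
Proof. by apply: to_evenK; apply: Dg; apply: evenTP. Qed.
Lemma DE_D x y : DE (x + y) = DE x + DE y.
Proof. by apply: val_inj; rewrite [RHS]rmorphD /= !val_DE [val (x + y)]rmorphD DD. Qed.
Lemma DE_M x y : DE (x * y) = DE x * y + x * DE y.
Proof. by apply: val_inj; rewrite [RHS]rmorphD /= !val_DE DM. Qed.

Lemma D_det n (P Pi : 'M[B]_n) : evmx false P -> P *m Pi = 1%:M -> Pi *m P = 1%:M ->
  D (\det P) = \det P * \tr (map_mx D P *m Pi).
Proof.
move=> hP h1 h2; have hPi := evmx_inv hg hP h1 h2.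
have hDP : evmx false (map_mx D P) by move=> i j; rewrite mxE; apply: Dg.
have e0 : lift_mx hg P *m lift_mx hg Pi = 1%:M.
  by apply: emb_inj; rewrite embM emb1 !lift_mxK.
have e1 : \adj (lift_mx hg P) = \det (lift_mx hg P) *: lift_mx hg Pi.
  by rewrite -[LHS]mulmx1 -e0 mulmxA mul_adj_mx mul_scalar_mx.
have e2 : map_mx DE (lift_mx hg P) = lift_mx hg (map_mx D P).
  by apply/matrixP => i j; apply: val_inj; rewrite !mxE val_DE !to_evenK //; apply: Dg.
rewrite (det_even hg hP) -val_DE (deriv_det DE_D DE_M) e1 e2 -scalemxAr mxtraceZ rmorphM.
by congr (_ * _); rewrite -trace_map_mx -/(emb _) embM !lift_mxK.
Qed.

Lemma D_mul m n r (P : 'M[B]_(m, n)) (Q : 'M[B]_(n, r)) :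
  map_mx D (P *m Q) = map_mx D P *m Q + P *m map_mx D Q.
Proof.
apply/matrixP => i j; rewrite !mxE -big_split.
have D0 : D 0 = 0 by apply: (addIr (D 0)); rewrite -DD !add0r.
rewrite (big_morph D DD D0); apply: eq_bigr => k _.
by rewrite /= !mxE DM.
Qed.

Lemma Ber_schur : Ber N = \det S * \det Yi.
Proof.
rewrite /Ber (mx_invE Y1 Y2); congr (_ * _).
by have [h1 h2] := det_inv hg (emx_dr hN) Y1 Y2; apply: elt_invE.
Qed.

(** In N = U G L the factors U and L are unipotent, so dU U^-1 and dL L^-1 have zero diagonal
    blocks. Cyclicity of the supertrace removes the conjugations, and Jacobi's formula for S and for
    Y remains. *)
Lemma D_Ber : D (Ber N) = Ber N * str (map_mx D N *m Ni).
Proof.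
have D0 : D 0 = 0 by apply: (addIr (D 0)); rewrite -DD !add0r.
have D1 : D 1 = 0 by apply: (addIr (D 1)); have := DM 1 1; rewrite !mulr1 mul1r add0r.
have [S1 S2] := schur_S; have [u1 u2] := schur_U; have [l1 l2] := schur_L.
have [G1 G2] := schur_G; have [d1 d2] := det_inv hg (emx_dr hN) Y1 Y2.
have hSi := evmx_inv hg evmx_S S1 S2.
have hbY : evmx true (b *m Yi) := evmx_mul hg (emx_ur hN) evmx_Yi.
have hYc : evmx true (Yi *m c) := evmx_mul hg evmx_Yi (emx_dl hN).
have DP m n (P : 'M[B]_(m, n)) e : evmx e P -> evmx e (map_mx D P).
  by move=> h i j; rewrite mxE; apply: Dg.
pose Gi : 'M[B]_(p + q) := block_mx Si 0 0 Yi.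
have G3 : G *m Gi = 1%:M.
  by rewrite /G /Gi mulmx_block !mulmx0 !mul0mx !addr0 !add0r S1 Y1 -scalar_mx_block.
have ev n := @evmx1 _ _ hg n; have e0 m n d := @evmx0 _ _ hg m n d.
have hU : emx U by apply: emx_block.
have hUi : emx Ui by apply: emx_block => //; apply: evmxN.
have hL : emx L by apply: emx_block.
have hLi : emx Li by apply: emx_block => //; apply: evmxN.
have hG : emx G by apply: emx_block => //; [exact: evmx_S | exact: emx_dr].
have hGi : emx Gi by apply: emx_block => //; exact: evmx_Yi.
have Dblk a b' c' d : map_mx D (block_mx a b' c' d : 'M[B]_(p + q)) =
   block_mx (map_mx D a) (map_mx D b') (map_mx D c') (map_mx D d) by rewrite map_block_mx.
have D1M n : map_mx D (1%:M : 'M[B]_n) = 0.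
  by apply/matrixP => i j; rewrite !mxE; case: eqP; rewrite ?mulr1n ?mulr0n.
have D0M m n : map_mx D (0 : 'M[B]_(m, n)) = 0 by apply/matrixP => i j; rewrite !mxE.
have De (P : 'M[B]_(p + q)) : emx P -> emx (map_mx D P).
  by move=> h i j; rewrite mxE; apply: Dg.
have G4 : Gi *m G = 1%:M.
  by rewrite /G /Gi mulmx_block !mulmx0 !mul0mx !addr0 !add0r S2 Y2 -scalar_mx_block.
have eNi : Ni = Li *m Gi *m Ui.
  apply: mx_inv_unique N2 _; rewrite schur_UGL !mulmxA -(mulmxA _ L Li) l1 mulmx1.
  by rewrite -(mulmxA _ G Gi) G3 mulmx1.
have em := @emx_mul _ _ hg _ par.
have sU : str (map_mx D U *m Ui) = 0.
  by rewrite /U /Ui Dblk !D1M !D0M mulmx_block !mul0mx !mulmx0 !addr0 str_block !mxtrace0 subr0.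
have sL : str (map_mx D L *m Li) = 0.
  by rewrite /L /Li Dblk !D1M !D0M mulmx_block !mul0mx !mulmx0 !addr0 str_block !mxtrace0 subr0.
have sG : str (map_mx D G *m Gi) = \tr (map_mx D S *m Si) - \tr (map_mx D Y *m Yi).
  by rewrite /G /Gi Dblk !D0M mulmx_block !mul0mx !mulmx0 !addr0 !add0r str_block.
have eq1 : str (map_mx D N *m Ni) = \tr (map_mx D S *m Si) - \tr (map_mx D Y *m Yi).
  rewrite eNi schur_UGL !D_mul !mulmxDl !strmD -sG !mulmxA.
  rewrite -(mulmxA _ L Li) l1 mulmx1 -(mulmxA _ G Gi) G3 mulmx1 sU add0r.
  rewrite -(mulmxA _ L Li) l1 mulmx1.
  have -> : str (U *m map_mx D G *m Gi *m Ui) = str (map_mx D G *m Gi).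
    rewrite -!mulmxA (strmC hg); [|exact: hU|exact: (em _ _ (De _ hG) (em _ _ hGi hUi))].
    by rewrite !mulmxA -(mulmxA _ Ui U) u2 mulmx1.
  have -> : str (U *m G *m map_mx D L *m Li *m Gi *m Ui) = str (map_mx D L *m Li).
    rewrite -!mulmxA (mulmxA U) (strmC hg); [|exact: (em _ _ hU hG)|].
      by rewrite !mulmxA -(mulmxA _ Ui U) u2 mulmx1 -(mulmxA _ Gi G) G4 mulmx1.
    exact: (em _ _ (De _ hL) (em _ _ hLi (em _ _ hGi hUi))).
  by rewrite sL addr0.
have hY := emx_dr hN.
have gd := even_det hg evmx_S.
have gy := even_det hg evmx_Yi.
have trg (P Q : 'M[B]_q) : evmx false P -> evmx false Q -> g false (\tr (P *m Q)).
  by move=> hP hQ; apply: (sr_sum hg) => i _; apply: (evmx_mul hg hP hQ).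
(* Obtained by differentiating det Y det Yi = 1. *)
have eDy : D (\det Yi) = - (\det Yi * \tr (map_mx D Y *m Yi)).
  have := congr1 D d1; rewrite D1 DM (D_det hY Y1 Y2).
  move=> /(congr1 (fun x => \det Yi * x)); rewrite mulr0 mulrDr [in X in _ + X]mulrA d2 mul1r.
  rewrite !mulrA d2 mul1r => h; apply/eqP; rewrite -addr_eq0 addrC; apply/eqP.
  rewrite -[RHS]h; congr (_ + _); apply: (sr_eC hg gy); apply: trg; last exact: evmx_Yi.
  exact: DP.
rewrite Ber_schur DM (D_det evmx_S S1 S2) eDy eq1 mulrBr mulrN -!mulrA; congr (_ * _ - _).
apply: (sr_eC hg _ gy); apply: (sr_sum hg) => i _.
exact: (evmx_mul hg (DP _ _ _ _ evmx_S) hSi i i).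
Qed.
End SchurInverse.
End Berezinian.

Section ConstCoef.
Context (B : nzRingType).
Definition ps_const (f : pseries B) : B := f 0%N.
Fact ps_const_zmod : zmod_morphism ps_const. Proof. by []. Qed.
Fact ps_const_monoid : monoid_morphism ps_const.
Proof. by split=> // f h; rewrite /ps_const psM big_ord1. Qed.
HB.instance Definition _ :=
  GRing.isZmodMorphism.Build (pseries B) B ps_const ps_const_zmod.
HB.instance Definition _ :=
  GRing.isMonoidMorphism.Build (pseries B) B ps_const ps_const_monoid.
End ConstCoef.

(** * Berezinians of linear pencils *)

Section Pencil.
Context (B : nzRingType) (g : bool -> B -> Prop) (hg : superring g).
Context (p q : nat).
Local Notation par := (@ipar p q).
Local Notation str := (strm par).
Local Notation emx := (emx g par).
Local Notation hps := (psg_superring hg).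
Implicit Types M N : 'M[B]_(p + q).

(* M + z N. *)
Definition lin M N : 'M[pseries B]_(p + q) :=
  psmx (fun k => if k is k'.+1 then if k' is 0 then N else 0 else M).

Lemma lin_mulE M N (c : nat -> 'M[B]_(p + q)) k : cmx k (lin M N *m psmx c) =
  if k is k'.+1 then M *m c k + N *m c k' else M *m c k.
Proof.
rewrite cmx_mul big_ord_recl !psmxK /= subn0; case: k => [|k]; first by rewrite big_ord0 addr0.
rewrite big_ord_recl !psmxK /= subSS subn0 big1 ?addr0 // => i _.
by rewrite /bump !leq0n !add1n (psmxK (fun k => if k is k1.+1 then if k1 is 0 then N else 0 else M)) mul0mx.
Qed.
Lemma mul_linE M N (c : nat -> 'M[B]_(p + q)) k : cmx k (psmx c *m lin M N) =
  if k is k'.+1 then c k *m M + c k' *m N else c k *m M.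
Proof.
rewrite cmx_mul big_ord_recr !psmxK /= subnn; case: k => [|k].
  by rewrite big_ord0 add0r.
rewrite big_ord_recr !psmxK /= subSnn addrC big1 ?add0r // => i _.
rewrite (psmxK (fun k => if k is k1.+1 then if k1 is 0 then N else 0 else M)) subSn 1?ltnW //=; case e : (k - i)%N => [|l]; last by rewrite mulmx0.
by move: (ltn_ord i); rewrite ltnNge -subn_eq0 e.
Qed.

Lemma lin_inv1 M : lin 1%:M M *m psmx (fun k => (- M) ^+ k) = 1%:M /\
  psmx (fun k => (- M) ^+ k) *m lin 1%:M M = 1%:M.
Proof.
split; apply: cmx_inj => k; rewrite ?lin_mulE ?mul_linE cmx1; case: k => [|k] //=;
  rewrite ?mul1mx ?mulmx1 //.
  by rewrite exprS -[_ *m _]/(M * _) mulNr addNr.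
by rewrite exprSr -[_ *m M]/(_ * M) mulrN addNr.
Qed.
(** As M + z = M (1 + z P), this is a geometric series in P. Its supertrace generates the power sums
    of P, which is how exterior powers of the inverse enter Ber (M + z). *)
Lemma lin_inv2 M P : M *m P = 1%:M -> P *m M = 1%:M ->
  lin M 1%:M *m psmx (fun k => - (- P) ^+ k.+1) = 1%:M /\
  psmx (fun k => - (- P) ^+ k.+1) *m lin M 1%:M = 1%:M.
Proof.
move=> h1 h2; have e k : - (- P) ^+ k.+1 = P *m (- P) ^+ k by rewrite exprS mulNr opprK.
have e' k : - (- P) ^+ k.+1 = (- P) ^+ k *m P by rewrite exprSr mulrN opprK.
split; apply: cmx_inj => k; rewrite ?lin_mulE ?mul_linE cmx1; case: k => [|k] /=.
- by rewrite e mulmx1.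
- by rewrite e mulmxA h1 mul1mx mul1mx subrr.
- by rewrite e mulmx1.
- by rewrite e' -mulmxA h2 mulmx1 mulmx1 subrr.
Qed.

Lemma emx_psmx (c : nat -> 'M[B]_(p + q)) :
  (forall k, emx (c k)) -> Operators.emx (psg g) par (psmx c).
Proof. by move=> h i j n; rewrite mxE; apply: h. Qed.
Lemma emx0 : emx 0.
Proof. by move=> i j; rewrite mxE; apply: (sr_0 hg). Qed.
Lemma emx_lin M N : emx M -> emx N -> Operators.emx (psg g) par (lin M N).
Proof. by move=> hM hN; apply: emx_psmx => -[|[|k]] //; apply: emx0. Qed.

Lemma dr_lin_inv M N : mx_invertible (drsubmx M) -> mx_invertible (drsubmx (lin M N)).
Proof.
move=> h; apply: mx_ps_inv; rewrite (_ : cmx 0 _ = drsubmx M) //.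
by apply/matrixP => i j; rewrite !mxE.
Qed.

Lemma Ber_lin0 M N : emx M -> emx N -> mx_invertible (drsubmx M) ->
  Ber (lin M N) 0%N = Ber M.
Proof.
move=> hM hN hY; have [Yi [Y1 Y2]] := dr_lin_inv N hY.
rewrite (Ber_schur hps (emx_lin hM hN) Y1 Y2) -[LHS]/(ps_const (_ * _)) rmorphM /=.
have c0M n m r (P : 'M[pseries B]_(n, m)) (Q : 'M[pseries B]_(m, r)) :
  map_mx (@ps_const B) (P *m Q) = map_mx (@ps_const B) P *m map_mx (@ps_const B) Q.
  exact: map_mxM.
have e : map_mx (@ps_const B) (drsubmx (lin M N)) = drsubmx M.
  by apply/matrixP => i j; rewrite !mxE.
have Y1' : drsubmx M *m map_mx (@ps_const B) Yi = 1%:M by rewrite -e -c0M Y1 map_mx1.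
have Y2' : map_mx (@ps_const B) Yi *m drsubmx M = 1%:M by rewrite -e -c0M Y2 map_mx1.
rewrite (Ber_schur hg hM Y1' Y2') -!det_map_mx; congr (\det _ * _).
have eX : ulsubmx M = map_mx (@ps_const B) (ulsubmx (lin M N)).
  by apply/matrixP => i j; rewrite !mxE.
have eb : ursubmx M = map_mx (@ps_const B) (ursubmx (lin M N)).
  by apply/matrixP => i j; rewrite !mxE.
have ec : dlsubmx M = map_mx (@ps_const B) (dlsubmx (lin M N)).
  by apply/matrixP => i j; rewrite !mxE.
by rewrite eX eb ec -!c0M map_mxB.
Qed.

Lemma str_even M : emx M -> g false (str M).
Proof.
move=> hM; apply: (sr_sum hg) => i _; apply: (sr_sign hg).
by have := hM i i; rewrite addbb.
Qed.

(** The coefficient of z^n in (d/dz) Ber = Ber str (N (M + z N)^-1), where [c] lists the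
    coefficients of the inverse matrix. *)
Lemma Ber_lin_rec M N (c : nat -> 'M[B]_(p + q)) n : emx M -> emx N ->
  mx_invertible (drsubmx M) ->
  lin M N *m psmx c = 1%:M -> psmx c *m lin M N = 1%:M ->
  n.+1%:R * Ber (lin M N) n.+1 = \sum_(i < n.+1) str (N *m c i) * Ber (lin M N) (n - i)%N.
Proof.
move=> hM hN hY h1 h2; have [Yi [Y1 Y2]] := dr_lin_inv N hY.
have hc k : emx (c k).
  have h := emx_inv hps (emx_lin hM hN) h1 h2.
  by move=> i j; have := h i j k; rewrite mxE.
have := D_Ber hps (emx_lin hM hN) h1 h2 Y1 Y2 (@dpsD B) (@dpsM B) (@dps_psg _ _ hg).
move=> /(congr1 (fun f : pseries B => f n)); rewrite {1}/dps => ->.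
rewrite psMr; apply: eq_bigr => i _.
have -> : strm par (map_mx (@dps B) (lin M N) *m psmx c) i = str (N *m c i).
  rewrite /Operators.strm ps_sum; apply: eq_bigr => j _.
  have -> : ((-1) ^+ par j * (map_mx (@dps B) (lin M N) *m psmx c) j j) i =
     (-1) ^+ par j * (map_mx (@dps B) (lin M N) *m psmx c) j j i.
    by rewrite !mulr_sign; case: (par j).
  congr (_ * _).
  have e : map_mx (@dps B) (lin M N) = lin N 0.
    apply: cmx_inj => k; apply/matrixP => a b; rewrite !mxE /dps /=.
    by case: k => [|[|k]]; rewrite ?mul1r // !mxE mulr0.
  have := congr1 (fun P : 'M_(p + q) => P j j) (lin_mulE N 0 c i).
  rewrite e mxE => ->; case: (nat_of_ord i) => [|k] //.
  by rewrite mul0mx addr0.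
by rewrite [RHS](even_cst hg) //; apply: str_even; apply: emx_mul.
Qed.

Lemma rec_unique (s f h : nat -> B) : f 0%N = h 0%N ->
  (forall n, n.+1%:R * f n.+1 = \sum_(i < n.+1) s i * f (n - i)%N) ->
  (forall n, n.+1%:R * h n.+1 = \sum_(i < n.+1) s i * h (n - i)%N) -> forall n, f n = h n.
Proof.
move=> e0 hf hh n; elim/ltn_ind: n => -[//|n] ih; apply/eqP; rewrite -subr_eq0; apply/eqP.
apply: (sr_inj hg (n := n)); rewrite mulrBr hf hh -sumrB big1 // => i _.
by rewrite ih ?subrr // ltnS leq_subr.
Qed.

Lemma mx_inv1 n : mx_invertible (1%:M : 'M[B]_n).
Proof. by exists 1%:M; rewrite mulmx1. Qed.

Lemma dr1 : drsubmx (1%:M : 'M[B]_(p + q)) = 1%:M.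
Proof. by rewrite scalar_mx_block block_mxKdr. Qed.

Lemma strN M : str (- M) = - str M.
Proof. by rewrite -sumrN; apply: eq_bigr => i _; rewrite mxE mulrN. Qed.

Lemma str_signX (P : 'M[B]_(p + q)) k : str ((-1) ^+ k * P) = (-1) ^+ k * str P.
Proof.
by rewrite -signr_odd -[in RHS]signr_odd !mulr_sign; case: odd; rewrite ?strN.
Qed.

Lemma Ber1 : Ber (1%:M : 'M[B]_(p + q)) = 1.
Proof.
have h : (1%:M : 'M[B]_q) *m 1%:M = 1%:M by rewrite mulmx1.
rewrite (Ber_schur hg (emx1 hg par) (Yi := 1%:M)) ?dr1 // scalar_mx_block.
have d1 n : \det (1%:M : 'M[B]_n) = 1.
  by rewrite -(emb1 hg n) /emb det_map_mx det1 rmorph1.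
by rewrite block_mxKul block_mxKur block_mxKdl mul0mx mul0mx subr0 !d1 mulr1.
Qed.

Lemma Ber_lin1 M n : emx M -> Ber (lin 1%:M M) n = strL par n M.
Proof.
move=> hM; have [h1 h2] := lin_inv1 M; have e1 := emx1 hg par.
have hd : mx_invertible (drsubmx (1%:M : 'M[B]_(p + q))) by rewrite dr1; apply: mx_inv1.
move: n; apply: (@rec_unique (fun j => (-1) ^+ j * str (M ^+ j.+1)) (Ber (lin 1%:M M))
  (fun n => strL par n M)) => [|n|n].
- by rewrite Ber_lin0 // (strL0 hg) Ber1.
- rewrite (Ber_lin_rec n e1 hM hd h1 h2); apply: eq_bigr => i _; congr (_ * _).
  rewrite /= (exprNn M) -str_signX; congr (str _); rewrite -[M *m _]/(M * _) mulrA.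
  by rewrite (commr_sign M) -mulrA -exprS.
- exact: (strL_newton hg n hM).
Qed.

Lemma Ber_lin2 M P n : emx M -> M *m P = 1%:M -> P *m M = 1%:M ->
  mx_invertible (drsubmx M) ->
  Ber (lin M 1%:M) n = Ber M * strL par n P.
Proof.
move=> hM e1 e2 hd; have [h1 h2] := lin_inv2 e1 e2; have i1 := emx1 hg par.
have hP := emx_inv hg hM e1 e2.
move: n; apply: (@rec_unique (fun j => (-1) ^+ j * str (P ^+ j.+1)) (Ber (lin M 1%:M))
  (fun n => Ber M * strL par n P)) => [|n|n].
- by rewrite Ber_lin0 // (strL0 hg) mulr1.
- rewrite (Ber_lin_rec n hM i1 hd h1 h2); apply: eq_bigr => i _; congr (_ * _).
  rewrite /= mul1mx (exprNn P) -str_signX; congr (str _).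
  by rewrite exprS mulN1r mulNr opprK.
- rewrite mulr_natl -mulrnAr -mulr_natl (strL_newton hg n hP) mulr_sumr.
  apply: eq_bigr => i _; rewrite mulrA [RHS]mulrA; congr (_ * _).
  apply/esym; apply: (even_cst hg); apply: (sr_sign hg); apply: str_even.
  elim: (i.+1) => [|k ih]; first exact: i1.
  by rewrite exprS; apply: emx_mul.
Qed.

Lemma charfun_lin M : charfun M = Ber (lin 1%:M M).
Proof.
rewrite /charfun; congr (Ber _); apply/matrixP => i j; rewrite !mxE; apply/funext => k.
rewrite /ps_of_poly coefD coefXM coefC; case: k => [|[|k]] /=; rewrite ?mxE.
- by case: (i == j); rewrite ?mulr1n ?mulr0n ?coef1 ?coef0 addr0.
- by case: (i == j); rewrite ?mulr1n ?mulr0n ?coef1 ?coef0 add0r.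
- by case: (i == j); rewrite ?mulr1n ?mulr0n ?coef1 ?coef0 add0r.
Qed.

End Pencil.

(** * Fractions and their reversal *)

Section Data.
Context (p q : nat).

(** N01 Z N10 expressed through products of two odd entries, so that it makes sense over a
    commutative ring. *)
Definition thmx (K : comNzRingType) (t : 'I_p -> 'I_q -> 'I_q -> 'I_p -> K)
  (Z : 'M[K]_q) : 'M[K]_p := \matrix_(i, j) \sum_k \sum_l t i k l j * Z k l.

(* If t i k l j = N01 i k * N10 l j, this is det(N11)^(p+1) * Ber N. *)
Definition berN (K : comNzRingType) (X : 'M[K]_p) (Y : 'M[K]_q) t : K :=
  \det (\det Y *: X - thmx t (\adj Y)).

Lemma thmx_map (K K' : comNzRingType) (f : {rmorphism K -> K'}) t Z :
  map_mx f (thmx t Z) = thmx (fun i k l j => f (t i k l j)) (map_mx f Z).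
Proof.
apply/matrixP => i j; rewrite !mxE rmorph_sum; apply: eq_bigr => k _.
by rewrite rmorph_sum; apply: eq_bigr => l _; rewrite rmorphM mxE.
Qed.
Lemma berN_map (K K' : comNzRingType) (f : {rmorphism K -> K'}) X Y t :
  f (berN X Y t) = berN (map_mx f X) (map_mx f Y) (fun i k l j => f (t i k l j)).
Proof.
by rewrite /berN -det_map_mx map_mxB map_mxZ thmx_map map_mx_adj det_map_mx.
Qed.
Lemma thmxZ (K : comNzRingType) t (c : K) Z : thmx t (c *: Z) = c *: thmx t Z.
Proof.
apply/matrixP => i j; rewrite !mxE mulr_sumr; apply: eq_bigr => k _.
by rewrite mulr_sumr; apply: eq_bigr => l _; rewrite mxE mulrCA.
Qed.
End Data.

Section BerData.
Context (B : nzRingType) (g : bool -> B -> Prop) (hg : superring g).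
Local Notation E := (evenT hg).
Context (p q : nat).
Local Notation par := (@ipar p q).

Definition data_t (N : 'M[B]_(p + q)) (i : 'I_p) (k l : 'I_q) (j : 'I_p) : E :=
  to_even hg (ursubmx N i k * dlsubmx N l j).

(** As adj Y = det Y Y^-1, the matrix in [berN] is det Y times the Schur complement. Its determinant
    gains (det Y)^p, and one more factor det Y compensates the denominator of Ber. *)
Lemma Ber_berN (N : 'M[B]_(p + q)) (X : 'M[E]_p) (Y : 'M[E]_q) t :
  emx g par N -> mx_invertible (drsubmx N) ->
  ulsubmx N = emb X -> drsubmx N = emb Y ->
  (forall i k l j, ursubmx N i k * dlsubmx N l j = val (t i k l j)) ->
  val (berN X Y t) = Ber N * val (\det Y ^+ p.+1).
Proof.
move=> hN [Yi [Y1 Y2]] eX eY et; rewrite (Ber_schur hg hN Y1 Y2).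
have hYi := evmx_Yi hg hN Y1 Y2; have hS := evmx_S hg hN Y1 Y2.
pose Yi' := lift_mx hg Yi.
have eYi : Yi = emb Yi' by rewrite lift_mxK.
have e1 : Y *m Yi' = 1%:M by apply: emb_inj; rewrite embM emb1 -eY -eYi.
have ea : \adj Y = \det Y *: Yi' by rewrite -[LHS]mulmx1 -e1 mulmxA mul_adj_mx mul_scalar_mx.
have eS : ulsubmx N - ursubmx N *m Yi *m dlsubmx N = emb (X - thmx t Yi').
  apply/matrixP => i j; rewrite eX !mxE rmorphB; congr (_ - _).
  rewrite [RHS]rmorph_sum.
  transitivity (\sum_k \sum_l ursubmx N i k * dlsubmx N l j * Yi k l).
    under eq_bigr => l _ do rewrite mxE mulr_suml.
    rewrite exchange_big; apply: eq_bigr => k _; apply: eq_bigr => l _ /=.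
    rewrite -!mulrA; congr (_ * _); apply: (sr_eC hg (hYi k l)); exact: (emx_dl hN).
  apply: eq_bigr => k _; rewrite rmorph_sum; apply: eq_bigr => l _.
  by rewrite et rmorphM eYi mxE.
rewrite eS eYi /emb !det_map_mx -!rmorphM /berN ea thmxZ -scalerBr detZ; apply: (congr1 val).
rewrite exprS mulrA -(mulrA _ (\det Yi')) [\det Yi' * _]mulrC -det_mulmx e1 det1 mulr1.
exact: mulrC.
Qed.

Local Notation hps := (psg_superring hg).
(** Compares polynomials with even series. It is used for z, where Ber is only a series, and for s,
    where a polynomial identity is checked on series. *)
Definition rho (P : {poly E}) : evenT hps := to_even hps (fun n => val P`_n).
Lemma val_rho P : val (rho P) = (fun n => val P`_n).
Proof. by apply: to_evenK => n; apply: evenTP. Qed.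
Fact rho_zmod : zmod_morphism rho.
Proof.
move=> P Q; apply: val_inj; rewrite [RHS]rmorphB /= !val_rho; apply/funext => n.
by rewrite coefB rmorphB.
Qed.
Fact rho_monoid : monoid_morphism rho.
Proof.
split.
  apply: val_inj; rewrite rmorph1 val_rho; apply/funext => n.
  by rewrite coef1 ps1; case: eqP.
move=> P Q; apply: val_inj; rewrite [RHS]rmorphM /= !val_rho; apply/funext => n.
by rewrite coefM psM rmorph_sum; apply: eq_bigr => i _; rewrite rmorphM.
Qed.
HB.instance Definition _ := GRing.isZmodMorphism.Build {poly E} (evenT hps) rho rho_zmod.
HB.instance Definition _ := GRing.isMonoidMorphism.Build {poly E} (evenT hps) rho rho_monoid.
Lemma rho_inj : injective rho.
Proof.
move=> P Q /(congr1 val); rewrite !val_rho => h; apply/polyP => n; apply: val_inj.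
exact: (congr1 (@^~ n) h).
Qed.
End BerData.

Section Pencils.
Context (K : comNzRingType) (p q : nat).
Context (X : 'M[K]_p) (Y : 'M[K]_q) (t : 'I_p -> 'I_q -> 'I_q -> 'I_p -> K).
(* 1 + z Z and z + Z; the fractions Nf / Qf and Nb / Qb are Ber (1 + z M) and
   Ber (M + z), where M has blocks X, Y and products of odd entries t. *)
Definition fwd n (Z : 'M[K]_n) : 'M[{poly K}]_n := 1%:M + 'X *: map_mx polyC Z.
Definition bwd n (Z : 'M[K]_n) : 'M[{poly K}]_n := 'X%:M + map_mx polyC Z.
Definition Nf := berN (fwd X) (fwd Y) (fun i k l j => 'X^2 * (t i k l j)%:P).
Definition Qf := \det (fwd Y) ^+ p.+1.
Definition Nb := berN (bwd X) (bwd Y) (fun i k l j => (t i k l j)%:P).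
Definition Qb := \det (bwd Y) ^+ p.+1.

(* Q = z^m P(1/z). *)
Inductive revp (m : nat) : {poly K} -> {poly K} -> Prop :=
| revp0 : revp m 0 0
| revpM c i : (i <= m)%N -> revp m (c *: 'X^i) (c *: 'X^(m - i))
| revpD P P' Q Q' : revp m P Q -> revp m P' Q' -> revp m (P + P') (Q + Q').

Lemma revp_coef m P Q : revp m P Q ->
  forall i, Q`_i = if (i <= m)%N then P`_(m - i) else 0.
Proof.
elim=> [i|c j jm i|P0 P' Q0 Q' _ ih _ ih' i].
- by rewrite !coef0; case: ifP.
- rewrite !coefZ !coefXn; case: leqP => im.
    congr (_ * _%:R); congr (nat_of_bool _).
    by apply/eqP/eqP => [->|<-]; rewrite subKn.
  by rewrite gtn_eqF ?mulr0 // (leq_ltn_trans (leq_subr _ _)).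
- by rewrite !coefD ih ih'; case: ifP; rewrite ?addr0.
Qed.
Lemma revpC m P Q : revp m P Q -> revp m Q P.
Proof.
elim=> [|c i im|P0 P' Q0 Q' _ ih _ ih']; [exact: revp0 | | exact: revpD].
by rewrite -{2}(subKn im); apply: revpM; apply: leq_subr.
Qed.
Lemma revp_eq m P Q Q' : revp m P Q -> revp m P Q' -> Q = Q'.
Proof. by move=> h h'; apply/polyP => i; rewrite (revp_coef h) (revp_coef h'). Qed.
Lemma revp_poly m (f : nat -> K) :
  revp m (\poly_(i < m.+1) f i) (\poly_(i < m.+1) f (m - i)%N).
Proof.
have -> : \poly_(i < m.+1) f (m - i)%N = \sum_(i < m.+1) f i *: 'X^(m - i).
  rewrite poly_def (reindex_inj rev_ord_inj); apply: eq_bigr => i _ /=.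
  by rewrite subSS subKn // -ltnS.
rewrite poly_def; apply: (big_ind2 (revp m)) => [|P P' Q Q'|i _].
- exact: revp0.
- exact: revpD.
- by apply: revpM; rewrite -ltnS.
Qed.
Lemma revp_size m (P : {poly K}) : (size P <= m.+1)%N -> exists Q, revp m P Q.
Proof.
move=> hP; exists (\poly_(i < m.+1) P`_(m - i)).
have {1}-> : P = \poly_(i < m.+1) P`_i.
  apply/polyP => i; rewrite coef_poly; case: ltnP => // h.
  by rewrite nth_default // (leq_trans hP).
exact: revp_poly.
Qed.
Lemma revp_coef0 m (P Q : {poly K}) i : revp m P Q -> (m < i)%N -> P`_i = 0.
Proof. by move=> /revpC/revp_coef -> h; rewrite leqNgt h. Qed.
Lemma revpMM m m' P P' Q Q' : revp m P Q -> revp m' P' Q' -> revp (m + m') (P * P') (Q * Q').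
Proof.
move=> h h'; elim: h => [|c i im|P0 P1 Q0 Q1 _ ih _ ih1].
- by rewrite !mul0r; apply: revp0.
- elim: h' => [|c' i' im'|P0 P1 Q0 Q1 _ ih _ ih1].
  + by rewrite !mulr0; apply: revp0.
  + rewrite -!scalerAl -!scalerAr !scalerA -!exprD.
    have -> : (m - i + (m' - i') = m + m' - (i + i'))%N.
      by rewrite addnBA // addnBAC // subnDA.
    by apply: revpM; apply: leq_add.
  + by rewrite !mulrDr; apply: revpD.
- by rewrite !mulrDl; apply: revpD.
Qed.
Lemma revp1 : revp 0 1 1.
Proof. by have := revpM 1 (leqnn 0); rewrite expr0 scale1r. Qed.
Lemma revpX m P Q n : revp m P Q -> revp (m * n) (P ^+ n) (Q ^+ n).
Proof.
move=> h; elim: n => [|n ih]; first by rewrite muln0 !expr0; apply: revp1.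
by rewrite mulnS !exprS; apply: revpMM.
Qed.
Lemma revp_prod (J : Type) (r : seq J) (F G : J -> {poly K}) m :
  (forall i, revp m (F i) (G i)) ->
  revp (m * size r) (\prod_(i <- r) F i) (\prod_(i <- r) G i).
Proof.
move=> h; elim: r => [|j r ih]; first by rewrite !big_nil muln0; apply: revp1.
by rewrite !big_cons /= mulnS; apply: revpMM.
Qed.
Lemma revp_sum m (J : Type) (r : seq J) (F G : J -> {poly K}) :
  (forall i, revp m (F i) (G i)) -> revp m (\sum_(i <- r) F i) (\sum_(i <- r) G i).
Proof.
by move=> h; apply: (big_ind2 (revp m)) => [|P P' Q Q'|i _]; [exact: revp0 | exact: revpD | exact: h].
Qed.
Lemma revp_sign m (b : bool) P Q : revp m P Q -> revp m ((-1) ^+ b * P) ((-1) ^+ b * Q).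
Proof.
have -> : (-1) ^+ b = ((-1) ^+ b : K) *: 1 :> {poly K}.
  by rewrite alg_polyC rmorphXn rmorphN1.
move=> h; rewrite -!scalerAl !mul1r; elim: h => [|c i im|P0 P1 Q0 Q1 _ ih _ ih1].
- by rewrite !scaler0; apply: revp0.
- by rewrite !scalerA; apply: revpM.
- by rewrite !scalerDr; apply: revpD.
Qed.
Lemma revpN m P Q : revp m P Q -> revp m (- P) (- Q).
Proof. by move=> /(@revp_sign _ true); rewrite /= expr1 !mulN1r. Qed.
Lemma revp_det m n (F G : 'M[{poly K}]_n) :
  (forall i j, revp m (F i j) (G i j)) -> revp (m * n) (\det F) (\det G).
Proof.
move=> h; apply: revp_sum => s; apply: revp_sign.
have := @revp_prod _ (index_enum 'I_n) (fun i => F i (s i)) (fun i => G i (s i)) m (fun i => h _ _).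
by rewrite -[index_enum _]enumT size_enum_ord.
Qed.
Lemma revp_adj m n (F G : 'M[{poly K}]_n) i j :
  (forall i j, revp m (F i j) (G i j)) -> revp (m * n.-1) (\adj F i j) (\adj G i j).
Proof.
move=> h; rewrite !mxE /cofactor -signr_odd; apply: revp_sign; apply: revp_det => a b.
by rewrite !mxE.
Qed.
Lemma revp_fwd n (Z : 'M[K]_n) i j : revp 1 (fwd Z i j) (bwd Z i j).
Proof.
rewrite !mxE; apply: revpD.
  case: (i == j); rewrite ?mulr1n ?mulr0n; last exact: revp0.
  by have := @revpM 1 1 0 isT; rewrite !scale1r expr0 expr1.
have := @revpM 1 (Z i j) 1 isT; rewrite expr1 subnn expr0.
by rewrite mulrC mul_polyC alg_polyC.
Qed.

Lemma revp_Q : revp (q * p.+1) Qf Qb.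
Proof.
by apply: revpX; rewrite -[X in revp X]mul1n; apply: revp_det => i j; apply: revp_fwd.
Qed.
(** Each entry of the p x p matrix has formal degree q + 1: a determinant of degree q times a linear
    entry, minus z^2 times minors of degree q - 1. *)
Lemma revp_N : revp (q.+1 * p) Nf Nb.
Proof.
apply: revp_det => i j.
have eB (P Q : 'M[{poly K}]_p) : (P - Q) i j = P i j - Q i j by rewrite !mxE.
have eZ c (P : 'M[{poly K}]_p) : (c *: P) i j = c * P i j by rewrite !mxE.
rewrite !eB !eZ; apply: revpD.
  rewrite -addn1; apply: revpMM; last exact: revp_fwd.
  by rewrite -[X in revp X]mul1n; apply: revp_det => a b; apply: revp_fwd.
apply: revpN; rewrite ![thmx _ _ i j]mxE; apply: revp_sum => k; apply: revp_sum => l.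
(* The summation index k lies in ['I_q], so q - 1 is not truncated. *)
have hq : (0 < q)%N by apply: leq_ltn_trans (ltn_ord k).
have -> : q.+1 = (2 + 1 * q.-1)%N by rewrite mul1n -[in LHS](prednK hq).
apply: revpMM; last by apply: revp_adj => a b; apply: revp_fwd.
have := @revpM 2 (t i k l j) 2 isT; rewrite subnn expr0.
by rewrite mulrC mul_polyC alg_polyC.
Qed.
End Pencils.

(** * Two-sided recurrences and Hankel determinants *)

Definition zx (K : zmodType) (C : nat -> K) (k : int) : K :=
  if k is Posz n then C n else 0.

Section TwoSided.
Context (K : comNzRingType).

Lemma sum_ord_ext (f : nat -> K) n N : (n <= N)%N ->
  (forall j, (n <= j)%N -> f j = 0) -> \sum_(j < N) f j = \sum_(j < n) f j.
Proof.
move=> nN h; rewrite -!(big_mkord xpredT f) (big_cat_nat (leq0n n) nN) //= [X in _ + X]big1_seq ?addr0 //.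
by move=> i /andP[_]; rewrite mem_index_iota => /andP[hi _]; apply: h.
Qed.

(** A window of fixed length q + 1 against a Cauchy product: they agree because b vanishes beyond q
    and [zx] at negative indices. *)
Lemma zconv (b : nat -> K) q (C : nat -> K) (n : int) :
  (forall i, (q < i)%N -> b i = 0) ->
  \sum_(j < q.+1) b j * zx C (n - j%:Z) =
  if n is Posz k then \sum_(i < k.+1) b i * C (k - i)%N else 0.
Proof.
move=> hb; case: n => [k|k]; last first.
  rewrite big1 // => j _; rewrite (_ : zx _ _ = 0) ?mulr0 //.
  by have -> : Negz k - j%:Z = Negz (k + j) by lia.
pose f j := b j * zx C (k%:Z - j%:Z).
transitivity (\sum_(j < k.+1 + q.+1) f j).
  by apply/esym; apply: (@sum_ord_ext f q.+1) => [|j hj]; [apply: leq_addl | rewrite /f hb ?mul0r].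
rewrite (@sum_ord_ext f k.+1) ?leq_addr //.
  apply: eq_bigr => i _; rewrite /f; congr (_ * _).
  by have -> : k%:Z - i%:Z = (k - i)%N%:Z by have := ltn_ord i; lia.
move=> j hj; rewrite /f; have -> : k%:Z - j%:Z = Negz (j - k.+1) by lia.
by rewrite mulr0.
Qed.

(** The first half convolves to c a_m. Substituting q - j for j turns b into its reversal b' and the
    second half into c a'_(p-m), which is c a_m again; for m outside [0, p] both halves vanish. The
    bound L and the factor c serve series known only modulo z^L and up to cleared denominators. *)
Lemma two_sided p q (a a' b b' : {poly K}) (C G : nat -> K) (c : K) L (m : int) :
  revp p a a' -> revp q b b' ->
  (forall n, (n < L)%N -> \sum_(i < n.+1) b`_i * C (n - i)%N = c * a`_n) ->
  (forall n, (n < L)%N -> \sum_(i < n.+1) b'`_i * G (n - i)%N = c * a'`_n) ->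
  (m < L%:Z)%R -> (p%:Z - m < L%:Z)%R ->
  \sum_(j < q.+1) b`_j * (zx C (m - j%:Z) - zx G (p%:Z - q%:Z - (m - j%:Z))) = 0.
Proof.
move=> ha hb hC hG hm hpm.
under eq_bigr => j _ do rewrite mulrBr.
rewrite sumrB (@zconv (fun i => b`_i)); last by move=> i; apply: (revp_coef0 hb).
have -> : \sum_(j < q.+1) b`_j * zx G (p%:Z - q%:Z - (m - j%:Z)) =
   \sum_(j < q.+1) b'`_j * zx G (p%:Z - m - j%:Z).
  rewrite (reindex_inj rev_ord_inj); apply: eq_bigr => j _ /=.
  have hj : (j <= q)%N by rewrite -ltnS.
  rewrite (revp_coef hb) hj subSS; congr (_ * zx _ _); lia.
rewrite (@zconv (fun i => b'`_i)); last by move=> i; apply: (revp_coef0 (revpC hb)).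
have e k : (k <= p)%N -> a'`_(p - k) = a`_k.
  by move=> h; rewrite (revp_coef ha) leq_subr subKn.
case: m hm hpm => [k|k] hm hpm.
  rewrite hC; last by lia.
  have [kp|pk] := leqP k p.
    have -> : p%:Z - k%:Z = (p - k)%N by lia.
    by rewrite hG ?e ?subrr //; lia.
  have -> : p%:Z - k%:Z = Negz (k - p.+1) by lia.
  by rewrite (revp_coef0 ha pk) mulr0 subr0.
have -> : p%:Z - Negz k = (p + k.+1)%N by lia.
rewrite hG; last by lia.
by rewrite (revp_coef0 (revpC ha)) ?mulr0 ?subr0 //; lia.
Qed.

(** The reversed b is a kernel vector of H with last coordinate b_0 = 1; multiplying by adj H gives
    det H = 0, with no division. *)
Lemma hankel_det0 q (gm : int -> K) (b : nat -> K) (k : int) : b 0%N = 1 ->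
  (forall i : nat, (i <= q)%N ->
     \sum_(j < q.+1) b j * gm (k + q%:Z + i%:Z - j%:Z) = 0) ->
  \det (\matrix_(i < q.+1, j < q.+1) gm (k + i%:Z + j%:Z)) = 0.
Proof.
move=> b0 h; set H := \matrix_(i, j) _.
pose v : 'cV[K]_q.+1 := \col_i b (q - i)%N.
have Hv : H *m v = 0.
  apply/matrixP => i l; rewrite !mxE; apply: etrans (h i _); last by rewrite -ltnS.
  rewrite (reindex_inj rev_ord_inj); apply: eq_bigr => j _; rewrite !mxE /= subSS.
  have hj : (j <= q)%N by rewrite -ltnS.
  by rewrite subKn // mulrC; congr (_ * gm _); lia.
have := congr1 (mulmx (\adj H)) Hv; rewrite mulmxA mul_adj_mx mul_scalar_mx mulmx0.
by move=> /matrixP/(_ ord_max 0); rewrite !mxE subnn b0 mulr1.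
Qed.
End TwoSided.

Section BerSeries.
Context (B : nzRingType) (g : bool -> B -> Prop) (hg : superring g).
Local Notation E := (evenT hg).
Local Notation hps := (psg_superring hg).
Local Notation rho := (@rho B g hg).
Context (p q : nat).
Local Notation par := (@ipar p q).

Lemma Ber_even (N : 'M[B]_(p + q)) : emx g par N -> mx_invertible (drsubmx N) ->
  g false (Ber N).
Proof.
move=> hN [Yi [Y1 Y2]]; rewrite (Ber_schur hg hN Y1 Y2); apply: (sr_eM hg).
  exact: (even_det hg (evmx_S hg hN Y1 Y2)).
exact: (even_det hg (evmx_Yi hg hN Y1 Y2)).
Qed.

Definition psm n (b : B) : pseries B := fun k => if k == n then b else 0.
Lemma psmM n m b c : psm n b * psm m c = psm (n + m) (b * c).
Proof.
apply/funext => k; rewrite psM /psm; case: eqVneq => [->|nk].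
  have hn : (n < (n + m).+1)%N by rewrite ltnS leq_addr.
  rewrite (bigD1 (Ordinal hn)) //= eqxx addKn eqxx big1 ?addr0 // => i hi.
  by rewrite (_ : (nat_of_ord i == n) = false) ?mul0r //; apply/negbTE.
rewrite big1 // => i _; case: eqVneq => [e|_]; last by rewrite mul0r.
case: eqVneq => [e'|_]; last by rewrite mulr0.
by move/eqP: nk; have := ltn_ord i; lia.
Qed.

Variables (M : 'M[B]_(p + q)) (hM : emx g par M).
Let X := lift_mx hg (ulsubmx M).
Let Y := lift_mx hg (drsubmx M).
Let t := data_t hg M.

Lemma data_tE i k l j : val (t i k l j) = ursubmx M i k * dlsubmx M l j.
Proof. by apply: to_evenK; apply: (sr_M hg (emx_ur hM i k) (emx_dl hM l j)). Qed.
Lemma valX i j : val (X i j) = ulsubmx M i j.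
Proof. by rewrite mxE to_evenK //; apply: (emx_ul hM). Qed.
Lemma valY i j : val (Y i j) = drsubmx M i j.
Proof. by rewrite mxE to_evenK //; apply: (emx_dr hM). Qed.

Lemma coef_fwd n (Z : 'M[E]_n) i j k :
  (fwd Z i j)`_k = if k is k'.+1 then if k' is 0 then Z i j else 0 else (1%:M : 'M_n) i j.
Proof.
rewrite !mxE coefD coefXM coefC; case: k => [|[|k]] /=.
- by case: (i == j); rewrite ?mulr1n ?mulr0n ?coef1 ?coef0 addr0.
- by case: (i == j); rewrite ?mulr1n ?mulr0n ?coef1 ?coef0 add0r.
- by case: (i == j); rewrite ?mulr1n ?mulr0n ?coef1 ?coef0 add0r.
Qed.
Lemma coef_bwd n (Z : 'M[E]_n) i j k :
  (bwd Z i j)`_k = if k is k'.+1 then if k' is 0 then (1%:M : 'M_n) i j else 0 else Z i j.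
Proof.
rewrite !mxE coefD coefC; case: k => [|[|k]] /=.
- by case: (i == j); rewrite ?mulr1n ?mulr0n ?coefX ?coef0 add0r.
- by case: (i == j); rewrite ?mulr1n ?mulr0n ?coefX ?coef0 addr0.
- by case: (i == j); rewrite ?mulr1n ?mulr0n ?coefX ?coef0 addr0.
Qed.

Lemma val1M n (i j : 'I_n) : val ((1%:M : 'M[E]_n) i j) = (1%:M : 'M[B]_n) i j.
Proof. by rewrite !mxE; case: (i == j). Qed.
Lemma val_fwd n (Z : 'M[E]_n) i j k : val (fwd Z i j)`_k =
  if k is k'.+1 then if k' is 0 then val (Z i j) else 0 else (1%:M : 'M[B]_n) i j.
Proof.
by rewrite coef_fwd; case: k => [|[|k]]; [apply: val1M | | apply: rmorph0].
Qed.
Lemma val_bwd n (Z : 'M[E]_n) i j k : val (bwd Z i j)`_k =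
  if k is k'.+1 then if k' is 0 then (1%:M : 'M[B]_n) i j else 0 else val (Z i j).
Proof.
by rewrite coef_bwd; case: k => [|[|k]]; [ | apply: val1M | apply: rmorph0].
Qed.
Lemma Ber_Nf : val (rho (Nf X Y t)) = Ber (lin 1%:M M) * val (rho (Qf p Y)).
Proof.
have h1 := emx_lin hg (emx1 hg par) hM.
have hd : mx_invertible (drsubmx (lin 1%:M M)).
  by apply: dr_lin_inv; rewrite dr1; apply: mx_inv1.
have := @Ber_berN _ _ hps p q (lin 1%:M M) (map_mx rho (fwd X)) (map_mx rho (fwd Y))
  (fun i k l j => rho ('X^2 * (t i k l j)%:P)) h1 hd.
rewrite -berN_map det_map_mx -rmorphXn; apply.
- apply/matrixP => i j; rewrite [RHS]mxE [map_mx _ _ i j]mxE val_rho; apply/funext => k.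
  by rewrite val_fwd valX !mxE; case: k => [|[|k]]; rewrite ?mxE ?eq_rshift.
- apply/matrixP => i j; rewrite [RHS]mxE [map_mx _ _ i j]mxE val_rho; apply/funext => k.
  by rewrite val_fwd valY !mxE; case: k => [|[|k]]; rewrite ?mxE ?eq_rshift.
- move=> i k l j; rewrite val_rho.
  have -> : ursubmx (lin 1%:M M) i k = psm 1 (ursubmx M i k).
    apply/funext => n; rewrite !mxE /psm; case: n => [|[|n]] //=; rewrite !mxE //.
    by rewrite eq_lrshift.
  have -> : dlsubmx (lin 1%:M M) l j = psm 1 (dlsubmx M l j).
    apply/funext => n; rewrite !mxE /psm; case: n => [|[|n]] //=; rewrite !mxE //.
    by rewrite eq_rlshift.
  rewrite psmM -data_tE; apply/funext => n; rewrite /psm mulrC coefCM coefXn.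
  by case: eqP; rewrite ?mulr1 ?mulr0 ?rmorph0.
Qed.

Lemma Ber_Nb : mx_invertible (drsubmx M) ->
  val (rho (Nb X Y t)) = Ber (lin M 1%:M) * val (rho (Qb p Y)).
Proof.
move=> hY; have h1 := emx_lin hg hM (emx1 hg par).
have hd : mx_invertible (drsubmx (lin M 1%:M)) by apply: dr_lin_inv.
have := @Ber_berN _ _ hps p q (lin M 1%:M) (map_mx rho (bwd X)) (map_mx rho (bwd Y))
  (fun i k l j => rho (t i k l j)%:P) h1 hd.
rewrite -berN_map det_map_mx -rmorphXn; apply.
- apply/matrixP => i j; rewrite [RHS]mxE [map_mx _ _ i j]mxE val_rho; apply/funext => k.
  by rewrite val_bwd valX !mxE; case: k => [|[|k]]; rewrite ?mxE ?eq_rshift.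
- apply/matrixP => i j; rewrite [RHS]mxE [map_mx _ _ i j]mxE val_rho; apply/funext => k.
  by rewrite val_bwd valY !mxE; case: k => [|[|k]]; rewrite ?mxE ?eq_rshift.
- move=> i k l j; rewrite val_rho.
  have -> : ursubmx (lin M 1%:M) i k = psm 0 (ursubmx M i k).
    apply/funext => n; rewrite !mxE /psm; case: n => [|[|n]] //=; rewrite !mxE //.
    by rewrite eq_lrshift.
  have -> : dlsubmx (lin M 1%:M) l j = psm 0 (dlsubmx M l j).
    apply/funext => n; rewrite !mxE /psm; case: n => [|[|n]] //=; rewrite !mxE //.
    by rewrite eq_rlshift.
  rewrite psmM -data_tE; apply/funext => n; rewrite /psm coefC.
  by case: eqP; rewrite ?rmorph0.
Qed.
End BerSeries.

(** * The Hankel determinant *)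

Section Hankel.
Context (p q : nat).

Section Ring.
Context (K : comNzRingType).
Implicit Types (P Q G a b : {poly K}).

(* Q * geo L Q = Q_0^L modulo z^L: division by Q with denominators cleared. *)
Definition geo L Q : {poly K} :=
  \sum_(i < L) (Q`_0)%:P ^+ (L.-1 - i) * ((Q`_0)%:P - Q) ^+ i.

Lemma mul_geo L Q : Q * geo L Q = (Q`_0)%:P ^+ L - ((Q`_0)%:P - Q) ^+ L.
Proof. by rewrite subrXX opprB addrC subrK. Qed.

Lemma coef_low_pow P L n : P`_0 = 0 -> (n < L)%N -> (P ^+ L)`_n = 0.
Proof.
move=> h; elim: L n => // L ih n hn; rewrite exprS coefM big1 // => -[[|i] hi] _ /=.
  by rewrite h mul0r.
by rewrite ih ?mulr0 //; lia.
Qed.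

(** By [mul_geo], Q * geo L Q differs from Q_0^L by an L-th power of a polynomial without constant
    term, invisible below degree L. *)
Lemma geo_coef L P Q G : (forall n, (n < L)%N -> P`_n = (G * Q)`_n) ->
  forall n, (n < L)%N -> (P * geo L Q)`_n = Q`_0 ^+ L * G`_n.
Proof.
move=> h n hn; have -> : P = (P - G * Q) + G * Q by rewrite subrK.
rewrite mulrDl coefD coefM big1 ?add0r => [|i _]; last first.
  by rewrite coefB h ?subrr ?mul0r //; have := ltn_ord i; lia.
rewrite -mulrA mul_geo mulrBr coefB -rmorphXn mulrC coefCM [X in _ - X]coefM.
rewrite [X in _ - X]big1 ?subr0 // => i _; rewrite coef_low_pow ?mulr0 //; last by lia.
by rewrite coefB coefC subrr.
Qed.

Variables (X : 'M[K]_p) (Y : 'M[K]_q) (t : 'I_p -> 'I_q -> 'I_q -> 'I_p -> K).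
Local Notation N1 := (Nf X Y t).
Local Notation Q1 := (Qf p Y).
Local Notation N2 := (Nb X Y t).
Local Notation Q2 := (Qb p Y).

(* When k and p - q - k are less than L, this is gamma_k times (Qf_0 Qb_0)^L. *)
Definition gH L (k : int) : K :=
  Q2`_0 ^+ L * zx (fun n => (N1 * geo L Q1)`_n) k
  - Q1`_0 ^+ L * zx (fun n => (N2 * geo L Q2)`_n) (p%:Z - q%:Z - k).
Definition Hd L (k : int) : K := \det (\matrix_(i < q.+1, j < q.+1) gH L (k + i%:Z + j%:Z)).

(** Both sides have formal degree p + q + p q, so reversal in this degree replaces every factor by
    its partner. *)
Lemma reverse_fraction a a' b b' : revp p a a' -> revp q b b' ->
  b * N1 = a * Q1 -> b' * N2 = a' * Q2.
Proof.
move=> ha hb e.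
have h1 := revpMM hb (revp_N X Y t); have h2 := revpMM ha (revp_Q p Y).
rewrite e in h1; apply: (revp_eq h1).
by have -> : (q + q.+1 * p = p + q * p.+1)%N by lia.
Qed.

Lemma zxZ c (C : nat -> K) k : c * zx C k = zx (fun n => c * C n) k.
Proof. by case: k => [n|n] //=; rewrite mulr0. Qed.

(** Clearing denominators multiplies both halves of gamma by the same constant (Qb_0 Qf_0)^L, so the
    cancellation in [two_sided] survives and b supplies the kernel vector. *)
Lemma Hd_fraction a a' b b' L k : revp p a a' -> revp q b b' ->
  b`_0 = 1 -> b * N1 = a * Q1 ->
  (k + q%:Z + q%:Z < L%:Z)%R -> (p%:Z - k < L%:Z)%R -> Hd L k = 0.
Proof.
move=> ha hb b0 e hL1 hL2; apply: (@hankel_det0 _ q _ (fun j => b`_j)) => // i hi.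
have e' := reverse_fraction ha hb e.
under eq_bigr => j _ do rewrite /gH !zxZ.
apply: (@two_sided _ p q a a' b b' _ _ (Q2`_0 ^+ L * Q1`_0 ^+ L) L (k + q%:Z + i%:Z) ha hb).
- move=> n hn; have h := @geo_coef L (b * N1) Q1 a (fun n _ => congr1 (fun P => P`_n) e) n hn.
  rewrite -mulrA -h -mulrA coefM [RHS]mulr_sumr; apply: eq_bigr => j _.
  by rewrite mulrCA.
- move=> n hn.
  have h := @geo_coef L (b' * N2) Q2 a' (fun n _ => congr1 (fun P => P`_n) e') n hn.
  rewrite [_ * Q1`_0 ^+ L]mulrC -mulrA -h -mulrA coefM [RHS]mulr_sumr; apply: eq_bigr => j _.
  by rewrite mulrCA.
- by lia.
- by lia.
Qed.

(** The way back to gamma: with actual series C and G the cleared determinant is a Hankel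
    determinant times a power of Qb_0 Qf_0, which is a unit when M is invertible. *)
Lemma Hd_series L k (C G : nat -> K) :
  (forall n, N1`_n = \sum_(i < n.+1) C i * Q1`_(n - i)) ->
  (forall n, N2`_n = \sum_(i < n.+1) G i * Q2`_(n - i)) ->
  (k + q%:Z + q%:Z < L%:Z)%R -> (p%:Z - k < L%:Z)%R ->
  Hd L k = (Q2`_0 ^+ L * Q1`_0 ^+ L) ^+ q.+1 *
   \det (\matrix_(i < q.+1, j < q.+1)
      (zx C (k + i%:Z + j%:Z) - zx G (p%:Z - q%:Z - (k + i%:Z + j%:Z)))).
Proof.
move=> hC hG hL1 hL2; rewrite -detZ; congr (\det _); apply/matrixP => i j; rewrite !mxE.
have ser P Q (F : nat -> K) : (forall n, P`_n = \sum_(i < n.+1) F i * Q`_(n - i)) ->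
  forall n, (n < L)%N -> (P * geo L Q)`_n = Q`_0 ^+ L * F n.
  move=> h n hn; rewrite (@geo_coef L P Q (\poly_(i < L) F i)) // ?coef_poly ?hn //.
  move=> m hm; rewrite h coefM; apply: eq_bigr => l _; rewrite coef_poly.
  by rewrite (leq_ltn_trans _ hm) // -ltnS.
have zxser P Q (F : nat -> K) m : (forall n, P`_n = \sum_(i < n.+1) F i * Q`_(n - i)) ->
  (m < L%:Z)%R -> zx (fun n => (P * geo L Q)`_n) m = Q`_0 ^+ L * zx F m.
  by move=> h; case: m => [m|m] hm /=; rewrite ?mulr0 // (ser _ _ _ h) //; lia.
have hi := ltn_ord i; have hj := ltn_ord j.
rewrite /gH (zxser _ _ _ _ hC); last by lia.
rewrite (zxser _ _ _ _ hG); last by lia.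
by rewrite mulrBr -!mulrA; congr (_ - _); rewrite mulrCA.
Qed.

Lemma coef0_det n (Z : 'M[{poly K}]_n) : (\det Z)`_0 = \det (map_mx (fun P : {poly K} => P`_0) Z).
Proof.
rewrite -horner_coef0 -/(horner_eval 0 _) -det_map_mx; congr (\det _).
by apply/matrixP => i j; rewrite !mxE; apply: horner_coef0.
Qed.
Lemma coef0_exp P n : (P ^+ n)`_0 = P`_0 ^+ n.
Proof. by rewrite -!horner_coef0 horner_exp. Qed.
Lemma Qf_0 : Q1`_0 = 1.
Proof.
rewrite coef0_exp coef0_det (_ : map_mx _ _ = 1%:M) ?det1 ?expr1n //.
apply/matrixP => i j; rewrite !mxE coefD coefXM addr0.
by case: (i == j); rewrite ?mulr1n ?mulr0n ?coef1 ?coef0.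
Qed.
Lemma Qb_0 : Q2`_0 = \det Y ^+ p.+1.
Proof.
rewrite coef0_exp coef0_det; congr (\det _ ^+ _).
apply/matrixP => i j; rewrite !mxE coefD coefC /=.
by case: (i == j); rewrite ?mulr1n ?mulr0n ?coefX ?coef0 add0r.
Qed.
End Ring.

(** * Naturality of the cleared Hankel determinant *)

Section Natural.
Context (K K' : comNzRingType) (f : {rmorphism K -> K'}).
Variables (X : 'M[K]_p) (Y : 'M[K]_q) (t : 'I_p -> 'I_q -> 'I_q -> 'I_p -> K).
Let X' := map_mx f X.
Let Y' := map_mx f Y.
Let t' i k l j := f (t i k l j).

Lemma map_fwd n (Z : 'M[K]_n) : map_mx (map_poly f) (fwd Z) = fwd (map_mx f Z).
Proof.
apply/matrixP => i j; rewrite !mxE rmorphD rmorphM /= map_polyX map_polyC rmorph_nat.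
by [].
Qed.
Lemma map_bwd n (Z : 'M[K]_n) : map_mx (map_poly f) (bwd Z) = bwd (map_mx f Z).
Proof. by apply/matrixP => i j; rewrite !mxE rmorphD rmorphMn /= map_polyX map_polyC. Qed.
Lemma map_Nf : map_poly f (Nf X Y t) = Nf X' Y' t'.
Proof.
rewrite /Nf [LHS](berN_map (map_poly f)) !map_fwd; congr (berN _ _ _).
do 4 (apply/funext => ?); by rewrite rmorphM /= map_polyXn map_polyC.
Qed.
Lemma map_Nb : map_poly f (Nb X Y t) = Nb X' Y' t'.
Proof.
rewrite /Nb [LHS](berN_map (map_poly f)) !map_bwd; congr (berN _ _ _).
do 4 (apply/funext => ?); by rewrite /= map_polyC.
Qed.
Lemma map_Qf : map_poly f (Qf p Y) = Qf p Y'.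
Proof. by rewrite /Qf rmorphXn /= -det_map_mx map_fwd. Qed.
Lemma map_Qb : map_poly f (Qb p Y) = Qb p Y'.
Proof. by rewrite /Qb rmorphXn /= -det_map_mx map_bwd. Qed.
Lemma map_geo L Q : map_poly f (geo L Q) = geo L (map_poly f Q).
Proof.
rewrite /geo rmorph_sum; apply: eq_bigr => i _.
by rewrite rmorphM !rmorphXn rmorphB /= map_polyC coef_map.
Qed.
Lemma zx_map (C : nat -> K) k : f (zx C k) = zx (fun n => f (C n)) k.
Proof. by case: k => [n|n] //=; rewrite rmorph0. Qed.
Lemma Hd_map L k : f (Hd X Y t L k) = Hd X' Y' t' L k.
Proof.
rewrite /Hd -det_map_mx; congr (\det _); apply/matrixP => i j; rewrite !mxE /gH.
rewrite rmorphB !rmorphM !rmorphXn !zx_map -!coef_map map_Qf map_Qb /=.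
congr (_ * zx _ _ - _ * zx _ _); apply/funext => n; rewrite -coef_map rmorphM /= map_geo.
  by rewrite map_Nf map_Qf.
by rewrite map_Nb map_Qb.
Qed.
End Natural.
End Hankel.

Section Units.
Context (B : nzRingType) (g : bool -> B -> Prop) (hg : superring g).
Local Notation E := (evenT hg).
Local Notation hps := (psg_superring hg).
Local Notation rho := (@rho B g hg).
Context (p q : nat).
Local Notation par := (@ipar p q).
Implicit Types (M N : 'M[B]_(p + q)).

(** The inverse is the 1 x 1 case of [mx_ps_inv], and [even_unit] makes it even. *)
Lemma rho_unit (P : {poly E}) (u : E) : u * P`_0 = 1 -> exists w, rho P * w = 1.
Proof.
move=> hu; pose F : 'M[pseries B]_1 := (val (rho P))%:M.
have c0 : cmx 0 F = (val P`_0)%:M.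
  by apply/matrixP => i j; rewrite !mxE !ord1 val_rho.
have [G [h1 h2]] : mx_invertible F.
  apply: mx_ps_inv; rewrite c0; exists (val u)%:M.
  by rewrite -!scalar_mxM -!rmorphM [P`_0 * u]mulrC hu rmorph1.
have e1 : val (rho P) * G 0 0 = 1.
  by have /matrixP/(_ 0 0) := h1; rewrite /F mul_scalar_mx !mxE mulr1n.
have e2 : G 0 0 * val (rho P) = 1.
  have /matrixP/(_ 0 0) := h2; rewrite !mxE big_ord1 !mxE !mulr1n; exact.
have gG := even_unit hps (evenTP (rho P)) e1 e2.
exists (to_even hps (G 0 0)); apply: val_inj.
by rewrite [LHS]rmorphM [RHS]rmorph1 -[RHS]e1; congr (_ * _); apply: to_evenK.
Qed.

Lemma det_fwd_0 n (Z : 'M[E]_n) : (\det (fwd Z))`_0 = 1.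
Proof.
rewrite coef0_det (_ : map_mx _ _ = 1%:M) ?det1 //.
apply/matrixP => i j; rewrite !mxE coefD coefXM addr0.
by case: (i == j); rewrite ?mulr1n ?mulr0n ?coef1 ?coef0.
Qed.

Definition dX M := lift_mx hg (ulsubmx M).
Definition dY M := lift_mx hg (drsubmx M).

(** The products of odd entries of N vanish, so Ber (1 + z N) is a / b with a and b of degrees at
    most p and q. The surplus power b^p can be cancelled because b has constant term 1, and
    injectivity of [rho] brings the identity back to polynomials. *)
Lemma fraction_block M N : emx g par M -> emx g par N ->
  ursubmx N = 0 -> Ber (lin 1%:M M) = Ber (lin 1%:M N) ->
  \det (fwd (dY N)) * Nf (dX M) (dY M) (data_t hg M) =
  \det (fwd (dX N)) * Qf p (dY M).
Proof.
move=> hM hN uN eB; set b := \det (fwd (dY N)); set a := \det (fwd (dX N)).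
have [w hw] : exists w, rho b * w = 1.
  by apply: (@rho_unit b 1); rewrite det_fwd_0 mulr1.
have d1 : mx_invertible (drsubmx (lin (1%:M : 'M_(p + q)) M)).
  by apply: dr_lin_inv; rewrite dr1; apply: mx_inv1.
have hR := Ber_even hps (emx_lin hg (emx1 hg par) hM) d1.
pose R := to_even hps (Ber (lin 1%:M M)).
have eM : rho (Nf (dX M) (dY M) (data_t hg M)) = R * rho (Qf p (dY M)).
  apply: val_inj; rewrite [RHS]rmorphM [LHS](Ber_Nf hg hM); congr (_ * _).
  exact: (esym (to_evenK hps hR)).
have eN : rho (Nf (dX N) (dY N) (data_t hg N)) = R * rho (Qf p (dY N)).
  apply: val_inj; rewrite [RHS]rmorphM [LHS](Ber_Nf hg hN); congr (_ * _).
  by rewrite -eB; exact: (esym (to_evenK hps hR)).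
have nN : Nf (dX N) (dY N) (data_t hg N) = b ^+ p * a.
  rewrite /Nf /berN (_ : thmx _ _ = 0) ?subr0 ?detZ //.
  apply/matrixP => i j; rewrite !mxE big1 // => k _; rewrite big1 // => l _.
  rewrite (_ : data_t hg N i k l j = 0) ?polyC0 ?mulr0 ?mul0r //.
  by apply: val_inj; rewrite data_tE // uN mxE mul0r.
have eab : rho a = R * rho b.
  have : rho b ^+ p * rho a = rho b ^+ p * (R * rho b).
    transitivity (rho (b ^+ p * a)); first by rewrite rmorphM rmorphXn.
    by rewrite -nN eN /Qf rmorphXn exprSr [RHS]mulrCA.
  move=> /(congr1 (fun x => w ^+ p * x)).
  by rewrite !mulrA -!exprMn [w * _]mulrC hw expr1n !mul1r.
apply: (rho_inj (hg := hg)).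
transitivity (rho b * rho (Nf (dX M) (dY M) (data_t hg M))); first exact: (rmorphM rho b _).
transitivity (rho a * rho (Qf p (dY M))); last exact: (esym (rmorphM rho a _)).
have gen (x y z u : evenT hps) : u = y * x -> x * (y * z) = u * z.
  by move=> ->; rewrite mulrCA mulrA.
exact: etrans (congr1 (fun x => rho b * x) eM) (gen _ _ _ _ eab).
Qed.
End Units.

(** * Deformation to a block diagonal matrix *)

Section BlockDiagonal.
Context (B : nzRingType) (g : bool -> B -> Prop) (hg : superring g).
Local Notation hps := (psg_superring hg).
Context (p q : nat).
Local Notation par := (@ipar p q).

Definition D01 : 'M[B]_(p + q) := block_mx 0 0 0 1%:M.
Lemma emx_D01 : emx g par D01.
Proof. by apply: emx_block; try exact: evmx0; apply: evmx1. Qed.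

(* Solves N T = T N' order by order in the power series variable, starting from
   N = D01, T = 1: the commutator with D01 is invertible on off-diagonal blocks. *)
Lemma block_diagonalize (W : 'M[B]_(p + q)) : emx g par W ->
  exists T N' : 'M[pseries B]_(p + q),
   [/\ emx (psg g) par T, emx (psg g) par N', mx_invertible T, ursubmx N' = 0
     & lin D01 W *m T = T *m N'].
Proof.
move=> hW.
(* In order n + 1 the equation is N'_(n+1) - [D01, T_(n+1)] = rem_n. The commutator with D01 negates
   the upper right block and keeps the lower left one, hence the signs in [off]; the diagonal blocks
   go into N'. *)
pose off (Z : 'M[B]_(p + q)) : 'M[B]_(p + q) := block_mx 0 (ursubmx Z) (- dlsubmx Z) 0.
pose dia (Z : 'M[B]_(p + q)) : 'M[B]_(p + q) := block_mx (ulsubmx Z) 0 0 (drsubmx Z).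
pose rem (f : nat -> 'M[B]_(p + q) * 'M[B]_(p + q)) n :=
  W *m (f n).1 - \sum_(i < n) (f (n - i)%N).1 *m (f i.+1).2.
have [|f hf] := @strong_rec _ (0, 0) (fun n f =>
    if n is n'.+1 then (off (rem f n'), dia (rem f n')) else (1%:M, D01)).
  case=> // n f f' e; have -> // : rem f n = rem f' n.
  rewrite /rem e //; congr (_ - _); apply: eq_bigr => i _.
  by rewrite !e // ltnS ?leq_subr // ltnW.
have hem n : emx g par (f n).1 /\ emx g par (f n).2.
  elim/ltn_ind: n => -[|n] ih; rewrite hf /=.
    by split; [apply: emx1 | apply: emx_D01].
  have hr : emx g par (rem f n).
    move=> i j; rewrite !mxE; apply: (sr_B hg).
      by have := emx_mul hg hW (ih n (leqnn _)).1 i j; rewrite mxE.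
    rewrite summxE; apply: (sr_sum hg) => l _.
    apply: (emx_mul hg (ih _ _).1 (ih _ _).2); rewrite ?ltnS ?leq_subr //.
  split; apply: emx_block; try exact: (evmx0 hg).
  - exact: emx_ur.
  - exact: (evmxN hg (emx_dl hr)).
  - exact: emx_ul.
  - exact: emx_dr.
pose T := psmx (fun n => (f n).1); pose N' := psmx (fun n => (f n).2).
exists T, N'; split.
- by apply: emx_psmx => n; have [] := hem n.
- by apply: emx_psmx => n; have [] := hem n.
- by apply: mx_ps_inv; rewrite psmxK hf; apply: mx_inv1.
- apply/matrixP => i j; apply/funext => n; rewrite !mxE hf.
  case: n => [|n] /=; first by rewrite block_mxEur mxE.
  by rewrite block_mxEur mxE.
- apply: cmx_inj => n; rewrite lin_mulE cmx_mul; case: n => [|n].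
    by rewrite big_ord1 !psmxK hf /= mulmx1 mul1mx.
  have -> : \sum_(i < n.+2) cmx i T *m cmx (n.+1 - i) N' =
      (f 0%N).1 *m (f n.+1).2 + (\sum_(i < n) (f (n - i)%N).1 *m (f i.+1).2
      + (f n.+1).1 *m (f 0%N).2).
    rewrite big_ord_recl big_ord_recr /= !psmxK subn0; congr (_ + (_ + _)).
      rewrite (reindex_inj rev_ord_inj); apply: eq_bigr => i _ /=; rewrite !psmxK.
      rewrite /bump leq0n add1n; congr ((f _).1 *m (f _).2); have := ltn_ord i; lia.
    by rewrite /bump leq0n add1n subnn.
  have -> : W *m (f n).1 = rem f n + \sum_(i < n) (f (n - i)%N).1 *m (f i.+1).2.
    by rewrite subrK.
  rewrite [f 0%N]hf [f n.+1]hf /=; set Z := rem f n; set S := \sum_(i < n) _.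
  rewrite mul1mx addrA [RHS]addrCA [RHS]addrC; congr (_ + _).
  rewrite -{2}(submxK Z) /off /dia /D01 !mulmx_block !mulmx0 !mul0mx !mulmx1 !mul1mx.
  by rewrite !add_block_mx !addr0 !add0r !addNr.
Qed.
End BlockDiagonal.

Section Conjugation.
Context (B : nzRingType) (g : bool -> B -> Prop) (hg : superring g).
Context (p q : nat).
Local Notation par := (@ipar p q).

Lemma emx_exp (M : 'M[B]_(p + q)) k : emx g par M -> emx g par (M ^+ k).
Proof.
move=> hM; elim: k => [|k ih]; first exact: (emx1 hg par).
by rewrite exprS; apply: (emx_mul hg hM ih).
Qed.

Lemma str_conj (N N' T : 'M[B]_(p + q)) k : emx g par N' -> emx g par T ->
  mx_invertible T -> N *m T = T *m N' -> strm par (N ^+ k) = strm par (N' ^+ k).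
Proof.
move=> hN' hT [Ti [h1 h2]] e; have hTi := emx_inv hg hT h1 h2.
have ek : N ^+ k *m T = T *m N' ^+ k.
  elim: k => [|k ih]; first by rewrite !expr0 mulmx1 mul1mx.
  rewrite exprS -[N * _]/(N *m _) -mulmxA ih mulmxA e -mulmxA.
  by rewrite -[N' *m _]/(N' * _) -exprS.
have -> : N ^+ k = T *m (N' ^+ k *m Ti).
  by rewrite mulmxA -ek -mulmxA h1 mulmx1.
rewrite (strmC hg) //; last by apply: (emx_mul hg) => //; apply: emx_exp.
by rewrite -mulmxA h2 mulmx1.
Qed.

(** Power sums str N^k are invariant under conjugation, and Newton's recursion determines all
    coefficients of Ber (1 + z N) from them. *)
Lemma Ber_lin_conj (N N' T : 'M[B]_(p + q)) : emx g par N -> emx g par N' ->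
  emx g par T -> mx_invertible T -> N *m T = T *m N' ->
  Ber (lin 1%:M N) = Ber (lin 1%:M N').
Proof.
move=> hN hN' hT iT e; apply/funext => n; rewrite !(Ber_lin1 hg) //; move: n.
apply: (@rec_unique _ _ hg (fun j => (-1) ^+ j * strm par (N ^+ j.+1))
  (fun n => strL par n N) (fun n => strL par n N')) => [|n|n].
- by rewrite !(strL0 hg).
- exact: (strL_newton hg n hN).
- rewrite (strL_newton hg n hN'); apply: eq_bigr => i _.
  by rewrite (str_conj _ hN' hT iT e).
Qed.
End Conjugation.

Section HankelZero.
Context (B : nzRingType) (g : bool -> B -> Prop) (hg : superring g).
Local Notation E := (evenT hg).
Local Notation hps := (psg_superring hg).
Local Notation rho := (@rho B g hg).
Context (p q : nat).
Local Notation par := (@ipar p q).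

(* Along the line from D01 (at 0) to M (at 1) the cleared Hankel determinant is
   a polynomial; it vanishes as a power series at 0, where the matrix can be
   block diagonalized, hence also at 1. *)
Lemma Hd_zero (M : 'M[B]_(p + q)) L k : emx g par M ->
  (k + q%:Z + q%:Z < L%:Z)%R -> (p%:Z - k < L%:Z)%R ->
  Hd (dX hg M) (dY hg M) (data_t hg M) L k = 0.
Proof.
move=> hM hL1 hL2; pose W := M - D01 B p q.
have hW : emx g par W by move=> i j; rewrite !mxE; apply: (sr_B hg); [|have := emx_D01 hg i j; rewrite mxE].
have [T [N' [hT hN' iT uN' e]]] := block_diagonalize hg hW.
pose Nt := lin (D01 B p q) W.
have hNt : emx (psg g) par Nt := emx_lin hg (@emx_D01 _ _ hg p q) hW.
have fr := fraction_block hps hNt hN' uN' (Ber_lin_conj hps hNt hN' hT iT e).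
(* The blocks of D01 + s (M - D01): the upper left one is s X, the lower right one 1 + s (Y - 1),
   and each product of two odd entries carries s^2. *)
pose Xp : 'M[{poly E}]_p := 'X *: map_mx polyC (dX hg M).
pose Yp : 'M[{poly E}]_q := fwd (dY hg M - 1%:M).
pose tp i k l j : {poly E} := 'X^2 * (data_t hg M i k l j)%:P.
have sub (R : nzRingType) (Z : 'M[R]_(p + q)) :
  [/\ forall i j, ulsubmx Z i j = Z (lshift q i) (lshift q j),
      forall i j, ursubmx Z i j = Z (lshift q i) (rshift p j),
      forall i j, dlsubmx Z i j = Z (rshift p i) (lshift q j)
    & forall i j, drsubmx Z i j = Z (rshift p i) (rshift p j)].
  by split=> i j; rewrite !mxE.
have [ulN urN dlN drN] := sub _ Nt; have [ulM urM dlM drM] := sub _ M.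
have ent i j n : Nt i j n =
    if n is n'.+1 then if n' is 0 then W i j else 0 else D01 B p q i j.
  by rewrite mxE; case: n => [|[|n]] //; rewrite mxE.
have WE i j : W i j = M i j - D01 B p q i j by rewrite !mxE.
have eX : map_mx rho Xp = dX hps Nt.
  apply: (emb_inj (hg := hps)); rewrite lift_mxK; last exact: emx_ul.
  apply/matrixP => i j; rewrite mxE [map_mx _ _ i j]mxE val_rho; apply/funext => n.
  have -> : Xp i j = 'X * (dX hg M i j)%:P by rewrite !mxE.
  rewrite coefXM coefC ulN ent; case: n => [|[|n]]; rewrite /= ?rmorph0 //.
    by rewrite block_mxEul mxE.
  by rewrite WE block_mxEul [X in _ - X]mxE subr0 -ulM; apply: (valX hg hM).
have eY : map_mx rho Yp = dY hps Nt.
  apply: (emb_inj (hg := hps)); rewrite lift_mxK; last exact: emx_dr.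
  apply/matrixP => i j; rewrite mxE [map_mx _ _ i j]mxE val_rho; apply/funext => n.
  rewrite /Yp val_fwd drN ent; case: n => [|[|n]] //.
    by rewrite block_mxEdr.
  have -> : (dY hg M - 1%:M) i j = dY hg M i j - (1%:M : 'M_q) i j by rewrite !mxE.
  rewrite WE block_mxEdr rmorphB; congr (_ - _); last exact: val1M.
  by rewrite -drM; apply: (valY hg hM).
have et : (fun i k l j => rho (tp i k l j)) = data_t hps Nt.
  apply/funext => i; apply/funext => k0; apply/funext => l; apply/funext => j.
  apply: val_inj; rewrite (data_tE hps hNt) val_rho.
  have -> : ursubmx Nt i k0 = psm 1 (ursubmx M i k0).
    apply/funext => n; rewrite urN ent /psm; case: n => [|[|n]] //=.
      by rewrite block_mxEur mxE.
    by rewrite WE block_mxEur [X in _ - X]mxE subr0 urM.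
  have -> : dlsubmx Nt l j = psm 1 (dlsubmx M l j).
    apply/funext => n; rewrite dlN ent /psm; case: n => [|[|n]] //=.
      by rewrite block_mxEdl mxE.
    by rewrite WE block_mxEdl [X in _ - X]mxE subr0 dlM.
  rewrite psmM -(data_tE hg hM); apply/funext => n; rewrite /psm /tp mulrC coefCM coefXn.
  by case: eqP; rewrite ?mulr1 ?mulr0 ?rmorph0.
(* As [rho] is injective, it suffices that the series in s vanishes; there [fr] provides a
   denominator of degree q. *)
have z1 : Hd Xp Yp tp L k = 0.
  apply: (rho_inj (hg := hg)).
  transitivity (Hd (dX hps Nt) (dY hps Nt) (data_t hps Nt) L k).
    pose f : {rmorphism {poly E} -> evenT hps} := rho.
    have h := Hd_map f Xp Yp tp L k.
    have h' : Hd (map_mx rho Xp) (map_mx rho Yp) (fun i k l j => rho (tp i k l j)) L k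
       = Hd (dX hps Nt) (dY hps Nt) (data_t hps Nt) L k.
      have cg x x' y y' t t' : x = x' -> y = y' -> t = t' ->
        Hd x y t L k = Hd x' y' t' L k :> evenT hps by move=> -> -> ->.
      exact: cg eX eY et.
    apply: etrans _ h'.
    exact h.
  have [a' ha] : exists a', revp p (\det (fwd (dX hps N'))) a'.
    exists (\det (bwd (dX hps N'))); rewrite -[X in revp X]mul1n.
    by apply: revp_det => i j; apply: revp_fwd.
  have [b' hb] : exists b', revp q (\det (fwd (dY hps N'))) b'.
    exists (\det (bwd (dY hps N'))); rewrite -[X in revp X]mul1n.
    by apply: revp_det => i j; apply: revp_fwd.
  rewrite (Hd_fraction ha hb (det_fwd_0 _) fr hL1 hL2).
  by apply/esym/(rmorph0 rho).
(* At s = 1 the line reaches M, and naturality of [Hd] carries the vanishing over. *)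
have h2 := Hd_map (horner_eval (1 : E)) Xp Yp tp L k.
have h3 : horner_eval (1 : E) (Hd Xp Yp tp L k) = 0 by rewrite z1; apply: horner0.
have e1 : dX hg M = map_mx (horner_eval (1 : E)) Xp.
  apply/matrixP => i j; rewrite [RHS]mxE.
  have -> : Xp i j = 'X * (dX hg M i j)%:P by rewrite !mxE.
  by rewrite /horner_eval hornerM hornerX hornerC mul1r.
have e2 : dY hg M = map_mx (horner_eval (1 : E)) Yp.
  apply/matrixP => i j; rewrite [RHS]mxE.
  have -> : Yp i j = (i == j)%:R + 'X * (dY hg M i j - (i == j)%:R)%:P by rewrite !mxE.
  rewrite /horner_eval hornerD hornerM hornerX hornerC mul1r.
  by case: (i == j); rewrite ?hornerC ?horner0 addrC subrK.
have e3 : data_t hg M = fun i k l j => horner_eval (1 : E) (tp i k l j).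
  apply/funext => i; apply/funext => k0; apply/funext => l; apply/funext => j.
  by rewrite /tp /horner_eval hornerM hornerXn hornerC expr1n mul1r.
have cg x x' y y' t t' : x = x' -> y = y' -> t = t' ->
  Hd x y t L k = Hd x' y' t' L k :> E by move=> -> -> ->.
exact (etrans (cg _ _ _ _ _ _ _ _ e1 e2 e3) (etrans (esym h2) h3)).
Qed.
End HankelZero.

(** * The sequence gamma *)

Section Final.
Context (C : fieldType) (A : algType C) (gA : bool -> {pred A}).
Context (hg : superring (fun d x => x \in gA d)).
Local Notation E := (evenT hg).
Local Notation hps := (psg_superring hg).
Local Notation rho := (@rho A _ hg).
Context (p q : nat) (M : 'M[A]_(p + q)) (hM : even_op gA M) (iM : mx_invertible M).
Local Notation par := (@ipar p q).
Local Notation X := (dX hg M).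
Local Notation Y := (dY hg M).
Local Notation t := (data_t hg M).

Let R : pseries A := Ber (lin 1%:M M).
Let G : pseries A := Ber (lin M 1%:M).
Let RE n : E := to_even hg (R n).
Let GE n : E := to_even hg (G n).

Let dM : mx_invertible (drsubmx M) := dr_invertible hg hM iM.

Lemma R_even : psg (fun d x => x \in gA d) false R.
Proof.
apply: (Ber_even hps (emx_lin hg (emx1 hg par) hM)).
by apply: dr_lin_inv; rewrite dr1; apply: mx_inv1.
Qed.
Lemma G_even : psg (fun d x => x \in gA d) false G.
Proof.
by apply: (Ber_even hps (emx_lin hg hM (emx1 hg par))); apply: dr_lin_inv.
Qed.
Lemma val_RE n : val (RE n) = R n.
Proof. exact: to_evenK (R_even n). Qed.
Lemma val_GE n : val (GE n) = G n.
Proof. exact: to_evenK (G_even n). Qed.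

Definition gE (k : int) : E := zx RE k - zx GE (p%:Z - q%:Z - k).

Lemma val_zx (F : nat -> E) k : val (zx F k) = zx (fun n => val (F n)) k.
Proof. by case: k => [n|n] //=; apply: rmorph0. Qed.

Lemma val_gE k : val (gE k) = gam gA M k.
Proof.
have [P [h1 h2]] := iM; have hP := emx_inv hg hM h1 h2.
transitivity (val (zx RE k) - val (zx GE (p%:Z - q%:Z - k))); first exact: rmorphB.
rewrite !val_zx /gam /strSigma (mx_invE h1 h2).
have -> : p%:Z - (q%:Z + k) = p%:Z - q%:Z - k by lia.
congr (_ - _).
  case: k => [n|n] //=; rewrite val_RE /R (Ber_lin1 hg) //.
  exact: esym (strLambdaE hg n hM).
case: (p%:Z - q%:Z - k) => [n|n] /=; last by rewrite mulr0.
rewrite val_GE /G (Ber_lin2 hg n hM h1 h2 dM); congr (_ * _).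
exact: esym (strLambdaE hg n hP).
Qed.

Lemma series_conv (P Q : {poly E}) (F : pseries A) (FE : nat -> E) :
  (forall n, val (FE n) = F n) ->
  val (rho P) = F * val (rho Q) ->
  forall n, P`_n = \sum_(i < n.+1) FE i * Q`_(n - i).
Proof.
move=> hF e n; apply: val_inj; rewrite rmorph_sum.
have := congr1 (fun f : pseries A => f n) e; rewrite psM !val_rho => ->.
by apply: eq_bigr => i _; rewrite -hF; apply: esym; apply: rmorphM.
Qed.

Lemma conv_f n : (Nf X Y t)`_n = \sum_(i < n.+1) RE i * (Qf p Y)`_(n - i).
Proof. by apply: (series_conv val_RE); apply: Ber_Nf. Qed.
Lemma conv_b n : (Nb X Y t)`_n = \sum_(i < n.+1) GE i * (Qb p Y)`_(n - i).
Proof. by apply: (series_conv val_GE); apply: Ber_Nb. Qed.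

Lemma detY_unit : exists u, u * \det Y = 1.
Proof.
have [Yi [y1 y2]] := dM; have hE : Operators.emx (fun (d : bool) (x : A) => x \in gA d) par M := hM.
have hY := emx_dr hE; have hYi := evmx_inv hg hY y1 y2.
have [d1 d2] := det_inv hg hY y1 y2.
exists (\det (lift_mx hg Yi)); apply: val_inj.
transitivity (\val (\det (lift_mx hg Yi)) * \val (\det Y)); first exact: rmorphM.
transitivity (\det Yi * \det (drsubmx M)); last by rewrite d2 [RHS]rmorph1.
by congr (_ * _); apply: esym; apply: det_even.
Qed.

Lemma Qb_unit : exists u, u * (Qb p Y)`_0 = 1.
Proof.
have [u hu] := detY_unit; exists (u ^+ p.+1).
by rewrite Qb_0 -exprMn hu expr1n.
Qed.

Lemma hankel_gam k : \det (\matrix_(i < q.+1, j < q.+1) gam gA M (k + i%:Z + j%:Z)) = 0.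
Proof.
(* Large enough for all indices k + i + j and p - q - (k + i + j) to stay below L. *)
pose L := (`|k| + p + q + q).+1.
have hL1 : (k + q%:Z + q%:Z < L%:Z)%R by rewrite /L; lia.
have hL2 : (p%:Z - k < L%:Z)%R by rewrite /L; lia.
have z := Hd_zero hg hM hL1 hL2.
have e := Hd_series conv_f conv_b hL1 hL2; rewrite z in e.
have [u hu] := Qb_unit.
have dz : \det (\matrix_(i < q.+1, j < q.+1) gE (k + i%:Z + j%:Z)) = 0.
  set d := \det _; set c := (Qb p Y)`_0 ^+ L * (Qf p Y)`_0 ^+ L in e.
  (* The clearing factor is a unit: Qf_0 = 1, and Qb_0 is a power of det Y, invertible by
     [dr_invertible]. *)
  have hc : u ^+ L * c = 1 by rewrite /c Qf_0 expr1n mulr1 -exprMn hu expr1n.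
  have : (u ^+ L * c) ^+ q.+1 * d = 0.
    by rewrite exprMn -mulrA; apply: etrans (congr1 _ (esym e)) (mulr0 _).
  by rewrite hc expr1n mul1r.
have := congr1 val dz; rewrite -det_map_mx rmorph0 => dz'.
apply: etrans dz'; congr (\det _); apply/matrixP => i j; rewrite !mxE.
exact: esym (val_gE _).
Qed.

Lemma recurrence_gam : general_position gA M ->
  exists b : nat -> A, [/\ b 0%N = 1, (forall j : nat, (j <= q)%N -> b j \in gA false)
    & forall k : int, \sum_(j < q.+1) b j * gam gA M (k + q%:Z - j%:Z) = 0].
Proof.
move=> [a [b [[sa a0 _ ga] [sb b0 _ gb] ech]]].
exists (fun j => b`_j); split=> // k.
pose lft_poly (P : {poly A}) : {poly E} := \poly_(i < size P) to_even hg P`_i.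
have lftE (P : {poly A}) : (forall i, P`_i \in gA false) ->
    forall i, val (lft_poly P)`_i = P`_i.
  move=> gP i; rewrite coef_poly; case: ltnP => h; first exact: to_evenK (gP i).
  by rewrite nth_default // rmorph0.
pose aE := lft_poly a; pose bE := lft_poly b.
have ra : val (rho aE) = ps_of_poly a.
  by rewrite val_rho; apply/funext => n; apply: lftE.
have rb : val (rho bE) = ps_of_poly b.
  by rewrite val_rho; apply/funext => n; apply: lftE.
have bE0 : bE`_0 = 1 by apply: val_inj; rewrite (lftE b gb) b0 rmorph1.
have [w hw] : exists w, rho bE * w = 1.
  by apply: (@rho_unit _ _ hg bE 1); rewrite bE0 mulr1.
have w1 : val (rho bE) * val w = 1 by rewrite -rmorphM hw rmorph1.
have w2 : val w * val (rho bE) = 1 by rewrite -rmorphM mulrC hw rmorph1.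
have eR : R * val (rho bE) = val (rho aE).
  have e1 : R = val (rho aE) * val w.
    by rewrite /R -charfun_lin ech -rb (elt_invE w1 w2) ra.
  by rewrite e1 -mulrA w2 mulr1.
have cR n : aE`_n = \sum_(i < n.+1) RE i * bE`_(n - i).
  by apply: (series_conv val_RE); rewrite eR.
pose R1 := to_even hps R; pose G1 := to_even hps G.
have vR : val R1 = R by apply: to_evenK; apply: R_even.
have vG : val G1 = G by apply: to_evenK; apply: G_even.
have vM (x y : evenT hps) : \val (x * y) = \val x * \val y by exact: rmorphM.
have eF : rho (Nf X Y t) = R1 * rho (Qf p Y).
  by apply: val_inj; apply: etrans (Ber_Nf hg hM) _; rewrite vM vR.
have eB : rho (Nb X Y t) = G1 * rho (Qb p Y).
  by apply: val_inj; apply: etrans (Ber_Nb hg hM dM) _; rewrite vM vG.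
have ea : rho aE = R1 * rho bE by apply: val_inj; rewrite vM vR eR.
(* Reversal makes sense for polynomials only, so the equality of series is first
   cross-multiplied. *)
have e : bE * Nf X Y t = aE * Qf p Y.
  apply: (rho_inj (hg := hg)); apply: etrans (rmorphM rho bE _) _.
  apply: etrans _ (esym (rmorphM rho aE _)).
  have gen (x y z u v : evenT hps) : v = y * z -> u = y * x -> x * v = u * z.
    by move=> -> ->; rewrite mulrCA mulrA.
  exact: gen eF ea.
have szP (P : {poly A}) n : (size P <= n)%N -> (size (lft_poly P) <= n)%N.
  by move=> h; apply: leq_trans (size_poly _ _) h.
have [a' ha] := revp_size (szP a _ sa); have [b' hb] := revp_size (szP b _ sb).
have e' := reverse_fraction ha hb e.
have [u hu] := Qb_unit; have [v hv] := @rho_unit _ _ hg (Qb p Y) u hu.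
(* Cancelling [Qb], a unit among series because its constant term is one, leaves Ber (M + z) = a' /
   b'. *)
have ea' : rho a' = G1 * rho b'.
  have h : rho b' * rho (Nb X Y t) = rho a' * rho (Qb p Y).
    apply: etrans (esym (rmorphM rho b' _)) _.
    by apply: etrans (congr1 rho e') _; apply: (rmorphM rho a').
  have gen (x y z s r n : evenT hps) : n = z * s -> x * n = y * s -> s * r = 1 -> y = z * x.
    by move=> -> h1 h2; rewrite -[y]mulr1 -h2 mulrA -h1 -!mulrA h2 mulr1 mulrC.
  exact: gen eB h hv.
have cG n : a'`_n = \sum_(i < n.+1) GE i * b'`_(n - i).
  by apply: (series_conv val_GE); rewrite ea' vM vG.
pose L := (`|k| + p + q).+1.
have flip (x y : nat -> E) n :
    \sum_(i < n.+1) x i * y (n - i)%N = \sum_(i < n.+1) y i * x (n - i)%N.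
  rewrite (reindex_inj rev_ord_inj); apply: eq_bigr => i _ /=.
  by rewrite subSS mulrC subKn // -ltnS.
(* The series are genuine here, so c = 1, and L only has to exceed k + q and p - k - q. *)
have := @two_sided _ p q aE a' bE b' RE GE 1 L (k + q%:Z) ha hb.
move=> /(_ (fun n _ => etrans (flip _ _ n) (etrans (esym (cR n)) (esym (mul1r _))))).
move=> /(_ (fun n _ => etrans (flip _ _ n) (etrans (esym (cG n)) (esym (mul1r _))))).
have h1 : (k + q%:Z < L%:Z)%R by rewrite /L; lia.
have h2 : (p%:Z - (k + q%:Z) < L%:Z)%R by rewrite /L; lia.
move=> /(_ h1 h2) /(congr1 val); rewrite rmorph0 rmorph_sum => h; apply: etrans h.
apply: eq_bigr => j _; rewrite rmorphM; congr (_ * _); first exact: esym (lftE b gb j).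
exact: esym (val_gE _).
Qed.
End Final.

Theorem theorem1 (R : realType) (A : algType (complex R))
    (gA : bool -> {pred A}) (hA : supercommutative gA)
    (p q : nat) (M : 'M[A]_(p + q)%N)
    (hM : even_op gA M) (hMinv : mx_invertible M) :
  (general_position gA M ->
     exists b : nat -> A,
       [/\ b 0%N = 1, (forall j : nat, (j <= q)%N -> b j \in gA false)
         & forall k : int,
             \sum_(j < q.+1) b j * gam gA M (k + q%:Z - j%:Z) = 0])
  /\ (forall k : int,
        \det (\matrix_(i < q.+1, j < q.+1) gam gA M (k + i%:Z + j%:Z)) = 0).
Proof.
have hC n : n.+1%:R != 0 :> complex R by rewrite Num.Theory.pnatr_eq0.
have hg := supercommutative_superring hC hA.
by split; [apply: (recurrence_gam hg) | apply: (hankel_gam hg)].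
Qed.
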